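(* Let $n\ge 1$, let $\Omega\subset\mathbb{H}^n$ be an open, smooth and bounded subset of the Heisenberg group, let $a\in L^{\infty}(\Omega)$ and $f\in C(\overline{\Omega}\times\mathbb{R},\mathbb{R})$. Let $Q=2n+2$. Assume: (A) $f=f(\xi,y)$ is $C^1$ in the variable $y$ and $f_y(\xi,y)\ge\frac{f(\xi,y)}{y}$ for all $y\in\mathbb{R}$ with $y>0$ and all $\xi\in\Omega$. (B) There exist an exponent $q\ge 1$, with conjugate exponent $q'=\frac{q}{q-1}$, a function $r\in L^{q}(\Omega)\cap L^{q'}(\Omega)$ and a constant $c>0$ with $(c+\|a\|_\infty)\,c_{emb}^2<1$, where $c_{emb}$ is the constant of the embedding of $D$ into $L^q(\Omega)$, such that (i) if $n=1$ (so $Q=4$): $|f(\xi,s)|\le r(\xi)+c|s|^{q-1}$ for a.e. $\xi\in\Omega$ and all $s\in\mathbb{R}$ ($q\geq 1$ being arbitrary); (ii) if $n>1$ (so $Q>4$): $q<\frac{Q+4}{Q-4}$ and $|f(\xi,s)|\le r(\xi)+c|s|^{q}$ for a.e. $\xi\in\Omega$ and all $s\in\mathbb{R}$. (C) $a(\xi)s-f(\xi,s)\ge 0$ for a.e. $\xi\in\Omega$ and all $s\in\mathbb{R}$. Let $u\in D\cap L^\infty(\Omega)$ be a positive solution of $$\Delta_{\mathbb{H}^n}^2u=a(\xi)u-f(\xi,u)\ \text{ in }\Omega,\qquad u>0\ \text{ in }\Omega,\qquad u=0=\Delta_{\mathbb{H}^n}u\ \text{ on }\partial\Omega.$$ Then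 $u$ is semi-stable, i.e. $$\int_\Omega|\Delta_{\mathbb{H}^n}v|^2d\xi-\int_\Omega a(\xi)v^2d\xi+\int_\Omega f_u(\xi,u)v^2d\xi\ge 0\qquad\text{for every } v\in C_c^2(\Omega),$$ where $f_u$ denotes the partial derivative of $f$ with respect to its second variable.
   Context: The Heisenberg group $\mathbb{H}^n$ is $\mathbb{R}^{2n+1}$ with points $\xi=(x,y,t)$, $x,y\in\mathbb{R}^n$, $t\in\mathbb{R}$, and group law $(x,y,t)\cdot(x',y',t')=(x+x',y+y',t+t'+2(\langle y,x'\rangle-\langle x,y'\rangle))$; its homogeneous dimension is $Q=2n+2$, and $d\xi$ is Lebesgue measure on $\mathbb{R}^{2n+1}$. Put $X_i=\frac{\partial}{\partial x_i}+2y_i\frac{\partial}{\partial t}$, $Y_i=\frac{\partial}{\partial y_i}-2x_i\frac{\partial}{\partial t}$ ($1\le i\le n$), $\nabla_{\mathbb{H}^n}=(X_1,\dots,X_n,Y_1,\dots,Y_n)$ and $\Delta_{\mathbb{H}^n}=\sum_{i=1}^n (X_i^2+Y_i^2)$. $D^{2,2}(\Omega)$ is the space of $u:\Omega\to\mathbb{R}$ with $u,|\nabla_{\mathbb{H}^n}u|,|\Delta_{\mathbb{H}^n}u|\in L^2(\Omega)$, with norm $(\|u\|_{L^2}^2+\|\nabla_{\mathbb{H}^n}u\|_{L^2}^2+\|\Delta_{\mathbb{H}^n}u\|_{L^2}^2)^{1/2}$. $D_0^{1,2}(\Omega)$ is the closure of $C_c^\infty(\Omega)$ in the norm $\left(\int_\Omega|\nabla_{\mathbb{H}^n}u|^2d\xi\right)^{1/2}$.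 Set $D=D^{2,2}(\Omega)\cap D_0^{1,2}(\Omega)$, regarded as a Hilbert space with inner product $\langle u,v\rangle=\int_\Omega\Delta_{\mathbb{H}^n}u\,\Delta_{\mathbb{H}^n}v\,d\xi$ and the corresponding norm $\|\cdot\|$; the embedding constant $c_{emb}$ satisfies $\|v\|_{L^q(\Omega)}\le c_{emb}\|v\|$ for all $v\in D$. $C_c^2(\Omega)$ is the space of $C^2$ functions on $\Omega$ with compact support in $\Omega$. Solutions are understood in the weak sense: a solution of the problem is a function $u\in D$ (with $u>0$ in $\Omega$) such that $$\int_\Omega\Delta_{\mathbb{H}^n}u\,\Delta_{\mathbb{H}^n}\phi\,d\xi=\int_\Omega a(\xi)u\phi\,d\xi-\int_\Omega f(\xi,u)\phi\,d\xi\qquad\forall\,\phi\in D$$ (the boundary conditions are understood through this formulation). *)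

(* Defs.v *)
From HB Require Import structures.
From mathcomp Require Import all_boot all_order all_algebra.
From mathcomp Require Import all_classical all_reals all_analysis.

Set Implicit Arguments.
Unset Strict Implicit.
Unset Printing Implicit Defensive.

Import Order.TTheory GRing.Theory Num.Theory.
Import numFieldNormedType.Exports.

Local Open Scope classical_set_scope.
Local Open Scope ring_scope.

Definition mx_display : measure_display. Proof. exact: default_measure_display. Qed.

(** The product sigma-algebra: the Borel sets of R^(m * n). *)
Section measurable_mx.
Context {R : realType} (m n : nat).

Definition mx_coord (ij : 'I_m * 'I_n) (A : 'M[R]_(m, n)) : measurableTypeR R :=
  A ij.1 ij.2.

Definition mx_measurable : set (set 'M[R]_(m, n)) :=
  <<s \bigcup_ij preimage_set_system setT (mx_coord ij) measurable >>.

Let mx_measurable0 : mx_measurable set0.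
Proof. exact: sigma_algebra0. Qed.

Let mx_measurableC A : mx_measurable A -> mx_measurable (~` A).
Proof. exact: sigma_algebraC. Qed.

Let mx_measurable_bigcup (F : (set 'M[R]_(m, n))^nat) :
  (forall i, mx_measurable (F i)) -> mx_measurable (\bigcup_i F i).
Proof. exact: sigma_algebra_bigcup. Qed.

HB.instance Definition _ := @isMeasurable.Build mx_display 'M[R]_(m, n)
  mx_measurable mx_measurable0 mx_measurableC mx_measurable_bigcup.

Lemma measurable_mx_coord ij : measurable_fun [set: 'M[R]_(m, n)] (mx_coord ij).
Proof.
move=> _ Y mY; rewrite setTI; apply: sub_sigma_algebra; exists ij => //.
by exists Y => //; rewrite setTI.
Qed.

Lemma measurable_fun_mxP d (T : measurableType d) (f : T -> 'M[R]_(m, n)) :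
  (forall ij, measurable_fun setT (mx_coord ij \o f)) -> measurable_fun setT f.
Proof.
move=> mf; apply: (@measurability _ _ _ _ setT f
  (\bigcup_ij preimage_set_system setT (mx_coord ij) measurable)) => //.
move=> _ [_ [ij _ [Y mY <-]] <-].
by rewrite !setTI -comp_preimage -[X in measurable X]setTI; exact: mf.
Qed.

End measurable_mx.

Lemma product_sigma_finite d1 d2 (T1 : measurableType d1)
    (T2 : measurableType d2) (R : realType)
    (m1 : {sigma_finite_measure set T1 -> \bar R})
    (m2 : {sigma_finite_measure set T2 -> \bar R}) :
  sigma_finite setT (m1 \x m2)%E.
Proof.
have /sigma_finiteP[F [TF ndF Foo]] := sigma_finiteT m1.
have /sigma_finiteP[G [TG ndG Goo]] := sigma_finiteT m2.
exists (fun n => F n `*` G n).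
  rewrite -setXTT TF TG predeqE => -[x y]; split.
    move=> [/= [n _ Fnx] [k _ Gky]]; exists (maxn n k) => //; split.
    - by move: x Fnx; exact/subsetPset/ndF/leq_maxl.
    - by move: y Gky; exact/subsetPset/ndG/leq_maxr.
  by move=> [n _ []/= ? ?]; split; exists n.
move=> k; have [? ?] := Foo k; have [? ?] := Goo k; split.
  exact: measurableX.
by rewrite product_measure1E// lte_mul_pinfty// ge0_fin_numE.
Qed.

(** Lebesgue measure on R^n as an iterated product measure. *)
Section lebesgue_rV.
Context {R : realType}.

Definition rV_cons n (p : measurableTypeR R * 'rV[R]_n) : 'rV[R]_n.+1 :=
  \row_j oapp (p.2 0) p.1 (unlift ord0 j).

Definition rV_uncons n (v : 'rV[R]_n.+1) : measurableTypeR R * 'rV[R]_n :=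
  (v 0 ord0, \row_j v 0 (lift ord0 j)).

Lemma rV_consK n : cancel (@rV_cons n) (@rV_uncons n).
Proof.
case=> a v; rewrite /rV_cons /rV_uncons /=; congr pair.
  by rewrite mxE unlift_none.
by apply/rowP => j; rewrite !mxE liftK.
Qed.

Lemma rV_unconsK n : cancel (@rV_uncons n) (@rV_cons n).
Proof.
move=> v; apply/rowP => j; rewrite mxE.
by case: unliftP => [k ->|->] //=; rewrite mxE.
Qed.

Lemma measurable_rV_cons n : measurable_fun setT (@rV_cons n).
Proof.
apply: measurable_fun_mxP => -[i j]; rewrite ord1 {i}.
have -> : mx_coord (0, j) \o @rV_cons n =
    fun p => oapp (p.2 0) p.1 (unlift ord0 j).
  by apply/funext => p; rewrite /mx_coord /= mxE.
case: unliftP => [k _|_] /=; last exact: measurable_fst.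
rewrite (_ : (fun _ => _) = mx_coord (0, k) \o snd)//.
by apply: measurableT_comp; [exact: measurable_mx_coord|exact: measurable_snd].
Qed.

Lemma measurable_rV_uncons n : measurable_fun setT (@rV_uncons n).
Proof.
apply: measurable_fun_pair; first exact: (measurable_mx_coord (0, ord0)).
apply: measurable_fun_mxP => -[i j].
rewrite (_ : _ \o _ = mx_coord (0, lift ord0 j)).
  exact: measurable_mx_coord.
by apply/funext => v; rewrite /mx_coord /= mxE.
Qed.

Section step.
Context n (mu : {sigma_finite_measure set 'rV[R]_n -> \bar R}).

Definition rV_cons_measure : set 'rV[R]_n.+1 -> \bar R :=
  pushforward (lebesgue_measure \x mu)%E (@rV_cons n).

Let rV_cons_measure0 : rV_cons_measure set0 = 0%E.
Proof. by rewrite /rV_cons_measure /pushforward preimage_set0 measure0. Qed.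

Let rV_cons_measure_ge0 A : (0 <= rV_cons_measure A)%E.
Proof. by rewrite /rV_cons_measure /pushforward; exact: measure_ge0. Qed.

Let rV_cons_measure_sigma_additive : semi_sigma_additive rV_cons_measure.
Proof.
move=> F mF tF mUF; rewrite /rV_cons_measure /pushforward preimage_bigcup.
apply: measure_semi_sigma_additive.
- by move=> k; rewrite -[X in measurable X]setTI; exact: measurable_rV_cons.
- apply/trivIsetP => /= i j _ _ ij; rewrite -preimage_setI.
  by move/trivIsetP : tF => /(_ _ _ _ _ ij) ->//; rewrite preimage_set0.
- rewrite -preimage_bigcup -[X in measurable X]setTI.
  exact: measurable_rV_cons.
Qed.

HB.instance Definition _ := isMeasure.Build _ _ _ rV_cons_measure
  rV_cons_measure0 rV_cons_measure_ge0 rV_cons_measure_sigma_additive.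

Let rV_cons_measure_sigma_finite : sigma_finite setT rV_cons_measure.
Proof.
have [F TF Foo] := product_sigma_finite (@lebesgue_measure R) mu.
exists (fun k => @rV_uncons n @^-1` F k).
  by rewrite -preimage_bigcup -TF preimage_setT.
move=> k; have [mF Fk] := Foo k; split.
  by rewrite -[X in measurable X]setTI; exact: measurable_rV_uncons.
rewrite /rV_cons_measure /pushforward -comp_preimage.
by rewrite (_ : _ \o _ = id)//; apply/funext; exact: rV_consK.
Qed.

HB.instance Definition _ := Measure_isSigmaFinite.Build _ _ _ rV_cons_measure
  rV_cons_measure_sigma_finite.

End step.

Fixpoint lebesgue_rV n : {sigma_finite_measure set 'rV[R]_n -> \bar R} :=
  match n with
  | 0 => \d_(0 : 'rV[R]_0)
  | n'.+1 => rV_cons_measure (lebesgue_rV n')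
  end.

Lemma lebesgue_rV_box n (B : 'I_n -> set R) :
  (forall i, measurable (B i : set (measurableTypeR R))) ->
  lebesgue_rV n [set v | forall i, B i (v 0 i)] =
  (\prod_(i < n) lebesgue_measure (B i))%E.
Proof.
elim: n B => [|n IH] B mB /=.
  rewrite big_ord0 diracE mem_set//; by case.
have mB' : measurable [set v : 'rV[R]_n | forall i, B (lift ord0 i) (v 0 i)].
  rewrite [X in measurable X](_ : _ = \bigcap_(i in [set: 'I_n])
      ([set: 'rV[R]_n] `&` mx_coord (0, i) @^-1` B (lift ord0 i))).
    apply: fin_bigcap_measurable => //.
    by move=> i _; apply: measurable_mx_coord.
  by apply/seteqP; split=> [v /= h i _|v h i]; [split=> //; exact: h|exact: (h i I).2].
rewrite big_ord_recl -IH// -product_measure1E//.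
rewrite /rV_cons_measure /pushforward; congr ((_ \x _)%E _).
apply/seteqP; split=> -[a v] /=.
  move=> h; split=> [|i]; first by have := h ord0; rewrite mxE unlift_none.
  by have := h (lift ord0 i); rewrite mxE liftK.
by move=> [h1 h2] i; rewrite mxE; case: unliftP => [k ->|->].
Qed.

End lebesgue_rV.

(** A point [xi = (x, y, t)] has components [xi.1.1], [xi.1.2] and [xi.2]. *)
Notation heisenberg R n := ('rV[R]_n * 'rV[R]_n * R)%type.

(** Lebesgue measure [dx dy dt]. *)
Definition vol {R : realType} {n : nat} :
    {measure set ('rV[R]_n * 'rV[R]_n * measurableTypeR R) -> \bar R} :=
  ((lebesgue_rV n \x lebesgue_rV n) \x lebesgue_measure)%E.

Section smoothness.
Context {R : realType} {V : normedModType R}.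

(** [f] is of class C^k on the open set [U]: the derivatives of order at most
    [k], in all directions, exist and are continuous on [U]. *)
Fixpoint Ck (U : set V) (k : nat) (f : V -> R) : Prop :=
  (forall x, U x -> {for x, continuous f}) /\
  match k with
  | 0 => True
  | k'.+1 => forall v, (forall x, U x -> derivable f x v) /\
                       Ck U k' (fun x => 'D_v f x)
  end.

Definition Cinf (U : set V) (f : V -> R) := forall k, Ck U k f.

Definition compact_support_in (Omega : set V) (f : V -> R) :=
  exists K, [/\ compact K, K `<=` Omega & forall x, ~ K x -> f x = 0].

(** Functions with compact support in [Omega] are extended by zero. *)
Definition Ckc (Omega : set V) (k : nat) : set (V -> R) :=
  [set f | Ck setT k f /\ compact_support_in Omega f].

Definition Cinfc (Omega : set V) : set (V -> R) :=
  [set f | Cinf setT f /\ compact_support_in Omega f].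

(** Smooth boundary: near each boundary point, [Omega] is the negativity set of
    a C^infinity function with non-vanishing differential. *)
Definition smooth_boundary (Omega : set V) :=
  forall p, closure Omega p -> ~ interior Omega p ->
  exists (U : set V) (rho : V -> R),
    [/\ open U, U p, Cinf U rho, (exists v, 'D_v rho p != 0)
      & forall x, U x -> (Omega x <-> rho x < 0)].

End smoothness.

Section horizontal.
Context {R : realType} {n : nat}.
Notation H := (heisenberg R n).
Implicit Types (u v w : H -> R) (xi : H).

Definition dir_x (i : 'I_n) : H := (delta_mx 0 i, 0, 0).
Definition dir_y (i : 'I_n) : H := (0, delta_mx 0 i, 0).
Definition dir_t : H := (0, 0, 1).

Definition fieldX (i : 'I_n) u : H -> R :=
  fun xi => 'D_(dir_x i) u xi + 2 * xi.1.2 0 i * 'D_dir_t u xi.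

Definition fieldY (i : 'I_n) u : H -> R :=
  fun xi => 'D_(dir_y i) u xi - 2 * xi.1.1 0 i * 'D_dir_t u xi.

(** The components [X_1, ..., X_n, Y_1, ..., Y_n] of the horizontal gradient. *)
Definition hgrad (k : 'I_n + 'I_n) u : H -> R :=
  match k with inl i => fieldX i u | inr i => fieldY i u end.

Definition sublap u : H -> R :=
  fun xi => \sum_i (fieldX i (fieldX i u) xi + fieldY i (fieldY i u) xi).

End horizontal.

Definition homogeneous_dim (n : nat) : nat := (2 * n + 2)%N.

Section function_spaces.
Context {R : realType} {n : nat}.
Notation H := (heisenberg R n).
Variable Omega : set H.
Implicit Types (u v w g phi : H -> R) (xi : H).

Definition norm_L (p : \bar R) u : \bar R :=
  'N[vol]_p[(EFin \o u) \_ Omega].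

Definition space_L (p : \bar R) : set (H -> R) :=
  [set u | measurable_fun
             (Omega : set ('rV[R]_n * 'rV[R]_n * measurableTypeR R)) u /\
           (norm_L p u < +oo)%E].

(** Distributional derivatives. The fields [X_i], [Y_i] are divergence free, so
    that their formal adjoints are [- X_i], [- Y_i], and the sub-Laplacian is
    formally self-adjoint. *)
Definition is_weak_hgrad (k : 'I_n + 'I_n) u g :=
  forall phi, Cinfc Omega phi ->
  (\int[vol]_(xi in Omega) (u xi * hgrad k phi xi)%:E =
   - \int[vol]_(xi in Omega) (g xi * phi xi)%:E)%E.

Definition is_weak_sublap u w :=
  forall phi, Cinfc Omega phi ->
  (\int[vol]_(xi in Omega) (u xi * sublap phi xi)%:E =
   \int[vol]_(xi in Omega) (w xi * phi xi)%:E)%E.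

(** Chosen representatives in L^2 of the weak derivatives, which are unique up
    to null sets; zero when there is none. *)
Definition weak_hgrad k u : H -> R :=
  xget (fun=> 0) [set g | space_L 2%:E g /\ is_weak_hgrad k u g].

Definition weak_sublap u : H -> R :=
  xget (fun=> 0) [set w | space_L 2%:E w /\ is_weak_sublap u w].

Definition has_weak_hgrad u :=
  forall k, exists g, space_L 2%:E g /\ is_weak_hgrad k u g.

Definition D22 : set (H -> R) :=
  [set u | [/\ space_L 2%:E u, has_weak_hgrad u
             & exists w, space_L 2%:E w /\ is_weak_sublap u w]].

(** The closure of the test functions in the norm [||grad u||_2]. This is a norm
    on test functions only (it vanishes on constants), so the limit of a Cauchy
    sequence is identified by its convergence in L^2, which is automatic for
    bounded [Omega] by the Poincare inequality. *)
Definition D012 : set (H -> R) :=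
  [set u | [/\ space_L 2%:E u, has_weak_hgrad u & exists phi : (H -> R)^nat,
    [/\ forall m, Cinfc Omega (phi m),
        (fun m => norm_L 2%:E (phi m \- u)) @ \oo --> 0%E
      & (fun m => \int[vol]_(xi in Omega)
           (\sum_k (hgrad k (phi m) xi - weak_hgrad k u xi) ^+ 2)%:E)%E
          @ \oo --> 0%E]]].

Definition space_D : set (H -> R) := D22 `&` D012.

Definition inner_D u v : \bar R :=
  \int[vol]_(xi in Omega) (weak_sublap u xi * weak_sublap v xi)%:E.

Definition norm_D u : \bar R := norm_L 2%:E (weak_sublap u).

Definition embedding_constant (q C : R) :=
  forall v, space_D v -> (norm_L q%:E v <= C%:E * norm_D v)%E.

Definition weak_solution (a : H -> R) (f : H -> R -> R) u :=
  space_D u /\ forall phi, space_D phi ->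
  (inner_D u phi =
   \int[vol]_(xi in Omega) (a xi * u xi * phi xi)%:E -
   \int[vol]_(xi in Omega) (f xi (u xi) * phi xi)%:E)%E.

Definition ae_in (P : H -> Prop) := {ae vol, forall xi : H, Omega xi -> P xi}.

(** Since [f_u] is only assumed continuous in its second variable, the last
    integral may be [+oo] and is taken in [\bar R]. *)
Definition semi_stable (a : H -> R) (f : H -> R -> R) u :=
  forall v, Ckc Omega 2 v ->
  (0 <= \int[vol]_(xi in Omega) (`|sublap v xi| ^+ 2)%:E
        - \int[vol]_(xi in Omega) (a xi * v xi ^+ 2)%:E
        + \int[vol]_(xi in Omega) ((f xi)^`()%classic (u xi) * v xi ^+ 2)%:E)%E.

End function_spaces.

(* Main.v *)
Require Import Defs.
From HB Require Import structures.
From mathcomp Require Import all_boot all_order all_algebra.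
From mathcomp Require Import all_classical all_reals all_analysis.
From mathcomp Require Import measurable_realfun.
From mathcomp Require Import ring lra.
Import Order.TTheory GRing.Theory Num.Theory.
Import numFieldNormedType.Exports.
Local Open Scope classical_set_scope.
Local Open Scope ring_scope.
Set Implicit Arguments.
Unset Strict Implicit.
Unset Printing Implicit Defensive.

(** With [w = - Delta u] and [g = a u - f(., u) >= 0], the equation splits weakly into
    [- Delta u = w], [- Delta w = g]. Let [U], [W], [G] be the smoothings of [u], [w], [g]
    by a kernel depending on [x y^-1]; such kernels commute with the fields [X_i], [Y_i], so
    [- Delta U = W] and [- Delta W = G] hold pointwise near the support of [v]. Moreover
    [W >= 0]: minimising the Dirichlet functional over test functions yields [phi >= 0]
    in [D] with [- Delta phi = K(x, .)], and testing the equation with [phi] gives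
    [W x = int g phi]. Picone's inequality [- W Delta (v^2 / (U + e)) <= (Delta v)^2],
    integrated by parts, becomes [int G v^2 / (U + e) <= int (Delta v)^2], and Fatou's
    lemma leads to [int g v^2 / u <= int (Delta v)^2]. By (A), [f_u >= f / u = a - g / u]
    at [u], which is the claim. *)

(** The classical argument tests the equation with v^2 / u, but [u] is merely a weak solution: no
    regularity and no positive lower bound are at hand, and the boundary conditions exist only
    through the test space D. Smoothing makes every function in Picone's argument classical. The
    resulting identities hold only at points x for which K(x, .) is supported in [Omega]; as v has
    compact support there, these points are enough. The constant e keeps U + e positive on the whole
    space, so that v^2 / (U + e) is C^2. Commutation rests on (x z)(y z)^-1 = x y^-1: the fields
    X_i, Y_i generate the right translations, so a derivative of the kernel in x is minus its
    derivative in y, and for second derivatives the signs cancel. The sign of W is a maximum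
    principle obtained by duality. Nothing is known about w beyond L^2, but the Dirichlet problem
    with right-hand side K(x, .) has a solution in D, which is admissible in the weak equation. It
    is an L^2 limit of test functions already made nonnegative, so its sign comes with the
    construction. *)

(** * Functions of class C^k on a normed space *)

Section Ck_calculus.
Context {R : realType} {V : normedModType R}.
Implicit Types (f g : V -> R) (x v w : V) (k : nat).

(** Restricting to the line through [x] makes the one-variable rules, the chain rule above all,
    available on any normed space. *)
Lemma is_deriveP f x v (l : R) :
  is_derive x v f l <-> is_derive (0 : R) (1 : R) (fun h : R => f (h *: v + x)) l.
Proof.
suff E : (fun h : R => h^-1 *: ((f \o shift x) (h *: v) - f x)) =
    (fun h : R => h^-1 *: (((fun h : R => f (h *: v + x)) \o shift 0) (h *: (1 : R))
       - f (0 *: v + x))).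
  split=> -[df lE].
    by split; [exact: (derivable1P _ _ _).1|rewrite -lE /derive E].
  by split; [exact: (derivable1P _ _ _).2|rewrite -lE /derive E].
by apply/funext => h /=; rewrite addr0 scale0r add0r [_%:A]mulr1.
Qed.

Lemma is_derive_line f x v (s : R) (l : R) :
  is_derive (s *: v + x) v f l ->
  is_derive (s : R) (1 : R) (fun h : R => f (h *: v + x)) l.
Proof.
move=> /is_deriveP fl.
have h1 : is_derive (s : R) (1 : R) (fun h : R => h - s) 1.
  have := is_deriveB (is_derive_id (s : R) (1 : R)) (is_derive_cst s (s : R) (1 : R)).
  by rewrite subr0.
have := @is_derive1_comp R (fun h : R => f (h *: v + (s *: v + x))) (fun h => h - s)
  s l 1.
rewrite subrr mulr1 => /(_ fl h1).
rewrite (_ : _ \o _ = (fun h : R => f (h *: v + x)))//.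
by apply/funext => h /=; rewrite addrA -scalerDl subrK.
Qed.

Lemma is_derive_comp1 (g : R -> R) f x v (dg df : R) :
  is_derive (f x) 1 g dg -> is_derive x v f df ->
  is_derive x v (fun y => g (f y)) (dg * df).
Proof.
move=> hg /is_deriveP hf; apply/is_deriveP.
have := @is_derive1_comp R g (fun h : R => f (h *: v + x)) 0 dg df.
by rewrite scale0r add0r; apply.
Qed.

Lemma is_deriveM' f g x v (df dg : R) :
  is_derive x v f df -> is_derive x v g dg ->
  is_derive x v (fun y => f y * g y) (df * g x + f x * dg).
Proof.
move=> hf hg; have h := is_deriveM hf hg.
by rewrite (_ : df * g x + _ = f x *: dg + g x *: df)// addrC (mulrC df).
Qed.

Lemma is_deriveD' f g x v (df dg : R) :
  is_derive x v f df -> is_derive x v g dg ->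
  is_derive x v (fun y => f y + g y) (df + dg).
Proof. by move=> hf hg; have := is_deriveD hf hg. Qed.

Lemma Ck_cont k f : Ck setT k f -> continuous f.
Proof. by case: k => [|k] [cf _] x; exact: cf. Qed.

Lemma Ck_at k f x : Ck setT k f -> {for x, continuous f}.
Proof. by move=> /Ck_cont cf; exact: cf. Qed.

Lemma Ck_derivable k f x v : Ck setT k.+1 f -> derivable f x v.
Proof. by move=> [_ /(_ v)[df _]]; exact: df. Qed.

Lemma Ck_is_derive k f x v : Ck setT k.+1 f -> is_derive x v f ('D_v f x).
Proof. by move=> /Ck_derivable df; exact/derivableP. Qed.

Lemma CkD1 k f v : Ck setT k.+1 f -> Ck setT k ('D_v f).
Proof. by move=> [_ /(_ v)[]]. Qed.

(** [Ck] recurs on the function ['D_v f] itself. Here the caller supplies a closed formula for it,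
    and the regularity of that formula is what the inductions below prove. *)
Lemma CkI k f (df : V -> V -> R) : continuous f ->
  (forall v x, is_derive x v f (df v x)) -> (forall v, Ck setT k (df v)) ->
  Ck setT k.+1 f.
Proof.
move=> cf hdf cdf; split=> [x _|v]; first exact: cf.
split=> [x _|]; first by have [] := hdf v x.
rewrite (_ : (fun x => 'D_v f x) = df v)//.
by apply/funext => x; have [_ ->] := hdf v x.
Qed.

Lemma CkS k f : Ck setT k.+1 f -> Ck setT k f.
Proof.
elim: k f => [|k IH] f; first by move=> [].
move=> hf; apply: (@CkI _ _ (fun v => 'D_v f)).
- exact: Ck_cont hf.
- by move=> v x; exact: Ck_is_derive hf.
- by move=> v; apply: IH; exact: CkD1.
Qed.

Lemma Ck_le k l f : (k <= l)%N -> Ck setT l f -> Ck setT k f.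
Proof.
move=> kl; rewrite -(subnK kl); elim: (l - k)%N => [|m IH]//.
by rewrite addSn => /CkS.
Qed.

Lemma Ck_cst k (c : R) : Ck setT k (fun _ : V => c).
Proof.
elim: k c => [|k IH] c; first by split=> // x _; exact: cst_continuous.
by apply: (@CkI _ _ (fun _ _ => 0)) => //; exact: cst_continuous.
Qed.

Lemma CkD k f g : Ck setT k f -> Ck setT k g -> Ck setT k (fun x => f x + g x).
Proof.
elim: k f g => [|k IH] f g hf hg.
  by split=> // x _; apply: continuousD; [exact: Ck_at hf|exact: Ck_at hg].
apply: (@CkI _ _ (fun v x => 'D_v f x + 'D_v g x)).
- by move=> x; apply: continuousD; [exact: Ck_at hf|exact: Ck_at hg].
- by move=> v x; apply: is_deriveD'; [exact: Ck_is_derive hf|exact: Ck_is_derive hg].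
- by move=> v; apply: IH; exact: CkD1.
Qed.

Lemma CkM k f g : Ck setT k f -> Ck setT k g -> Ck setT k (fun x => f x * g x).
Proof.
elim: k f g => [|k IH] f g hf hg.
  by split=> // x _; apply: continuousM; [exact: Ck_at hf|exact: Ck_at hg].
apply: (@CkI _ _ (fun v x => 'D_v f x * g x + f x * 'D_v g x)).
- by move=> x; apply: continuousM; [exact: Ck_at hf|exact: Ck_at hg].
- by move=> v x; apply: is_deriveM'; [exact: Ck_is_derive hf|exact: Ck_is_derive hg].
- by move=> v; apply: CkD; apply: IH; do ?[exact: CkD1|exact: CkS].
Qed.

Lemma CkZ k (c : R) f : Ck setT k f -> Ck setT k (fun x => c * f x).
Proof. by move=> hf; apply: CkM => //; exact: Ck_cst. Qed.

Lemma CkN k f : Ck setT k f -> Ck setT k (fun x => - f x).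
Proof.
move=> /(CkZ (-1)); rewrite (_ : (fun _ => _) = (fun x => - f x))//.
by apply/funext => x; rewrite mulN1r.
Qed.

Lemma CkB k f g : Ck setT k f -> Ck setT k g -> Ck setT k (fun x => f x - g x).
Proof. by move=> hf hg; apply: CkD => //; exact: CkN. Qed.

Lemma CkX k n f : Ck setT k f -> Ck setT k (fun x => f x ^+ n).
Proof.
move=> hf; elim: n => [|n IH].
  rewrite (_ : (fun _ => _) = (fun=> 1)); first exact: Ck_cst.
  by apply/funext => x; rewrite expr0.
rewrite (_ : (fun _ => _) = (fun x => f x * f x ^+ n)); first exact: CkM.
by apply/funext => x; rewrite exprS.
Qed.

Lemma Ck_sum k (I : Type) (s : seq I) (F : I -> V -> R) :
  (forall i, Ck setT k (F i)) -> Ck setT k (fun x => \sum_(i <- s) F i x).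
Proof.
move=> hF; elim: s => [|i s IH].
  rewrite (_ : (fun _ => _) = (fun=> 0)); first exact: Ck_cst.
  by apply/funext => x; rewrite big_nil.
rewrite (_ : (fun _ => _) = (fun x => F i x + \sum_(j <- s) F j x)).
  exact: CkD.
by apply/funext => x; rewrite big_cons.
Qed.

Lemma CkV k f : (forall x, f x != 0) -> Ck setT k f ->
  Ck setT k (fun x => (f x)^-1).
Proof.
move=> f0; elim: k => [|k IH] hf.
  by split=> // x _; apply: continuousV; [exact: f0|exact: Ck_at hf].
apply: (@CkI _ _ (fun v x => - ((f x)^-1 * (f x)^-1) * 'D_v f x)).
- by move=> x; apply: continuousV; [exact: f0|exact: Ck_at hf].
- move=> v x; split; first by apply: derivableV => //; exact: Ck_derivable hf.
  rewrite deriveV//; last exact: Ck_derivable hf.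
  rewrite /GRing.scale/=.
  by rewrite expr2 invfM.
- move=> v; apply: CkM; last exact: CkD1.
  by apply: CkN; apply: CkM; apply: IH; exact: CkS.
Qed.

Lemma Ck_linear k f : continuous f -> (forall x v h, f (h *: v + x) = h * f v + f x) ->
  Ck setT k f.
Proof.
move=> cf lf; case: k => [|k]; first by split => // x _; exact: cf.
apply: (@CkI _ _ (fun v _ => f v)) => //; last by move=> v; exact: Ck_cst.
move=> v x; apply/is_deriveP.
rewrite (_ : (fun _ => _) = (fun h : R => h * f v + f x)); last first.
  by apply/funext => h.
have h := is_deriveD (is_deriveM (@is_derive_id _ _ (0 : R) (1 : R))
  (is_derive_cst (f v) (0 : R) (1 : R))) (is_derive_cst (f x) (0 : R) (1 : R)).
by move: h; rewrite addr0 scale0r add0r [X in is_derive _ _ _ X]mulr1.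
Qed.

End Ck_calculus.

Section Ck_composition.
Context {R : realType} {V W : normedModType R}.

Lemma Ck_comp1 k (g : R -> R) (f : V -> R) :
  Ck setT k g -> Ck setT k f -> Ck setT k (fun x => g (f x)).
Proof.
elim: k g f => [|k IH] g f hg hf.
  split=> // x _; apply: continuous_comp; first exact: Ck_at hf.
  exact: Ck_at hg.
apply: (@CkI _ _ _ _ (fun v x => 'D_1 g (f x) * 'D_v f x)).
- move=> x; apply: continuous_comp; first exact: Ck_at hf.
  exact: Ck_at hg.
- by move=> v x; apply: is_derive_comp1; [exact: Ck_is_derive hg|exact: Ck_is_derive hf].
- move=> v; apply: CkM; last exact: CkD1.
  by apply: (IH ('D_1 g) f); [exact: CkD1|exact: CkS].
Qed.

(** [A] is the linear part of the affine map [L]. The cases in view are the slices x -> (x, y) and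
    the projections of a product. *)
Lemma is_derive_affine (f : W -> R) (L : V -> W) (A : V -> W) x v l :
  (forall (x v : V) h, L (h *: v + x) = h *: A v + L x) ->
  is_derive (L x) (A v) f l -> is_derive x v (fun y => f (L y)) l.
Proof.
move=> LA /is_deriveP hf; apply/is_deriveP.
by rewrite (_ : (fun _ => _) = (fun h : R => f (h *: A v + L x)))//;
  apply/funext => h; rewrite LA.
Qed.

Lemma Ck_affine k (f : W -> R) (L : V -> W) (A : V -> W) : continuous L ->
  (forall (x v : V) h, L (h *: v + x) = h *: A v + L x) ->
  Ck setT k f -> Ck setT k (fun y => f (L y)).
Proof.
move=> cL LA; elim: k f => [|k IH] f hf.
  split=> // x _; apply: continuous_comp; first exact: cL.
  exact: Ck_at hf.
apply: (@CkI _ _ _ _ (fun v x => 'D_(A v) f (L x))).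
- move=> x; apply: continuous_comp; first exact: cL.
  exact: Ck_at hf.
- by move=> v x; apply: is_derive_affine LA _; exact: Ck_is_derive hf.
- by move=> v; apply: (IH ('D_(A v) f)); exact: CkD1.
Qed.

End Ck_composition.

(** * Mean values along lines, and linearity in the direction *)

Section Ck_derivative.
Context {R : realType} {V : normedModType R}.
Implicit Types (f : V -> R) (x v w : V).

Lemma mvt_line f x v (h : R) : Ck setT 1 f ->
  exists2 s : R, `|s| <= `|h| & f (h *: v + x) - f x = h * 'D_v f (s *: v + x).
Proof.
move=> hf; set F := fun s : R => f (s *: v + x).
have dF (s : R) : is_derive s 1 F ('D_v f (s *: v + x)).
  by apply: is_derive_line; exact: Ck_is_derive hf.
have cF : continuous F.
  by move=> s; apply: differentiable_continuous; apply/derivable1_diffP; have [] := dF s.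
have F0 : F 0 = f x by rewrite /F scale0r add0r.
case: (ltgtP h 0) => [h0|h0|->].
- have dF' y : y \in `]h, 0[%R -> is_derive y 1 F ('D_v f (y *: v + x)).
    by move=> _; exact: dF.
  have [c + E] := MVT h0 dF' (continuous_subspaceT cF).
  rewrite in_itv/= => /andP[hc c0]; exists c.
    by rewrite !ltr0_norm// lerN2 ltW.
  by move: E; rewrite F0 sub0r mulrN => /eqP; rewrite -eqr_oppLR opprB mulrC => /eqP.
- have dF' y : y \in `]0, h[%R -> is_derive y 1 F ('D_v f (y *: v + x)).
    by move=> _; exact: dF.
  have [c + E] := MVT h0 dF' (continuous_subspaceT cF).
  rewrite in_itv/= => /andP[hc c0]; exists c.
    by rewrite !gtr0_norm// ltW.
  by move: E; rewrite F0 subr0 [h * _]mulrC /F => <-.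
- by exists 0 => //; rewrite scale0r add0r subrr mul0r.
Qed.

(** [Ck] provides derivatives in each direction separately, so additivity is not free. The increment
    along [a *: v + w] splits into a step along [w] from [x] ([F]) and one along [v] from the moved
    point ([G]); the mean value theorem and the continuity of ['D_v f] at [x] handle the second. *)
Lemma derive_linear_dir f x v w (a : R) : Ck setT 1 f ->
  'D_(a *: v + w) f x = a * 'D_v f x + 'D_w f x.
Proof.
move=> hf.
suff h : is_derive x (a *: v + w) f (a * 'D_v f x + 'D_w f x) by have [_ ->] := h.
have dv := @Ck_is_derive _ _ 0 f x.
have key : (fun h : R => h^-1 *: ((f \o shift x) (h *: (a *: v + w)) - f x)) @ 0^'
   --> a * 'D_v f x + 'D_w f x.
  pose F (h : R) := h^-1 *: (f (h *: w + x) - f x) : R.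
  pose G (h : R) := h^-1 *: (f ((h * a) *: v + (h *: w + x)) - f (h *: w + x)) : R.
  have -> : (fun h : R => h^-1 *: ((f \o shift x) (h *: (a *: v + w)) - f x))
       = (fun h => G h + F h).
    apply/funext => h; rewrite /G /F /= -scalerDr; congr (_ *: _).
    by rewrite scalerDr scalerA addrA addrA subrK.
  apply: cvgD; last by have [dw _] := dv w hf; exact: dw.
  have cD : {for x, continuous ('D_v f)} by exact: (Ck_cont (CkD1 v hf)).
  apply/cvgrPdist_le => e e0.
  have e1 : 0 < e / (`|a| + 1) by rewrite divr_gt0// ltr_wpDl.
  move/cvgrPdist_le : cD => /(_ _ e1) /nbhs_ballP[d /= d0 hd].
  near=> h.
  have [s hs] := mvt_line (h *: w + x) v (h * a) hf.
  rewrite /G => ->.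
  have h0 : h != 0 by near: h; exact: nbhs_dnbhs_neq.
  rewrite /GRing.scale/= !mulrA mulVf// mul1r -mulrBr normrM.
  have : `|'D_v f x - 'D_v f (s *: v + (h *: w + x))| <= e / (`|a| + 1).
    apply: hd; rewrite -ball_normE /=.
    have -> : x - (s *: v + (h *: w + x)) = - (s *: v + h *: w).
      by rewrite addrA opprD addrCA subrr addr0.
    rewrite normrN (le_lt_trans (ler_normD _ _))// !normrZ.
    rewrite (@le_lt_trans _ _ (`|h| * (`|a| * `|v| + `|w|)))//.
      by rewrite mulrDr lerD// mulrA ler_wpM2r// -normrM.
    have : `|h| < d / (`|a| * `|v| + `|w| + 1).
      near: h. apply: dnbhs0_lt; by rewrite divr_gt0// ltr_wpDl// addr_ge0// mulr_ge0.
    rewrite ltr_pdivlMr; last by rewrite ltr_wpDl// addr_ge0// mulr_ge0.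
    by apply: le_lt_trans; rewrite ler_wpM2l// lerDl.
  move=> /(ler_wpM2l (normr_ge0 a)) /le_trans; apply.
  rewrite mulrA ler_pdivrMr; last by rewrite ltr_wpDl.
  by rewrite mulrDr mulr1 mulrC lerDl (ltW e0).
by split; [apply/cvg_ex; eexists; exact: key|exact: cvg_lim key].
Unshelve. all: by end_near. Qed.

Lemma derive_add_dir f x v w : Ck setT 1 f -> 'D_(v + w) f x = 'D_v f x + 'D_w f x.
Proof. by move=> hf; rewrite -[v in LHS]scale1r derive_linear_dir// mul1r. Qed.

End Ck_derivative.

Lemma Ck_sqrt {R : realType} {V : normedModType R} k (f : V -> R) :
  (forall x, 0 < f x) -> Ck setT k f -> Ck setT k (fun x => Num.sqrt (f x)).
Proof.
move=> f0; elim: k => [|k IH] hf.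
  split=> // x _; apply: continuous_comp; first exact: Ck_at hf.
  exact: sqrt_continuous.
apply: (@CkI _ _ _ _ (fun v x => (2 * Num.sqrt (f x))^-1 * 'D_v f x)).
- move=> x; apply: continuous_comp; first exact: Ck_at hf.
  exact: sqrt_continuous.
- move=> v x; apply: is_derive_comp1; last exact: Ck_is_derive hf.
  exact: is_derive1_sqrt.
- move=> v; apply: CkM; last exact: CkD1.
  apply: CkV; last by apply: CkZ; apply: IH; exact: CkS.
  by move=> x; rewrite mulf_neq0// gt_eqF// sqrtr_gt0.
Qed.

(** * A smooth function vanishing exactly on the nonpositive reals *)

Section smooth_step.
Context {R : realType}.
Implicit Types (p : {poly R}) (s : R).

(* Every derivative of [exp (- 1 / s)] is of this form. *)
Definition polyexp p s : R := if 0 < s then p.[s^-1] * expR (- s^-1) else 0.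

Lemma expX_le (n : nat) (y : R) : 0 <= y -> y ^+ n <= n`!%:R * expR y.
Proof.
move=> y0; case: n => [|n].
  by rewrite expr0 fact0 mul1r -[1](@expR0 R) ler_expR.
have := expR_ge1Dxn n y0.
have f0 : (0 : R) < (n.+1)`!%:R by rewrite ltr0n fact_gt0.
move=> h; have : y ^+ n.+1 / (n.+1)`!%:R <= expR y.
  by apply: le_trans h; rewrite lerDr.
by rewrite ler_pdivrMr// mulrC.
Qed.

Lemma poly_exp_le p : exists2 C : R, 0 <= C &
  forall y, 0 <= y -> `|p.[y]| * expR (- y) <= C.
Proof.
exists (\sum_(i < size p) `|p`_i| * i`!%:R).
  by apply: sumr_ge0 => i _; rewrite mulr_ge0.
move=> y y0; rewrite -ler_pdivlMr ?expR_gt0// -expRN opprK horner_coef mulr_suml.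
apply: (le_trans (ler_norm_sum _ _ _)); apply: ler_sum => i _.
by rewrite normrM (ger0_norm (exprn_ge0 _ y0)) -mulrA ler_wpM2l// expX_le.
Qed.

(** With y = 1 / s, this is the boundedness of y^2 p(y) exp(- y) for y >= 0. The square makes the
    difference quotient at 0 tend to 0. *)
Lemma polyexp_le p : exists2 C : R, 0 <= C &
  forall s, `|polyexp p s| <= C * s ^+ 2.
Proof.
have [C C0 hC] := poly_exp_le ('X^2 * p); exists C => // s.
rewrite /polyexp; case: ifPn => [s0|_]; last first.
  by rewrite normr0 mulr_ge0// sqr_ge0.
have s20 : 0 < s ^+ 2 by rewrite exprn_gt0.
rewrite -ler_pdivrMr// normrM (ger0_norm (expR_ge0 _)).
apply: le_trans (hC s^-1 _); last by rewrite invr_ge0 ltW.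
have -> : `|('X^2 * p).[s^-1]| = `|p.[s^-1]| / s ^+ 2.
  by rewrite hornerM hornerXn normrM exprVn mulrC normfV (ger0_norm (ltW s20)).
by rewrite mulrAC.
Qed.

(** With y = 1 / s one has dy/ds = - y^2, so p(y) exp(- y) differentiates to y^2 (p - p')(y) exp(-
    y). This is again a [polyexp], which gives all orders by induction. *)
Lemma is_derive_polyexp p s :
  is_derive s 1 (polyexp p) (polyexp ('X^2 * (p - p^`())) s).
Proof.
have [s0|s0|->] := ltgtP s 0.
- have -> : polyexp ('X^2 * (p - p^`())) s = 0 by rewrite /polyexp ltNge (ltW s0).
  apply: (@near_eq_is_derive _ _ _ (fun=> 0)).
  near=> t; rewrite /polyexp ifF//; apply/negbTE; rewrite -leNgt ltW//.
  by near: t; exact: lt_nbhsl.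
- have -> : polyexp ('X^2 * (p - p^`())) s =
     ((p^`().[s^-1] * (- s ^- 2)) * expR (- s^-1) +
       p.[s^-1] * (expR (- s^-1) * - (- s ^- 2))).
    by rewrite /polyexp s0 hornerM hornerXn hornerD hornerN exprVn; ring.
  suff hd : is_derive s 1 (fun t : R => p.[t^-1] * expR (- t^-1))
     ((p^`().[s^-1] * (- s ^- 2)) * expR (- s^-1) +
       p.[s^-1] * (expR (- s^-1) * - (- s ^- 2))).
    apply: (near_eq_is_derive _ hd); near=> t; rewrite /polyexp ifT//.
    by near: t; exact: lt_nbhsr.
  have hV : is_derive s 1 (fun t : R => t^-1) (- s ^- 2).
    have := @is_deriveV R id s 1 1 _ _.
    by rewrite gt_eqF// => /(_ erefl (is_derive_id _ _)); rewrite [X in is_derive _ _ _ X]mulr1.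
  exact: (is_deriveM' (is_derive_comp1 (is_derive_poly p s^-1) hV)
    (is_derive_comp1 (is_derive_expR _) (is_deriveN hV))).
- rewrite {2}/polyexp ltxx.
  have [C C0 hC] := polyexp_le p.
  have p0 : polyexp p 0 = 0 by rewrite /polyexp ltxx.
  have key : (fun h : R => h^-1 *: ((polyexp p \o shift 0) (h *: (1 : R)) - polyexp p 0)) @ 0^' --> (0 : R).
    apply/cvgrPdist_le => e e0; near=> h.
    rewrite sub0r normrN p0 subr0 /= addr0 [h%:A]mulr1 normrM.
    have h0 : h != 0 by near: h; exact: nbhs_dnbhs_neq.
    rewrite normfV mulrC ler_pdivrMr ?normr_gt0//.
    apply: (le_trans (hC h)); rewrite -real_normK ?num_real// expr2 mulrA ler_wpM2r//.
    have : `|h| <= e / (C + 1).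
      by near: h; apply: dnbhs0_le; rewrite divr_gt0// ltr_wpDl.
    rewrite ler_pdivlMr ?ltr_wpDl//; apply: le_trans.
    by rewrite mulrDr mulr1 mulrC lerDl.
  by split; [apply/cvg_ex; eexists; exact: key|exact: cvg_lim key].
Unshelve. all: by end_near. Qed.

Lemma is_derive_scale (f : R -> R) (s v l : R) :
  is_derive s 1 f l -> is_derive s v f (l * v).
Proof.
by move=> h; have := @is_derive_comp1 _ _ f id s v l v h (is_derive_id _ _).
Qed.

Lemma Ck_polyexp k p : Ck setT k (polyexp p).
Proof.
have cp q : continuous (polyexp q).
  move=> s; apply: differentiable_continuous; apply/derivable1_diffP.
  by have [] := is_derive_polyexp q s.
elim: k p => [|k IH] p; first by split=> // x _; exact: cp.
apply: (@CkI _ _ _ _ (fun v x => polyexp ('X^2 * (p - p^`())) x * v)) => //.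
- by move=> v x; apply: is_derive_scale; exact: is_derive_polyexp.
- by move=> v; apply: CkM => //; exact: Ck_cst.
Qed.

Definition smooth_step : R -> R := polyexp 1.

Lemma Cinf_smooth_step : Cinf setT smooth_step.
Proof. by move=> k; exact: Ck_polyexp. Qed.

Lemma smooth_step_gt0 s : 0 < s -> 0 < smooth_step s.
Proof. by move=> s0; rewrite /smooth_step /polyexp s0 hornerC mul1r expR_gt0. Qed.

Lemma smooth_step0 s : s <= 0 -> smooth_step s = 0.
Proof. by move=> s0; rewrite /smooth_step /polyexp ltNge s0. Qed.

Lemma smooth_step_ge0 s : 0 <= smooth_step s.
Proof.
by have [/smooth_step0 ->|/smooth_step_gt0/ltW] := leP s 0.
Qed.

End smooth_step.

(** * Integrals of real-valued functions *)

Section real_integrable.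
Context d {T : measurableType d} {R : realType} (mu : {measure set T -> \bar R}).
Variables (D : set T) (mD : measurable D).
Implicit Types (f g : T -> R).

Lemma intgD f g : mu.-integrable D (EFin \o f) -> mu.-integrable D (EFin \o g) ->
  mu.-integrable D (EFin \o (fun x => f x + g x)).
Proof. by move=> hf hg; have := integrableD mD hf hg. Qed.

Lemma intgB f g : mu.-integrable D (EFin \o f) -> mu.-integrable D (EFin \o g) ->
  mu.-integrable D (EFin \o (fun x => f x - g x)).
Proof. by move=> hf hg; have := integrableB mD hf hg. Qed.

Lemma intgZ (c : R) f : mu.-integrable D (EFin \o f) ->
  mu.-integrable D (EFin \o (fun x => c * f x)).
Proof. by move=> hf; have := integrableZl mD c hf. Qed.

Lemma intg_le f g : measurable_fun D f -> (forall x, D x -> `|f x| <= g x) ->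
  mu.-integrable D (EFin \o g) -> mu.-integrable D (EFin \o f).
Proof.
move=> mf fg; apply: le_integrable => //; first exact/measurable_EFinP.
by move=> x Dx; rewrite /= lee_fin (le_trans (fg x Dx))// ler_norm.
Qed.

Lemma intg_meas f : mu.-integrable D (EFin \o f) -> measurable_fun D f.
Proof. by move=> /integrableP[/measurable_EFinP]. Qed.

Lemma Rintg_DZ (c : R) f g : mu.-integrable D (EFin \o f) ->
  mu.-integrable D (EFin \o g) ->
  \int[mu]_(x in D) (f x + c * g x) = \int[mu]_(x in D) f x + c * \int[mu]_(x in D) g x.
Proof. by move=> hf hg; rewrite -RintegralZl// -RintegralD//; exact: intgZ. Qed.

Lemma le_int_lin f g (h : T -> R) (a b A B : R) : 0 <= a -> 0 <= b ->
  measurable_fun D f -> measurable_fun D g -> measurable_fun D h ->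
  (forall x, D x -> `|f x| <= a * `|g x| + b * `|h x|) ->
  (\int[mu]_(x in D) `|g x|%:E <= A%:E)%E -> (\int[mu]_(x in D) `|h x|%:E <= B%:E)%E ->
  (\int[mu]_(x in D) `|f x|%:E <= (a * A + b * B)%:E)%E.
Proof.
move=> a0 b0 mf mg mh fgh gA hB.
have mabs (u : T -> R) : measurable_fun D u -> measurable_fun D (fun x => `|u x|%:E).
  by move=> mu'; apply/measurable_EFinP; exact: measurableT_comp.
have n0 (u : T -> R) x : (0 <= `|u x|%:E)%E by rewrite lee_fin.
apply: (@le_trans _ _ (\int[mu]_(x in D) (a%:E * `|g x|%:E + b%:E * `|h x|%:E))%E).
  apply: ge0_le_integral => //.
  - exact: mabs.
  - by apply: emeasurable_funD; (apply: emeasurable_funM; [exact: measurable_cst|exact: mabs]).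
rewrite ge0_integralD//; first last.
- by apply: emeasurable_funM => //; exact: mabs.
- by move=> x Dx; rewrite mule_ge0.
- by apply: emeasurable_funM => //; exact: mabs.
- by move=> x Dx; rewrite mule_ge0.
rewrite !ge0_integralZl//; [|exact: mabs|exact: mabs].
by rewrite EFinD !EFinM leeD// lee_wpmul2l.
Qed.

Lemma intg_sum (I : Type) (s : seq I) (F : I -> T -> R) :
  (forall i, mu.-integrable D (EFin \o F i)) ->
  mu.-integrable D (EFin \o (fun x => \sum_(i <- s) F i x)).
Proof.
move=> hF; elim: s => [|i s IH].
  rewrite (_ : EFin \o _ = cst 0%E); first exact: integrable0.
  by apply/funext => x /=; rewrite big_nil.
rewrite (_ : EFin \o _ = EFin \o (fun x => F i x + \sum_(j <- s) F j x)).
  exact: intgD.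
by apply/funext => x /=; rewrite big_cons.
Qed.

Lemma Rintg_sum (I : Type) (s : seq I) (F : I -> T -> R) :
  (forall i, mu.-integrable D (EFin \o F i)) ->
  \int[mu]_(x in D) (\sum_(i <- s) F i x) = \sum_(i <- s) \int[mu]_(x in D) F i x.
Proof.
move=> hF; elim: s => [|i s IH].
  rewrite big_nil; under eq_Rintegral do rewrite big_nil.
  by rewrite Rintegral_cst// mul0r.
rewrite big_cons -IH -RintegralD//; last exact: intg_sum.
by apply: eq_Rintegral => x _; rewrite big_cons.
Qed.

Lemma dominated_cvg_real (f_ : nat -> T -> R) f g : (forall m, measurable_fun D (f_ m)) ->
  (forall x, D x -> f_ m x @[m --> \oo] --> f x) ->
  mu.-integrable D (EFin \o g) -> (forall m x, D x -> `|f_ m x| <= g x) ->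
  (\int[mu]_(x in D) (f_ m x)%:E)%E @[m --> \oo] --> (\int[mu]_(x in D) (f x)%:E)%E.
Proof.
move=> mf cf ig fg; apply: (@dominated_cvg _ _ _ mu D mD (fun m x => (f_ m x)%:E)
  (EFin \o f) (EFin \o g)) => //.
- by move=> m; exact/measurable_EFinP.
- by move=> x Dx; apply: cvg_EFin; [exact: nearW|exact: cf].
Qed.

End real_integrable.

(** * An induction principle for integrable functions *)

Section L1_induction.
Import HBSimple.
Context d {T : measurableType d} {R : realType} (mu : {measure set T -> \bar R}).
Variables (D : set T) (mD : measurable D) (Dfin : (mu D < +oo)%E).
Variables (G : set (set T)) (GE : @measurable _ T = <<s G >>) (GI : setI_closed G).
Variable P : (T -> R) -> Prop.
Hypothesis P1 : P (cst 1).
Hypothesis PG : forall A, G A -> P \1_A.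
Hypothesis Plin : forall (c : R) f g, mu.-integrable D (EFin \o f) ->
  mu.-integrable D (EFin \o g) -> P f -> P g -> P (fun x => c * f x + g x).
Hypothesis Plim : forall (f_ : nat -> T -> R) f,
  (forall m, mu.-integrable D (EFin \o f_ m)) -> mu.-integrable D (EFin \o f) ->
  (\int[mu]_(x in D) `|f x - f_ m x|%:E)%E @[m --> \oo] --> 0%E ->
  (forall m, P (f_ m)) -> P f.

Let intg_indic A : measurable A -> mu.-integrable D (EFin \o \1_A).
Proof.
move=> mA; apply: measurable_bounded_integrable => //.
  exists 1; split; first exact: num_real.
  move=> M M1 x _ /=; rewrite (le_trans _ (ltW M1))// indicE.
  by case: (x \in A); rewrite ?normr1 ?normr0.
Qed.

Let P0 : P (cst 0).
Proof.
have I1 : mu.-integrable D (EFin \o (cst 1 : T -> R)).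
  by rewrite (_ : cst 1 = \1_setT); [exact: intg_indic|rewrite indicT].
rewrite (_ : cst 0 = fun x => (-1) * (cst 1 : T -> R) x + (cst 1 : T -> R) x).
  exact: Plin.
by apply/funext => x /=; rewrite mulr1 addNr.
Qed.

Let P_sum (I : Type) (s : seq I) (F : I -> T -> R) (c : I -> R) :
  (forall i, mu.-integrable D (EFin \o F i)) -> (forall i, P (F i)) ->
  P (fun x => \sum_(i <- s) c i * F i x).
Proof.
move=> iF PF; elim: s => [|i s IH].
  by rewrite (_ : (fun _ => _) = cst 0)//; apply/funext => x; rewrite big_nil.
rewrite (_ : (fun _ => _) = (fun x => c i * F i x + \sum_(j <- s) c j * F j x)).
  by apply: Plin => //; apply: intg_sum => // j; exact: intgZ.
by apply/funext => x; rewrite big_cons.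
Qed.

Let P_indic A : measurable A -> P \1_A.
Proof.
rewrite GE; apply: (dynkin_induction (P := fun A => P \1_A)) => //.
- by rewrite indicT.
- move=> S mS PS.
  rewrite (_ : \1_(~` S) = fun x => (-1) * \1_S x + (cst 1 : T -> R) x).
    apply: Plin => //; first exact: intg_indic.
    by rewrite (_ : cst 1 = \1_setT); [exact: intg_indic|rewrite indicT].
  by apply/funext => x; rewrite !indicE in_setC mulN1r addrC; case: (x \in S); rewrite ?subrr ?subr0.
- move=> F mF tF PF.
  (* The sets being disjoint, this sum is the indicator of the partial union; it is bounded by 1,
     which is integrable since [D] has finite measure. The factors 1 are the coefficients expected
     by [P_sum]. *)
  pose f_ m x : R := \sum_(k < m) 1 * \1_(F k) x.
  have f_E m x : f_ m x = \1_(\bigcup_(k in `I_m) F k) x.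
    rewrite /f_; under eq_bigr do rewrite mul1r.
    have [/set_mem[k km Fkx]|nx] := boolP (x \in \bigcup_(k in `I_m) F k); last first.
      rewrite [RHS]indicE (negbTE nx) big1// => i _.
      rewrite indicE memNset// => Fix; move/negP : nx; apply; rewrite inE.
      by exists i => //=; exact: ltn_ord.
    rewrite indicE mem_set; last by exists k.
    rewrite (bigD1 (Ordinal km))//= indicE mem_set//= big1 ?addr0// => i ik.
    rewrite indicE memNset// => Fix; move/eqP : ik; apply; apply: val_inj => /=.
    by apply: (tF i k) => //; exists x.
  have mf_ m : measurable (\bigcup_(k in `I_m) F k) by exact: bigcup_measurable.
  have mU : measurable (\bigcup_k F k) by exact: bigcup_measurable.
  have If m : mu.-integrable D (EFin \o f_ m).
    by rewrite (_ : f_ m = \1_(\bigcup_(k in `I_m) F k)); [exact: intg_indic|apply/funext => x].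
  apply: (Plim (f_ := f_)) => //; first exact: intg_indic.
    rewrite -[X in _ --> X](integral0 mu D).
    apply: (@dominated_cvg_real _ _ _ mu D mD (fun m x => `|\1_(\bigcup_k F k) x - f_ m x|) (cst 0) (cst 1)).
    - move=> m; apply: measurableT_comp => //; apply: measurable_funB.
        exact/measurable_funTS/measurable_indic.
      exact: intg_meas (If m).
    - move=> x _; apply/cvgrPdist_le => e e0.
      have [[k _ Fkx]|nx] := pselect ((\bigcup_k F k) x).
        exists k.+1 => // m /= km.
        rewrite f_E !indicE mem_set; last by exists k.
        by rewrite mem_set; [rewrite subrr normr0 subrr normr0 ltW|exists k].
      near=> m; rewrite f_E !indicE memNset// memNset ?subrr ?normr0 ?subrr ?normr0 ?ltW//.
      by move=> [k _ Fkx]; apply: nx; exists k.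
    - by rewrite (_ : cst 1 = \1_setT); [exact: intg_indic|rewrite indicT].
    - move=> m x _; rewrite normr_id f_E !indicE.
      by do 2 case: (_ \in _); rewrite ?subrr ?normr0 ?subr0 ?sub0r ?normrN ?normr1.
  move=> m; apply: (@P_sum 'I_m (index_enum _) (fun k => \1_(F k)) (fun=> 1)) => // i.
  exact: intg_indic.
Unshelve. all: by end_near. Qed.

(** A monotone class argument: the pi-lambda theorem carries [P] from the generators to all
    measurable indicators, linearity to simple functions, and L^1 limits to the rest. For the
    convergence of smoothings it replaces the density of continuous functions. *)
Lemma L1_ind f : mu.-integrable D (EFin \o f) -> P f.
Proof.
move=> hf; have [g_ [ig_ _ cg]] := approximation_sfun_integrable mD hf.
apply: (@Plim (fun m => HBSimple.SimpleFun.sort (g_ m)) f) => //.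
move=> m.
rewrite (_ : (g_ m : T -> R) = fun x =>
    \sum_(y <- finmap.enum_fset (fset_set (range (g_ m)))) y * \1_(g_ m @^-1` [set y]) x); last first.
  by apply/funext => x; rewrite fimfunE fsbig_finite.
apply: (@P_sum R _ (fun y => \1_(g_ m @^-1` [set y])) id) => y.
  exact: intg_indic.
exact: P_indic.
Qed.

End L1_induction.

(** * Almost everywhere limits and completeness of L^2 *)

Section almost_everywhere_limits.
Context d {T : measurableType d} {R : realType} (mu : {measure set T -> \bar R}).
Variables (D : set T) (mD : measurable D).

(** The bounds sum to 1, so the series of the [f m] has a finite integral, converges almost
    everywhere, and its terms tend to 0. *)
Lemma ae_cvg0 (f : nat -> T -> R) : (forall m, measurable_fun D (f m)) ->
  (forall m x, D x -> 0 <= f m x) ->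
  (forall m, (\int[mu]_(x in D) (f m x)%:E <= (1 / (2 ^ (m + 1))%:R)%:E)%E) ->
  {ae mu, forall x, D x -> f m x @[m --> \oo] --> (0 : R)}.
Proof.
move=> mf f0 hf.
pose S x : \bar R := (\sum_(m <oo) (f m x)%:E)%E.
have mf' m : measurable_fun D (EFin \o f m) by exact/measurable_EFinP.
have f0' m x : D x -> (0 <= (f m x)%:E)%E by move=> Dx; rewrite lee_fin f0.
have IS : (\int[mu]_(x in D) S x <= 1%:E)%E.
  rewrite /S integral_nneseries//.
  apply: (@le_trans _ _ (\sum_(m <oo) (1 / (2 ^ (m + 1))%:R)%:E)%E).
    by apply: lee_nneseries => m *; [apply: integral_ge0|exact: hf] => x Dx; exact: f0'.
  have /cvg_lim -> := @cvg_geometric_eseries_half R 1 0; last by [].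
  by rewrite expr0 divr1.
have mS : measurable_fun D S.
  apply: (@ge0_emeasurable_sum _ _ _ D (fun k x => (f k x)%:E) predT).
    by move=> k x Dx _; exact: f0'.
  by move=> k _; exact: mf'.
have S0 x : D x -> (0 <= S x)%E by move=> Dx; apply: nneseries_ge0 => m _ _; exact: f0'.
have iS : mu.-integrable D S.
  apply/integrableP; split => //.
  under eq_integral => x /set_mem Dx do rewrite gee0_abs ?S0//.
  exact: le_lt_trans IS (ltry _).
have := integrable_ae mD iS; apply: filterS => x + Dx => /(_ Dx) Sfin.
have Soo : (S x < +oo)%E by move: Sfin; rewrite fin_numE => /andP[_]; rewrite ltey.
have cs : cvgn (series (fun m => f m x)).
  by apply: nnseries_is_cvg => // m; exact: f0.
exact: cvg_series_cvg_0 cs.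
Qed.

Lemma limn_einf_le (u : (\bar R)^nat) (v : nat -> R) (l : R) :
  (forall k, (u k <= (v k)%:E)%E) -> v @ \oo --> l -> (limn_einf u <= l%:E)%E.
Proof.
move=> uv vl; have vl' : (fun k => (v k)%:E) @ \oo --> l%:E.
  by apply: cvg_EFin => //; exact: nearW.
rewrite limn_einf_lim -(cvg_lim _ vl')//; apply: lee_lim.
- exact: is_cvg_einfs.
- by apply/cvg_ex; exists l%:E.
- apply: nearW => k; apply: le_trans (uv k).
  by apply: ereal_inf_lbound; exists k => //=.
Qed.

(** The bounds [c m] may vary with [m]: [L2_complete] needs this, its bound being a fixed term plus
    a vanishing one. *)
Lemma fatou_ae (f : nat -> T -> R) (g : T -> R) (c : nat -> R) (l : R) :
  (forall m, measurable_fun D (f m)) -> measurable_fun D g ->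
  (forall m x, D x -> 0 <= f m x) ->
  {ae mu, forall x, D x -> f m x @[m --> \oo] --> g x} ->
  (forall m, (\int[mu]_(x in D) (f m x)%:E <= (c m)%:E)%E) -> c @ \oo --> l ->
  (\int[mu]_(x in D) (g x)%:E <= l%:E)%E.
Proof.
move=> mf mg f0 fg fc cl.
have mf' m : measurable_fun D (EFin \o f m) by exact/measurable_EFinP.
have f0' m x : D x -> (0 <= (f m x)%:E)%E by move=> Dx; rewrite lee_fin f0.
apply: le_trans (limn_einf_le fc cl).
apply: le_trans (fatou mu mD mf' f0').
rewrite le_eqVlt; apply/orP; left; apply/eqP.
apply: ae_eq_integral => //.
- exact/measurable_EFinP.
- rewrite (_ : (fun x => limn_einf _) =
      (fun x => - limn_esup (fun m => - (f m x)%:E))%E); last first.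
    by apply/funext => x; rewrite (limn_esupN (fun m => (f m x)%:E)) oppeK.
  apply: (measurableT_comp (@oppe_measurable R setT)).
  apply: measurable_fun_limn_esup => m.
  by apply: (measurableT_comp (@oppe_measurable R setT)); exact: mf'.
- apply: filterS fg => x + Dx => /(_ Dx) h.
  have h' : (fun m => (f m x)%:E) @ \oo --> (g x)%:E.
    by apply: cvg_EFin => //; exact: nearW.
  by rewrite (cvg_limn_einf_sup h').1.
Qed.

(** The Riesz-Fischer theorem with an explicit rate. The last clause holds at every point of [D],
    not only almost everywhere, because [G] is an upper limit taken everywhere; this is how the sign
    of the Dirichlet solution survives the limit. *)
Lemma L2_complete (F : nat -> T -> R) (delta : nat -> R) :
  (forall m, measurable_fun D (F m)) ->
  (forall i j, (\int[mu]_(x in D) ((F i x - F j x) ^+ 2)%:E <= (delta i + delta j)%:E)%E) ->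
  delta @ \oo --> 0 ->
  exists G : T -> R, [/\ measurable_fun D G,
    forall i, (\int[mu]_(x in D) ((F i x - G x) ^+ 2)%:E <= (delta i)%:E)%E &
    (forall m x, D x -> 0 <= F m x) -> forall x, D x -> 0 <= G x].
Proof.
move=> mF hF d0.
(* Along [s] the integral of [4 ^+ k * (F (s k) x - F (s k.+1) x) ^+ 2] is at most (9/32) 2^-k,
   which is below the bound 2^-(k+1) of [ae_cvg0]. *)
have /choice[s hs] : forall k : nat, exists i, delta i <= (4 * 8 ^+ k)^-1.
  move=> k; have e0 : 0 < (4 * 8 ^+ k)^-1 :> R by rewrite invr_gt0 mulr_gt0// exprn_gt0.
  move/cvgrPdist_le : d0 => /(_ _ e0)[N _ /(_ N (leqnn N))].
  rewrite sub0r normrN => h; exists N; exact: le_trans (ler_norm _) h.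
pose dk k x : R := 4 ^+ k * (F (s k) x - F (s k.+1) x) ^+ 2.
have mFF i j : measurable_fun D (fun x => (F i x - F j x) ^+ 2).
  by apply: measurable_funX; exact: measurable_funB.
have mdk k : measurable_fun D (dk k) by apply: measurable_funM.
have dge0 k x : D x -> 0 <= dk k x.
  by move=> _; rewrite /dk mulr_ge0 ?sqr_ge0 ?exprn_ge0.
have hd : {ae mu, forall x, D x -> dk k x @[k --> \oo] --> (0 : R)}.
  apply: ae_cvg0 => // k.
  rewrite /dk; under eq_integral do rewrite EFinM.
  rewrite ge0_integralZl//; first last.
  - by move=> x _; rewrite lee_fin sqr_ge0.
  - exact/measurable_EFinP.
  apply: (@le_trans _ _ ((4 ^+ k)%:E * ((4 * 8 ^+ k)^-1 + (4 * 8 ^+ k.+1)^-1)%:E)%E).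
    rewrite lee_wpmul2l ?lee_fin ?exprn_ge0//.
    by apply: (le_trans (hF _ _)); rewrite lee_fin lerD.
  rewrite -EFinM lee_fin addn1 natrX div1r exprS.
  have -> : 8 ^+ k = 4 ^+ k * 2 ^+ k :> R by rewrite -exprMn; congr (_ ^+ _); ring.
  have h4 : 4 ^+ k != 0 :> R by rewrite expf_neq0.
  have h2 : 2 ^+ k != 0 :> R by rewrite expf_neq0.
  have -> : 4 ^+ k * ((4 * (4 ^+ k * 2 ^+ k))^-1 + (4 * (8 * (4 ^+ k * 2 ^+ k)))^-1) =
     (9 / 32) * (2 ^+ k)^-1 :> R by field; rewrite h4 h2.
  rewrite exprS invfM ler_wpM2r ?invr_ge0 ?exprn_ge0//; lra.
have cF x : (dk k x @[k --> \oo] --> (0 : R)) -> cvgn (fun k => F (s k) x).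
  move=> dx.
  have [M [Mr hM]] := cvg_seq_bounded (cvgP _ dx).
  pose N := `|M| + 2.
  have N1 : 1 <= N by rewrite /N; have := normr_ge0 M; lra.
  (* [dk k x] is at most [N], so the difference is at most sqrt N / 2^k, and [1 <= N] allows [N] in
     place of its root. The series of differences is thus dominated by a geometric one. *)
  have hN k : `|F (s k) x - F (s k.+1) x| <= N / 2 ^+ k.
    have : dk k x <= N.
      apply: (le_trans (ler_norm _)); apply: hM => //.
      by rewrite /N (le_lt_trans (ler_norm M))// ltrDl.
    rewrite ler_pdivlMr ?exprn_gt0//.
    rewrite /dk (_ : 4 ^+ k = 2 ^+ k * 2 ^+ k :> R); last by rewrite -exprMn; congr (_ ^+ _); ring.
    set a := F (s k) x - _; set b := 2 ^+ k => h.
    have b0 : 0 <= b by rewrite exprn_ge0.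
    rewrite -(@ler_pXn2r _ 2)// ?nnegrE ?mulr_ge0// ?(le_trans _ N1)//.
    rewrite exprMn real_normK ?num_real//.
    have : N * 1 <= N * N by rewrite ler_wpM2l// (le_trans _ N1).
    by rewrite mulr1 expr2; nra.
  have cs : cvgn (series (telescope (fun k => F (s k) x))).
    apply: normed_cvg.
    apply: (@series_le_cvg _ _ (geometric N (2^-1))).
    - by move=> k; exact: normr_ge0.
    - by move=> k; rewrite /geometric /= mulr_ge0 ?exprn_ge0 ?(le_trans _ N1)// invr_ge0.
    - by move=> k; rewrite /telescope /geometric /= distrC exprVn.
    - by apply: is_cvg_geometric_series; rewrite ger0_norm ?invr_ge0// invf_lt1// ltr1n.
  move: cs; rewrite telescopeK => /cvg_ex[l hl]; apply/cvg_ex; exists (l + F (s 0%N) x).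
  rewrite (_ : (fun k => F (s k) x) = (fun k => (F (s k) x - F (s 0%N) x) + F (s 0%N) x)).
    by apply: cvgD => //; exact: cvg_cst.
  by apply/funext => k; rewrite subrK.
(* The upper limit is measurable whether or not the sequence converges, and nonnegative if the
   sequence is; [fine] sends infinite values to 0. *)
pose G x : R := fine (limn_esup (fun k => (F (s k) x)%:E)).
have mG : measurable_fun D G.
  apply: measurableT_comp; first exact: fine_measurable.
  by apply: measurable_fun_limn_esup => k; exact/measurable_EFinP.
have GE : {ae mu, forall x, D x -> F (s k) x @[k --> \oo] --> G x}.
  apply: filterS hd => x + Dx => /(_ Dx) /cF /cvg_ex[l hl].
  have hl' : (fun k => (F (s k) x)%:E) @ \oo --> l%:E.
    by apply: cvg_EFin => //; exact: nearW.
  by rewrite /G (cvg_limn_einf_sup hl').2.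
exists G; split => //.
- move=> i; apply: (@fatou_ae (fun k x => (F i x - F (s k) x) ^+ 2) _
      (fun k => delta i + (4 * 8 ^+ k)^-1)) => //.
  + by apply: measurable_funX; exact: measurable_funB.
  + by move=> m x _; exact: sqr_ge0.
  + apply: filterS GE => x + Dx => /(_ Dx) h.
    have hh : F i x - F (s k) x @[k --> \oo] --> F i x - G x.
      by apply: cvgB => //; exact: cvg_cst.
    by rewrite expr2; under eq_fun do rewrite expr2; exact: cvgM.
  + by move=> k; apply: (le_trans (hF _ _)); rewrite lee_fin lerD2l.
  + rewrite -[X in _ --> X]addr0; apply: cvgD; first exact: cvg_cst.
    rewrite (_ : (fun k => _) = geometric (4^-1) (8^-1)).
      by apply: cvg_geometric; rewrite ger0_norm ?invr_ge0// invf_lt1// ltr1n.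
    by apply/funext => k; rewrite /geometric /= invfM exprVn.
- move=> F0 x Dx; apply: fine_ge0; rewrite limn_esup_lim.
  apply: lime_ge; first exact: is_cvg_esups.
  apply: nearW => k; apply: (@le_trans _ _ (F (s k) x)%:E); first by rewrite lee_fin F0.
  by apply: ereal_sup_ubound; exists k => //=.
Qed.

End almost_everywhere_limits.

(** * Coordinates and Borel sets of the Heisenberg group *)

Section heisenberg_coordinates.
Context {R : realType} {n : nat}.
Local Notation H := (heisenberg R n).
Local Notation HM := ('rV[R]_n * 'rV[R]_n * measurableTypeR R)%type.
Implicit Types (x y : H).

Definition coord (i : option ('I_n + 'I_n)) x : R :=
  match i with
  | None => x.2
  | Some (inl j) => x.1.1 0 j
  | Some (inr j) => x.1.2 0 j
  end.

Definition of_coord (c : option ('I_n + 'I_n) -> R) : H :=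
  (\row_j c (Some (inl j)), \row_j c (Some (inr j)), c None).

Lemma of_coordK c i : coord i (of_coord c) = c i.
Proof. by case: i => [[j|j]|] //=; rewrite mxE. Qed.

Lemma coord_lin i (h : R) x y : coord i (h *: x + y) = h * coord i x + coord i y.
Proof. by case: i => [[j|j]|] //=; rewrite !mxE. Qed.

Lemma ball_coord x (e : R) y : 0 < e ->
  ball x e y <-> forall i, `|coord i x - coord i y| < e.
Proof.
move=> e0; split.
  by move=> [[[_ h1] [_ h2]] h3] [[j|j]|]; [exact: h1|exact: h2|exact: h3].
move=> h; split; last exact: (h None).
by split; split => // i j; rewrite ord1; [exact: (h (Some (inl _)))|exact: (h (Some (inr _)))].
Qed.

Lemma coord_eq x y : (forall i, coord i x = coord i y) -> x = y.
Proof.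
move=> h; case: x y h => [[a b] c] [[a' b'] c'] h; congr (_, _, _).
- by apply/rowP => j; exact: (h (Some (inl j))).
- by apply/rowP => j; exact: (h (Some (inr j))).
- exact: (h None).
Qed.

Lemma continuous_coord i : continuous (coord i).
Proof.
move=> x; apply/cvgrPdist_lt => e e0.
have h : nbhs (x : H) (ball (x : H) e) by exact: nbhsx_ballx.
by apply: filterS h => y /(ball_coord _ _ e0).
Qed.

Lemma Ck_coord i k : Ck setT k (coord i).
Proof. by apply: Ck_linear; [exact: continuous_coord|move=> x v h; exact: coord_lin]. Qed.

Lemma is_derive_coord i x v : is_derive x v (coord i) (coord i v).
Proof.
apply/is_deriveP; have h := is_deriveD (is_deriveM (@is_derive_id _ _ (0 : R) (1 : R))
  (is_derive_cst (coord i v) (0 : R) (1 : R))) (is_derive_cst (coord i x) (0 : R) (1 : R)).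
move: h; rewrite addr0 scale0r add0r [X in is_derive _ _ _ X]mulr1.
by congr (is_derive _ _ _ _); apply/funext => h; rewrite coord_lin.
Qed.

Lemma measurable_coord i : measurable_fun setT (coord i : HM -> measurableTypeR R).
Proof.
case: i => [[j|j]|].
- by apply: (measurableT_comp (@measurable_mx_coord R 1 n (0, j)));
    apply: measurableT_comp; [exact: measurable_fst|exact: measurable_fst].
- by apply: (measurableT_comp (@measurable_mx_coord R 1 n (0, j)));
    apply: measurableT_comp; [exact: measurable_snd|exact: measurable_fst].
- exact: measurable_snd.
Qed.

(** For [0 < e] this is the norm ball ([ball_coord]), described by coordinates so that its
    measurability in the product sigma-algebra and its volume can be read off. *)
Definition cube x (e : R) : set H := [set y | forall i, `|coord i x - coord i y| < e].

Lemma measurable_cube x (e : R) : measurable (cube x e : set HM).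
Proof.
rewrite (_ : cube x e = \bigcap_(i in [set: option ('I_n + 'I_n)])
    ([set: HM] `&` (coord i : HM -> measurableTypeR R) @^-1` ball (coord i x) e)).
  apply: fin_bigcap_measurable => // i _; apply: measurable_coord => //.
  by apply: open_measurable; exact: ball_open.
apply/seteqP; split=> [y h i _|y h i]; first by split => //; exact: h.
exact: (h i I).2.
Qed.

(** The measurable structure of [HM] is the product of those of its factors, not one generated by
    open sets. An open set is recovered as the union of the cubes with rational centre and radius
    that it contains. *)
Lemma open_measurable_heisenberg (O : set H) : open O -> measurable (O : set HM).
Proof.
(* A rational cube not contained in [O] is replaced by the empty set, so that the union runs over a
   whole countable type. *)
move=> oO; pose F (p : {ffun option ('I_n + 'I_n) -> rat} * rat) : set HM :=
  let B := cube (of_coord (fun i => ratr (p.1 i))) (ratr p.2) in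
  if `[< B `<=` O >] then B else set0.
rewrite (_ : O = \bigcup_p F p); last first.
  apply/seteqP; split; last first.
    by move=> x [p _]; rewrite /F; case: ifPn => // /asboolP; exact.
  move=> x Ox; move: (oO); rewrite openE => /(_ _ Ox) /nbhs_ballP[e /= e0 he].
  have [r] : exists r : rat, ratr r \in `]0, (e / 2)[.
    by apply: rat_in_itvoo; rewrite divr_gt0.
  rewrite in_itv/= => /andP[r0 re].
  have /choice[c hc] : forall i, exists q : rat,
      ratr q \in `](coord i x - ratr r), (coord i x + ratr r)[.
    by move=> i; apply: rat_in_itvoo; rewrite ltrBlDr -addrA ltrDl addr_gt0.
  exists ([ffun i => c i], r) => //; rewrite /F /=.
  have cE i : coord i (of_coord (fun i => ratr ([ffun i => c i] i))) = ratr (c i) :> R.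
    by rewrite of_coordK ffunE.
  have xc i : `|ratr (c i) - coord i x| < ratr r.
    have := hc i; rewrite in_itv/= => /andP[h1 h2].
    by rewrite ltr_distl h1.
  rewrite ifT; first by move=> i; rewrite cE.
  apply/asboolP => y hy; apply: he; apply/(ball_coord _ _ e0) => i.
  have := hy i; rewrite cE => hi.
  rewrite (_ : _ - _ = (coord i x - ratr (c i)) + (ratr (c i) - coord i y)); last first.
    by rewrite addrA subrK.
  apply: (le_lt_trans (ler_normD _ _)); rewrite (splitr e) ltrD//.
    by rewrite distrC (lt_trans (xc i)).
  exact: lt_trans hi re.
apply: countable_bigcupT_measurable => [|p]; first exact: countable_countType || exact: countableP.
by rewrite /F; case: ifPn => // _; exact: measurable_cube.
Qed.

Lemma continuous_measurable_heisenberg (D : set H) (f : H -> R) : open D ->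
  (forall x, D x -> {for x, continuous f}) ->
  measurable_fun (D : set HM) (f : HM -> measurableTypeR R).
Proof.
move=> oD cf; apply: (measurability _ (RGenOpens.measurableE R)).
move=> _ [_ [a [b ->] <-]]; apply: open_measurable_heisenberg.
rewrite openE => x [Dx fx]; apply: filterI; first exact: open_nbhs_nbhs.
by apply: (cf x Dx); apply: open_nbhs_nbhs; split => //; exact: interval_open.
Qed.

Lemma Ck_measurable k (f : H -> R) : Ck setT k f ->
  measurable_fun setT (f : HM -> measurableTypeR R).
Proof.
move=> hf; apply: continuous_measurable_heisenberg; first exact: openT.
by move=> x _; exact: Ck_at hf.
Qed.

(** With the open sets as a generator stable under intersection, [L1_ind] applies on the group. *)
Lemma measurable_heisenbergE : @measurable _ HM = <<s (@open H) >>.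
Proof.
apply/seteqP; split; last first.
  apply: smallest_sub; first exact: sigma_algebra_measurable.
  by move=> O; exact: open_measurable_heisenberg.
pose T := g_sigma_algebraType (@open H).
have mc i : measurable_fun setT (coord i : T -> measurableTypeR R).
  apply: (measurability _ (RGenOpens.measurableE R)).
  move=> _ [_ [a [b ->] <-]]; rewrite setTI; apply: sub_sigma_algebra.
  by apply: open_comp; [move=> x _; exact: continuous_coord|exact: interval_open].
have mid : measurable_fun setT (id : T -> HM).
  rewrite (_ : id = fun x : T => ((x.1.1, x.1.2), x.2)); last first.
    by apply/funext => -[[]].
  apply: measurable_fun_pair; last exact: (mc None).
  apply: measurable_fun_pair; apply: measurable_fun_mxP => -[i j]; rewrite ord1.
  - exact: (mc (Some (inl j))).
  - exact: (mc (Some (inr j))).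
by move=> A mA; have := mid measurableT _ mA; rewrite setTI.
Qed.

End heisenberg_coordinates.

(** * Measure-preserving maps *)

Section measure_preserving.
Context {R : realType}.

(** Stated by integrals of nonnegative functions rather than by measures of sets, so that Tonelli's
    theorem composes it over products. *)
Definition preserving d (T : measurableType d) (mu : {measure set T -> \bar R})
    (phi : T -> T) :=
  forall F : T -> \bar R, measurable_fun setT F -> (forall x, (0 <= F x)%E) ->
    (\int[mu]_x F (phi x) = \int[mu]_x F x)%E.

(** [phi2] may depend on the first factor, so shears are included. A right translation of the
    Heisenberg group is of this kind: it shifts t by an amount depending on (x, y). *)
Lemma preserving_prod d1 d2 (T1 : measurableType d1) (T2 : measurableType d2)
    (m1 : {sigma_finite_measure set T1 -> \bar R})
    (m2 : {sigma_finite_measure set T2 -> \bar R})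
    (phi1 : T1 -> T1) (phi2 : T1 -> T2 -> T2) :
  measurable_fun setT phi1 ->
  measurable_fun setT (fun p : T1 * T2 => phi2 p.1 p.2) ->
  preserving m1 phi1 -> (forall x, preserving m2 (phi2 x)) ->
  preserving (m1 \x m2)%E (fun p => (phi1 p.1, phi2 p.1 p.2)).
Proof.
move=> mphi1 mphi2 h1 h2 F mF F0.
rewrite (fubini_tonelli1 (fun p => F (phi1 p.1, phi2 p.1 p.2)))//; last first.
  apply: (measurableT_comp mF); apply: measurable_fun_pair => //.
  by apply: measurableT_comp => //; exact: measurable_fst.
rewrite [RHS]fubini_tonelli1//.
transitivity (\int[m1]_x (fubini_F m2 F (phi1 x)))%E.
  apply: eq_integral => x _; rewrite /fubini_F /=.
  apply: (h2 x (fun y => F (phi1 x, y))) => //.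
  by apply: (measurableT_comp mF); exact: pair1_measurable.
apply: h1; first exact: measurable_fun_fubini_tonelli_F.
by move=> x; apply: integral_ge0.
Qed.

Lemma preserving_measure d (T : measurableType d) (mu : {measure set T -> \bar R}) phi :
  measurable_fun setT phi ->
  (forall A, measurable A -> mu (phi @^-1` A) = mu A) -> preserving mu phi.
Proof.
move=> mphi hA F mF F0.
transitivity (\int[pushforward mu phi]_x F x)%E.
  by rewrite ge0_integral_pushforward.
by apply: eq_measure_integral => A mA _; exact: hA.
Qed.

Lemma preserving_lebesgue_shift (c : R) :
  preserving (@lebesgue_measure R) (fun x : measurableTypeR R => (x + c : measurableTypeR R)).
Proof.
have mc : measurable_fun setT (fun x : measurableTypeR R => (x + c : measurableTypeR R)).
  by apply: measurable_funD => //; exact: measurable_cst.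
apply: preserving_measure => // A mA.
apply/esym.
apply: (@lebesgue_measure_unique _ (pushforward lebesgue_measure
  (fun x : measurableTypeR R => (x + c : measurableTypeR R)))) => // X [[a b]] /= _ <-.
rewrite /pushforward.
rewrite (_ : _ @^-1` _ = `](a - c), (b - c)]%classic); last first.
  by apply/seteqP; split => x; rewrite /= !in_itv/= ltrBlDr lerBrDr.
by rewrite !lebesgue_measure_itv/= !lte_fin ltrD2r -!EFinB opprB addrA subrK.
Qed.

Lemma measurable_rV_shift n (v : 'rV[R]_n) : measurable_fun setT (fun x : 'rV[R]_n => x + v).
Proof.
apply: measurable_fun_mxP => -[i j].
rewrite (_ : _ \o _ = fun x : 'rV[R]_n => mx_coord (i, j) x + v i j); last first.
  by apply/funext => x; rewrite /mx_coord /= mxE.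
by apply: measurable_funD => //; exact: measurable_mx_coord.
Qed.

Lemma preserving_rV_shift n (v : 'rV[R]_n) :
  preserving (@lebesgue_rV R n) (fun x => x + v).
Proof.
elim: n v => [|n IH] v F mF F0.
  by apply: eq_integral => x _; congr F; apply/rowP => -[].
pose v' : 'rV[R]_n := \row_j v 0 (lift ord0 j).
have h := preserving_prod (m1 := @lebesgue_measure R) (m2 := lebesgue_rV n)
  (phi1 := fun x => x + v 0 ord0) (phi2 := fun _ y => y + v').
have {}h : preserving (lebesgue_measure \x lebesgue_rV n)%E
   (fun p : measurableTypeR R * 'rV[R]_n => (p.1 + v 0 ord0 : measurableTypeR R, p.2 + v')).
  apply: h => //.
  - by apply: measurable_funD => //; exact: measurable_cst.
  - by apply: (measurableT_comp (measurable_rV_shift v')); exact: measurable_snd.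
  - exact: preserving_lebesgue_shift.
have mC := @measurable_rV_cons R n.
have E (G : 'rV[R]_n.+1 -> \bar R) : measurable_fun setT G ->
    (forall x, (0 <= G x)%E) -> (\int[lebesgue_rV n.+1]_x G x =
    \int[lebesgue_measure \x lebesgue_rV n]_x G (rV_cons x))%E.
  by move=> mG G0; rewrite /= /rV_cons_measure ge0_integral_pushforward.
rewrite !E//; last first.
  by apply: (measurableT_comp mF); exact: measurable_rV_shift.
rewrite -[RHS]h//; last exact: measurableT_comp.
apply: eq_integral => -[a w] _ /=; congr F; apply/rowP => j.
rewrite !mxE; case: unliftP => [k ->|->] /=; by rewrite ?mxE ?liftK ?unlift_none.
Qed.

Section sigma_finite_product.
Context d1 d2 (T1 : measurableType d1) (T2 : measurableType d2)
  (m1 : {sigma_finite_measure set T1 -> \bar R})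
  (m2 : {sigma_finite_measure set T2 -> \bar R}).

(* The product measure again, with its sigma-finite structure, so that products can be
   iterated and Tonelli's theorem applied to [vol]. *)
Definition sf_product : set (T1 * T2) -> \bar R := (m1 \x m2)%E.

HB.instance Definition _ := Measure.on sf_product.

HB.instance Definition _ :=
  Measure_isSigmaFinite.Build _ _ _ sf_product (product_sigma_finite m1 m2).

End sigma_finite_product.

End measure_preserving.

(** * The group law and the right invariance of Lebesgue measure *)

Section heisenberg_group.
Context {R : realType} {n : nat}.
Local Notation H := (heisenberg R n).
Local Notation HM := ('rV[R]_n * 'rV[R]_n * measurableTypeR R)%type.
Implicit Types (x y z : H).

Definition dot (a b : 'rV[R]_n) : R := \sum_j a 0 j * b 0 j.

Definition hmul x y : H :=
  (x.1.1 + y.1.1, x.1.2 + y.1.2,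
   x.2 + y.2 + 2 * (dot x.1.2 y.1.1 - dot x.1.1 y.1.2)).

Definition svol : {sigma_finite_measure set HM -> \bar R} :=
  sf_product (sf_product (lebesgue_rV n) (lebesgue_rV n)) (@lebesgue_measure R).

Lemma measurable_dotr (b : 'rV[R]_n) :
  measurable_fun setT (fun a : 'rV[R]_n => dot a b : measurableTypeR R).
Proof.
apply: measurable_sum => j; apply: measurable_funM => //.
exact: (measurable_mx_coord (0, j)).
Qed.

Lemma preserving_hmulr z : preserving (@vol R n) (fun x : HM => hmul x z : HM).
Proof.
have h1 : preserving (lebesgue_rV n \x lebesgue_rV n)%E
    (fun p : 'rV[R]_n * 'rV[R]_n => (p.1 + z.1.1, p.2 + z.1.2)).
  have := @preserving_prod R _ _ _ _ (lebesgue_rV n) (lebesgue_rV n)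
    (fun a => a + z.1.1) (fun _ b => b + z.1.2).
  apply => //; last by move=> x; exact: preserving_rV_shift.
  - exact: measurable_rV_shift.
  - by apply: (measurableT_comp (measurable_rV_shift z.1.2)); exact: measurable_snd.
  - exact: preserving_rV_shift.
pose s (p : 'rV[R]_n * 'rV[R]_n) : R := z.2 + 2 * (dot p.2 z.1.1 - dot p.1 z.1.2).
have := @preserving_prod R _ _ _ _ (sf_product (lebesgue_rV n) (lebesgue_rV n)) lebesgue_measure
  (fun p : 'rV[R]_n * 'rV[R]_n => (p.1 + z.1.1, p.2 + z.1.2))
  (fun p (t : measurableTypeR R) => (t + s p : measurableTypeR R)).
have -> : (fun p : HM => ((p.1.1 + z.1.1, p.1.2 + z.1.2), (p.2 + s p.1 : measurableTypeR R))) =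
    (fun x : HM => hmul x z).
  by apply/funext => p; rewrite /hmul /s addrA.
apply => //.
- apply: measurable_fun_pair.
  + by apply: (measurableT_comp (measurable_rV_shift z.1.1)); exact: measurable_fst.
  + by apply: (measurableT_comp (measurable_rV_shift z.1.2)); exact: measurable_snd.
- apply: measurable_funD; first exact: measurable_snd.
  apply: measurable_funD => //; apply: measurable_funM => //; apply: measurable_funB.
  + apply: (measurableT_comp (measurable_dotr z.1.1)).
    by apply: measurableT_comp; [exact: measurable_snd|exact: measurable_fst].
  + apply: (measurableT_comp (measurable_dotr z.1.2)).
    by apply: measurableT_comp; [exact: measurable_fst|exact: measurable_fst].
- by move=> p; exact: preserving_lebesgue_shift.
Qed.

Lemma measurable_hmulr z : measurable_fun setT (fun x : HM => hmul x z : HM).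
Proof.
apply: measurable_fun_pair.
  apply: measurable_fun_pair.
  - apply: (measurableT_comp (measurable_rV_shift z.1.1)).
    by apply: measurableT_comp; [exact: measurable_fst|exact: measurable_fst].
  - apply: (measurableT_comp (measurable_rV_shift z.1.2)).
    by apply: measurableT_comp; [exact: measurable_snd|exact: measurable_fst].
apply: measurable_funD; first by apply: measurable_funD => //; exact: measurable_snd.
apply: measurable_funM => //; apply: measurable_funB.
- apply: (measurableT_comp (measurable_dotr z.1.1)).
  by apply: measurableT_comp; [exact: measurable_snd|exact: measurable_fst].
- apply: (measurableT_comp (measurable_dotr z.1.2)).
  by apply: measurableT_comp; [exact: measurable_fst|exact: measurable_fst].
Qed.

Lemma tonelli_vol (F : HM * HM -> \bar R) : measurable_fun setT F ->
  (forall p, (0 <= F p)%E) ->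
  (\int[vol]_x \int[vol]_y F (x, y) = \int[vol]_y \int[vol]_x F (x, y))%E.
Proof. by move=> mF F0; exact: (@fubini_tonelli _ _ _ _ _ svol svol F mF F0). Qed.

Lemma vol_cube x (e : R) : 0 < e -> (0 < vol (cube x e : set HM) < +oo)%E.
Proof.
move=> e0.
have -> : cube x e = ([set v : 'rV[R]_n | forall j, ball (x.1.1 0 j) e (v 0 j)] `*`
    [set v : 'rV[R]_n | forall j, ball (x.1.2 0 j) e (v 0 j)]) `*` ball x.2 e.
  apply/seteqP; split => y h.
    by split; [split=> j; [exact: (h (Some (inl j)))|exact: (h (Some (inr j)))]|exact: (h None)].
  by move: h => [[h1 h2] h3] [[j|j]|]; [exact: h1|exact: h2|exact: h3].
have mb (v : 'rV[R]_n) : measurable [set w : 'rV[R]_n | forall j, ball (v 0 j) e (w 0 j)].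
  rewrite (_ : mkset _ = \bigcap_(i in [set: 'I_n])
      ([set: 'rV[R]_n] `&` mx_coord (0, i) @^-1` ball (v 0 i) e)).
    apply: fin_bigcap_measurable => // i _; apply: measurable_mx_coord => //.
    by apply: open_measurable; exact: ball_open.
  by apply/seteqP; split=> [w /= h i _|w h i]; [split=> //; exact: h|exact: (h i I).2].
have E1 (A : set 'rV[R]_n) (B : set 'rV[R]_n) (C : set (measurableTypeR R)) :
    measurable A -> measurable B -> measurable C -> vol ((A `*` B) `*` C) =
    (lebesgue_rV n A * lebesgue_rV n B * lebesgue_measure C)%E.
  move=> mA mB mC.
  have h := @product_measure1E _ _ _ _ _ (sf_product (lebesgue_rV n) (lebesgue_rV n))
    lebesgue_measure (A `*` B) C (measurableX mA mB) mC.
  apply: (eq_trans h); congr (_ * _)%E.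
  exact: (product_measure1E (lebesgue_rV n) (lebesgue_rV n) mA mB).
rewrite E1//; last by apply: open_measurable; exact: ball_open.
have vb (v : 'rV[R]_n) : lebesgue_rV n [set w | forall j, ball (v 0 j) e (w 0 j)] =
    (\prod_(j < n) (e *+ 2))%:E.
  have h := @lebesgue_rV_box R n (fun j => ball (v 0 j) e).
  apply: (eq_trans (h _)); first by move=> i; apply: open_measurable; exact: ball_open.
  by rewrite -prodEFin; apply: eq_bigr => i _; exact: lebesgue_measure_ball (ltW e0).
rewrite !vb lebesgue_measure_ball ?(ltW e0)// -!EFinM lte_fin ltry andbT.
by rewrite !mulr_gt0// ?prodr_gt0// => *; rewrite mulrn_wgt0.
Qed.

End heisenberg_group.

(** * The horizontal fields and compactly supported functions *)

Section horizontal_fields.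
Context {R : realType} {n : nat}.
Local Notation H := (heisenberg R n).
Local Notation HM := ('rV[R]_n * 'rV[R]_n * measurableTypeR R)%type.
Implicit Types (x y z : H) (u f g : H -> R) (k : 'I_n + 'I_n).

Definition hfield k x : H :=
  match k with
  | inl i => (delta_mx 0 i, 0, 2 * x.1.2 0 i)
  | inr i => (0, delta_mx 0 i, - (2 * x.1.1 0 i))
  end.

(** [hgrad] combines partial derivatives; as a single derivative along the vector [hfield k x] it
    inherits the sum and product rules and can be computed along the flow lines of the field. *)
Lemma hgradE k u x : Ck setT 1 u -> hgrad k u x = 'D_(hfield k x) u x.
Proof.
move=> hu; case: k => i /=.
- rewrite /fieldX (_ : (_, _, _) = (2 * x.1.2 0 i) *: dir_t + dir_x i :> H).
    by rewrite derive_linear_dir// addrC.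
  by rewrite /dir_t /dir_x; congr (_, _, _); rewrite /= ?scaler0 ?add0r// addr0 [RHS]mulr1.
- rewrite /fieldY (_ : (_, _, _) = (- (2 * x.1.1 0 i)) *: dir_t + dir_y i :> H).
    by rewrite derive_linear_dir// addrC mulNr.
  by rewrite /dir_t /dir_y; congr (_, _, _); rewrite /= ?scaler0 ?add0r// addr0 [RHS]mulr1.
Qed.

Lemma is_derive_hgrad k u x : Ck setT 1 u -> is_derive x (hfield k x) u (hgrad k u x).
Proof. by move=> hu; rewrite hgradE//; exact: Ck_is_derive hu. Qed.

Lemma hgrad_val k u x l : Ck setT 1 u -> is_derive x (hfield k x) u l -> hgrad k u x = l.
Proof. by move=> hu [_ <-]; exact: hgradE. Qed.

Lemma Ck_hgrad m k u : Ck setT m.+1 u -> Ck setT m (hgrad k u).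
Proof.
move=> hu; case: k => i /=.
- apply: CkD; first exact: CkD1.
  by apply: CkM; [apply: CkZ; exact: (Ck_coord (Some (inr i)))|exact: CkD1].
- apply: CkB; first exact: CkD1.
  by apply: CkM; [apply: CkZ; exact: (Ck_coord (Some (inl i)))|exact: CkD1].
Qed.

Lemma hgradD k f g x : Ck setT 1 f -> Ck setT 1 g ->
  hgrad k (fun y => f y + g y) x = hgrad k f x + hgrad k g x.
Proof.
move=> hf hg; apply: hgrad_val; first exact: CkD.
by apply: is_deriveD'; exact: is_derive_hgrad.
Qed.

Lemma hgradM k f g x : Ck setT 1 f -> Ck setT 1 g ->
  hgrad k (fun y => f y * g y) x = hgrad k f x * g x + f x * hgrad k g x.
Proof.
move=> hf hg; apply: hgrad_val; first exact: CkM.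
by apply: is_deriveM'; exact: is_derive_hgrad.
Qed.

Lemma hgrad_cst k (c : R) x : hgrad k (fun=> c) x = 0.
Proof. by apply: hgrad_val; exact: Ck_cst. Qed.

Lemma hgradZ k (c : R) f x : Ck setT 1 f ->
  hgrad k (fun y => c * f y) x = c * hgrad k f x.
Proof. by move=> hf; rewrite hgradM//; [rewrite hgrad_cst mul0r add0r|exact: Ck_cst]. Qed.

Lemma hgradB k f g x : Ck setT 1 f -> Ck setT 1 g ->
  hgrad k (fun y => f y - g y) x = hgrad k f x - hgrad k g x.
Proof.
move=> hf hg; apply: hgrad_val; first exact: CkB.
by apply: is_deriveB; exact: is_derive_hgrad.
Qed.

Lemma sublapE u x : sublap u x = \sum_k hgrad k (hgrad k u) x.
Proof. by rewrite big_sumType/= /sublap big_split. Qed.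

Lemma Ck_sublap m u : Ck setT m.+2 u -> Ck setT m (sublap u).
Proof.
move=> hu; rewrite (_ : sublap u = fun x => \sum_k hgrad k (hgrad k u) x).
  by apply: Ck_sum => k; do 2 apply: Ck_hgrad.
by apply/funext => x; rewrite sublapE.
Qed.

Definition off (K : set H) f := forall x, ~ K x -> f x = 0.

Lemma off_hgrad (K : set H) k f : closed K -> off K f -> off K (hgrad k f).
Proof.
move=> cK fK x nKx.
have E v : 'D_v f x = 0.
  rewrite (@near_eq_derive _ _ _ _ (fun=> 0)) ?derive_cst//.
  have : nbhs (x : H) (~` K) by apply: open_nbhs_nbhs; split => //; exact: closed_openC.
  by apply: filterS => y; exact: fK.
by case: k => i /=; rewrite /fieldX /fieldY !E mulr0 ?subr0 ?addr0.
Qed.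

Lemma off_sublap (K : set H) f : closed K -> off K f -> off K (sublap f).
Proof.
move=> cK fK x nKx; rewrite sublapE big1// => k _.
by do 2 apply: (@off_hgrad K) => //.
Qed.

Lemma compact_closed_heisenberg (K : set H) : compact K -> closed K.
Proof. by apply: compact_closed; exact: norm_hausdorff. Qed.

Lemma compact_bound (K : set H) f : compact K -> continuous f ->
  exists2 M : R, 0 <= M & forall x, K x -> `|f x| <= M.
Proof.
move=> cK cf; have [->|/set0P K0] := eqVneq K set0; first by exists 0.
have [|c _ hc] := @compact_EVT_max _ R (fun x => `|f x|) K K0 cK.
  apply: continuous_subspaceT => x; apply: continuous_comp; first exact: cf.
  exact: norm_continuous.
by exists `|f c| => // x Kx; apply: hc; rewrite inE.
Qed.

Lemma compact_cube (K : set H) : compact K -> exists2 M : R, 0 < M & K `<=` cube 0 M.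
Proof.
move=> cK.
have /choice[M hM] : forall i : option ('I_n + 'I_n), exists M : R, forall x, K x -> `|coord i x| <= M.
  by move=> i; have [M _ h] := compact_bound cK (@continuous_coord R n i); exists M.
exists (\big[Num.max/1]_i (M i) + 1).
  by rewrite ltr_wpDl//; apply: (le_trans ler01); exact: bigmax_ge_id.
move=> x Kx i; have -> : coord i (0 : H) = 0 by case: i => [[j|j]|] //=; rewrite mxE.
rewrite sub0r normrN; apply: (le_lt_trans (hM i x Kx)).
by rewrite (@le_lt_trans _ _ (\big[Num.max/1]_i (M i)))// ?ltrDl//; exact: le_bigmax_cond.
Qed.

Lemma off_bound (K : set H) f : compact K -> continuous f -> off K f ->
  exists2 M : R, 0 <= M & forall x, `|f x| <= M.
Proof.
move=> cK cf fK; have [M M0 h] := compact_bound cK cf; exists M => // x.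
by have [/h//|/fK ->] := pselect (K x); rewrite normr0.
Qed.

Lemma measurable_compact (K : set H) : compact K -> measurable (K : set HM).
Proof.
move=> /compact_closed_heisenberg cK; rewrite -(setCK K); apply: measurableC.
by apply: open_measurable_heisenberg; exact: closed_openC.
Qed.

Lemma compact_vol (K : set H) : compact K -> (vol (K : set HM) < +oo)%E.
Proof.
move=> cK; have [M M0 KM] := compact_cube cK.
apply: (@le_lt_trans _ _ (vol (cube 0 M : set HM))).
  by apply: le_measure => //; rewrite inE; [exact: measurable_compact|exact: measurable_cube].
by have /andP[] := @vol_cube R n 0 M M0.
Qed.

Lemma off_restrict (K : set H) (f : H -> R) : off K f -> (EFin \o f) = (EFin \o f) \_ K.
Proof.
move=> fK; apply/funext => x; rewrite patchE; case: ifPn => // /negP.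
by rewrite inE => /fK /= ->.
Qed.

Lemma off_integrable (K : set H) (f : H -> R) : compact K ->
  measurable_fun setT (f : HM -> measurableTypeR R) ->
  off K f -> (exists M : R, forall x, `|f x| <= M) ->
  vol.-integrable [set: HM] (EFin \o f).
Proof.
move=> cK mf fK [M hM]; have mK := measurable_compact cK.
rewrite (off_restrict fK) -integrable_mkcond//.
apply: measurable_bounded_integrable => //.
- exact: compact_vol.
- exact: measurable_funTS.
- exists M; split; first exact: num_real.
  by move=> M' MM' x _; apply: le_trans (ltW MM').
Qed.

Lemma integrable_compact_support (K : set H) (f : H -> R) : compact K -> continuous f ->
  off K f -> vol.-integrable [set: HM] (EFin \o f).
Proof.
move=> cK cf fK; apply: (off_integrable cK) => //.
  apply: (continuous_measurable_heisenberg openT) => x _; exact: cf.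
by have [M _ h] := off_bound cK cf fK; exists M.
Qed.

End horizontal_fields.

Lemma preserving_integral {R : realType} d (T : measurableType d)
    (mu : {measure set T -> \bar R}) (phi : T -> T) (F : T -> \bar R) :
  preserving mu phi -> measurable_fun setT F ->
  (\int[mu]_x F (phi x) = \int[mu]_x F x)%E.
Proof.
move=> hphi mF; rewrite integralE [RHS]integralE; congr (_ - _)%E.
- have := hphi (F^\+)%E (measurable_funepos mF) (funepos_ge0 F).
  by under eq_integral do rewrite funeposE; move=> h; under eq_integral do rewrite funeposE.
- have := hphi (F^\-)%E (measurable_funeneg mF) (funeneg_ge0 F).
  by under eq_integral do rewrite funenegE; move=> h; under eq_integral do rewrite funenegE.
Qed.

(** * Integration by parts along the horizontal fields *)

Section integration_by_parts.
Context {R : realType} {n : nat}.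
Local Notation H := (heisenberg R n).
Local Notation HM := ('rV[R]_n * 'rV[R]_n * measurableTypeR R)%type.
Implicit Types (x y z : H) (u f g : H -> R) (k : 'I_n + 'I_n).

Lemma integral_hmulr z (F : HM -> \bar R) : measurable_fun setT F ->
  (\int[vol]_x F (hmul x z) = \int[vol]_x F x)%E.
Proof. exact: preserving_integral (preserving_hmulr z). Qed.

Lemma dot_delta (a : 'rV[R]_n) (h : R) i : dot a (h *: delta_mx 0 i) = h * a 0 i.
Proof.
rewrite /dot (bigD1 i)//= big1 => [|j ji].
  by rewrite addr0 !mxE !eqxx mulr1 mulrC.
by rewrite !mxE eqxx/= (negbTE ji) !mulr0.
Qed.

Lemma dot0 (a : 'rV[R]_n) : dot a 0 = 0.
Proof. by rewrite /dot big1// => j _; rewrite mxE mulr0. Qed.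

(** The flow lines of X_i and Y_i are straight, and moving along them for time [h] is right
    multiplication by a fixed element. The flow hence preserves [vol]. *)
Lemma hmul_hfield k x (h : R) : hmul x (h *: hfield k 0) = h *: hfield k x + x.
Proof.
case: k => i; rewrite /hmul /=; congr (_, _, _); rewrite /= ?scaler0 ?addr0 ?add0r ?dot0 //=.
- by rewrite addrC.
- by rewrite mxE mulr0 scaler0 addr0 dot_delta subr0 addrC; congr (_ + _); rewrite /GRing.scale/=; ring.
- by rewrite addrC.
- by rewrite mxE mulr0 oppr0 scaler0 addr0 dot_delta sub0r addrC; congr (_ + _); rewrite /GRing.scale/=; ring.
Qed.

Lemma hfield_flow k x (h : R) : hfield k (h *: hfield k x + x) = hfield k x.
Proof.
by case: k => i /=; rewrite scaler0 add0r.
Qed.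

Lemma hflowN k x (h : R) : (- h) *: hfield k x + (h *: hfield k x + x) = x.
Proof. by rewrite addrA -scalerDl addNr scale0r add0r. Qed.

Lemma coord_hfield k x (M : R) i : (forall j, `|coord j x| <= M) -> 0 <= M ->
  `|coord i (hfield k x)| <= 1 + 2 * M.
Proof.
move=> hM M0.
have h1 : 1 <= 1 + 2 * M by rewrite lerDl mulr_ge0.
have h0 : 0 <= 1 + 2 * M by apply: le_trans h1.
have hd (a b : 'I_1) (c d : 'I_n) : `|(delta_mx a c : 'rV[R]_n) b d| <= 1 + 2 * M.
  by rewrite mxE; case: andP; rewrite ?normr1 ?normr0.
case: k => j; case: i => [[i|i]|] //=; rewrite ?mxE ?normr0//; rewrite ?normrN normrM ger0_norm//.
- by rewrite (@le_trans _ _ (2 * M))// ?lerDr// ler_wpM2l//; exact: (hM (Some (inr j))).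
- by rewrite (@le_trans _ _ (2 * M))// ?lerDr// ler_wpM2l//; exact: (hM (Some (inl j))).
Qed.

Lemma coord0 i : coord i (0 : H) = 0.
Proof. by case: i => [[j|j]|] //=; rewrite mxE. Qed.

Lemma cube0P (M : R) x : cube 0 M x <-> forall i, `|coord i x| < M.
Proof.
by split => h i; have := h i; rewrite coord0 sub0r normrN.
Qed.

(** A point that reaches [K] by time 1 is the image of a point of [K] under the reversed flow, and
    on [K] the field is bounded by 1 + 2 M. The cube found here carries the dominating function in
    [integral_hgrad0]. *)
Lemma compact_flow (K : set H) k : compact K ->
  exists2 M : R, 0 < M & forall x (s : R), `|s| <= 1 -> K (s *: hfield k x + x) -> cube 0 M x.
Proof.
move=> /compact_cube[M M0 KM]; exists (M + (1 + 2 * M)).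
  by rewrite addr_gt0// ltr_wpDr// mulr_ge0// ltW.
move=> x s s1 /KM /cube0P hK; apply/cube0P => i.
rewrite -(hflowN k x s) coord_lin.
apply: (le_lt_trans (ler_normD _ _)); rewrite addrC ltr_leD//.
rewrite normrM normrN -[leRHS]mul1r ler_pM// -(hfield_flow k x s).
by apply: coord_hfield; [move=> j; exact: ltW|exact: ltW].
Qed.

(** The difference quotients along the flow have integral 0 because the flow preserves [vol]; the
    derivative is their dominated limit. This stands in for the divergence theorem. *)
Lemma integral_hgrad0 (K : set H) k f : compact K -> off K f -> Ck setT 1 f ->
  (\int[vol]_x (hgrad k f x)%:E = 0)%E.
Proof.
move=> cK fK hf.
have clK := compact_closed_heisenberg cK.
have cX : continuous (hgrad k f) by apply: (@Ck_cont _ _ 0); exact: Ck_hgrad.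
have [C C0 hC] := off_bound cK cX (off_hgrad k clK fK).
have [M M0 hM] := compact_flow k cK.
pose h (m : nat) : R := m.+1%:R^-1.
have h0 m : h m != 0 by rewrite invr_eq0 pnatr_eq0.
have h1 m : `|h m| <= 1.
  by rewrite ger0_norm ?invr_ge0// invf_le1 ?ltr0n// ler1n.
pose q m x : R := (h m)^-1 * (f (h m *: hfield k x + x) - f x).
have mf := Ck_measurable hf.
have hE m : (fun x => f (h m *: hfield k x + x)) = (fun x => f (hmul x (h m *: hfield k 0))).
  by apply/funext => x; rewrite hmul_hfield.
have mflow m : measurable_fun setT (fun x : HM => f (h m *: hfield k x + x) : measurableTypeR R).
  by rewrite hE; apply: (measurableT_comp mf); exact: measurable_hmulr.
have If : vol.-integrable [set: HM] (EFin \o f).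
  by apply: (integrable_compact_support cK) => //; exact: Ck_cont hf.
have Iflow m : vol.-integrable [set: HM] (EFin \o (fun x => f (h m *: hfield k x + x))).
  apply/integrableP; split; first by apply/measurable_EFinP; exact: mflow.
  have /integrableP[_] := If; rewrite hE.
  rewrite -(preserving_hmulr (h m *: hfield k 0) (F := fun x => `|(f x)%:E|%E))//.
  by apply: measurableT_comp => //; exact/measurable_EFinP.
have Iq m : vol.-integrable [set: HM] (EFin \o q m).
  by apply: intgZ => //; exact: intgB.
have q0 m : (\int[vol]_x (q m x)%:E = 0)%E.
  under eq_integral do rewrite EFinM EFinB.
  rewrite (integralZl measurableT (integrableB measurableT (Iflow m) If)).
  rewrite (integralB measurableT (Iflow m) If) (_ : (\int[vol]_x (f (h m *: hfield k x + x))%:E)%E = (\int[vol]_x (f x)%:E)%E).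
    by rewrite subee ?mule0//; exact: integrable_fin_num If.
  rewrite -(@integral_hmulr (h m *: hfield k 0) (fun x : HM => (f x)%:E)).
    by apply: eq_integral => x _ /=; rewrite hmul_hfield.
  by apply/measurable_EFinP; exact: mf.
have hlim : h @ \oo --> (0 : R)^'.
  move=> A hA; have := @cvg_harmonic R _ hA.
  by apply: (@filterS _ \oo) => m; apply; exact: (h0 m).
have mcube := @measurable_cube R n 0 M.
have lim : (\int[vol]_x (q m x)%:E)%E @[m --> \oo] --> (\int[vol]_x (hgrad k f x)%:E)%E.
  apply: (@dominated_cvg_real _ _ _ vol [set: HM] measurableT q _ (cst C \_ (cube 0 M))).
  - by move=> m; have /intg_meas := Iq m.
  - move=> x _; have [hd hv] := is_derive_hgrad k x hf.
    have := cvg_comp h _ hlim hd; rewrite -hv /derive.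
    by apply.
  - rewrite -restrict_EFin -integrable_mkcond//.
    apply: measurable_bounded_integrable => //.
      by have /andP[] := @vol_cube R n 0 M M0.
    exists C; split; first exact: num_real.
    by move=> M' MM' y _ /=; rewrite ger0_norm// ltW.
  - move=> m x _; rewrite patchE.
    have [s sh qE] : exists2 s : R, `|s| <= `|h m| & q m x = hgrad k f (s *: hfield k x + x).
      have [s sh E] := mvt_line x (hfield k x) (h m) hf; exists s => //.
      by rewrite /q E mulrA (mulVf (h0 m)) mul1r (hgradE _ _ hf) hfield_flow.
    case: ifPn => [_|]; first by rewrite qE.
    rewrite notin_setE => nM /=; rewrite qE.
    rewrite (off_hgrad k clK fK) ?normr0// => /hM; apply: contra_not nM; apply.
    exact: le_trans sh (h1 m).
apply: (cvg_unique (ereal_hausdorff (R := R)) lim).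
rewrite /= (_ : (fun m => _) = cst 0%E); first exact: cvg_cst.
by apply/funext => m; exact: q0.
Qed.

Lemma integral_by_parts (K : set H) k f g : compact K -> off K f \/ off K g ->
  Ck setT 1 f -> Ck setT 1 g ->
  (\int[vol]_x (f x * hgrad k g x)%:E = - \int[vol]_x (hgrad k f x * g x)%:E)%E.
Proof.
move=> cK fgK hf hg.
have clK := compact_closed_heisenberg cK.
have offM (a b : H -> R) : off K a \/ off K b -> off K (fun x => a x * b x).
  by move=> [h|h] x nx; rewrite (h x nx) ?mulr0 ?mul0r.
have o1 : off K (fun x => f x * hgrad k g x).
  by apply: offM; case: fgK => h; [left|right; exact: (off_hgrad k clK h)].
have o2 : off K (fun x => hgrad k f x * g x).
  by apply: offM; case: fgK => h; [left; exact: (off_hgrad k clK h)|right].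
have I1 : vol.-integrable [set: HM] (EFin \o (fun x => f x * hgrad k g x)).
  apply: (integrable_compact_support cK) => //; apply: (@Ck_cont _ _ 0).
  by apply: CkM; [exact: CkS|exact: Ck_hgrad].
have I2 : vol.-integrable [set: HM] (EFin \o (fun x => hgrad k f x * g x)).
  apply: (integrable_compact_support cK) => //; apply: (@Ck_cont _ _ 0).
  by apply: CkM; [exact: Ck_hgrad|exact: CkS].
have := @integral_hgrad0 K k (fun x => f x * g x) cK (offM _ _ fgK) (CkM hf hg).
under eq_integral do rewrite hgradM// EFinD.
rewrite integralD// => E.
move: E; rewrite -(fineK (integrable_fin_num measurableT I1)).
rewrite -(fineK (integrable_fin_num measurableT I2)) -EFinD -EFinN => -[/eqP].
by rewrite addrC addr_eq0 => /eqP ->.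
Qed.

Lemma integral_sublap_sym (K : set H) f g : compact K -> off K f \/ off K g ->
  Ck setT 2 f -> Ck setT 2 g ->
  (\int[vol]_x (f x * sublap g x)%:E = \int[vol]_x (sublap f x * g x)%:E)%E.
Proof.
move=> cK fgK hf hg.
have clK := compact_closed_heisenberg cK.
have offM (a b : H -> R) : off K a \/ off K b -> off K (fun x => a x * b x).
  by move=> [h|h] x nx; rewrite (h x nx) ?mulr0 ?mul0r.
have I1 k : vol.-integrable [set: HM] (EFin \o (fun x => f x * hgrad k (hgrad k g) x)).
  apply: (integrable_compact_support cK).
    apply: (@Ck_cont _ _ 0); apply: CkM; first by do 2 apply: CkS.
    by do 2 apply: Ck_hgrad.
  by apply: offM; case: fgK => h; [left|right; exact: (off_hgrad k clK (off_hgrad k clK h))].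
have I2 k : vol.-integrable [set: HM] (EFin \o (fun x => hgrad k (hgrad k f) x * g x)).
  apply: (integrable_compact_support cK).
    apply: (@Ck_cont _ _ 0); apply: CkM; last by do 2 apply: CkS.
    by do 2 apply: Ck_hgrad.
  by apply: offM; case: fgK => h; [left; exact: (off_hgrad k clK (off_hgrad k clK h))|right].
transitivity (\sum_k \int[vol]_x (f x * hgrad k (hgrad k g) x)%:E)%E.
  rewrite -integral_sum//; apply: eq_integral => x _.
  by rewrite sublapE mulr_sumr sumEFin.
transitivity (\sum_k \int[vol]_x (hgrad k (hgrad k f) x * g x)%:E)%E; last first.
  rewrite -integral_sum//; apply: eq_integral => x _.
  by rewrite sublapE mulr_suml sumEFin.
apply: eq_bigr => k _.
have o1 : off K f \/ off K (hgrad k g).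
  by case: fgK => h; [left|right; exact: (off_hgrad k clK h)].
have o2 : off K (hgrad k f) \/ off K g.
  by case: fgK => h; [left; exact: (off_hgrad k clK h)|right].
have E1 := integral_by_parts k cK o1 (CkS hf) (Ck_hgrad k hg).
have E2 := integral_by_parts k cK o2 (Ck_hgrad k hf) (CkS hg).
by rewrite E1 E2 oppeK.
Qed.

End integration_by_parts.

(** * Functions of two points, and compact boxes *)

Section pairing.
Context {R : realType} {U V : normedModType R}.
Implicit Types (F : U * V -> R) (x : U) (y : V).

Lemma continuous_pairl y : continuous (fun x : U => (x, y)).
Proof. by move=> x; apply: cvg_pair; [exact: cvg_id|exact: cvg_cst]. Qed.

Lemma continuous_pairr x : continuous (fun y : V => (x, y)).
Proof. by move=> y; apply: cvg_pair; [exact: cvg_cst|exact: cvg_id]. Qed.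

Lemma pairl_affine y x (v : U) (h : R) : (h *: v + x, y) = h *: (v, 0) + (x, y).
Proof. by apply: injective_projections => //=; rewrite scaler0 add0r. Qed.

Lemma pairr_affine x y (v : V) (h : R) : (x, h *: v + y) = h *: (0, v) + (x, y).
Proof. by apply: injective_projections => //=; rewrite scaler0 add0r. Qed.

Lemma Ck_pairl k F y : Ck setT k F -> Ck setT k (fun x => F (x, y)).
Proof. exact: (Ck_affine (@continuous_pairl y) (pairl_affine y)). Qed.

Lemma Ck_pairr k F x : Ck setT k F -> Ck setT k (fun y => F (x, y)).
Proof. exact: (Ck_affine (@continuous_pairr x) (pairr_affine x)). Qed.

Lemma is_derive_pairl F x y v : Ck setT 1 F ->
  is_derive x v (fun x => F (x, y)) ('D_(v, 0) F (x, y)).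
Proof.
by move=> hF; apply: (is_derive_affine (pairl_affine y)); exact: Ck_is_derive hF.
Qed.

Lemma is_derive_pairr F x y v : Ck setT 1 F ->
  is_derive y v (fun y => F (x, y)) ('D_(0, v) F (x, y)).
Proof.
by move=> hF; apply: (is_derive_affine (pairr_affine x)); exact: Ck_is_derive hF.
Qed.

Lemma Ck_fst k (f : U -> R) : Ck setT k f -> Ck setT k (fun p : U * V => f p.1).
Proof.
by apply: (@Ck_affine _ _ _ k f fst fst) => // p; exact: cvg_fst.
Qed.

Lemma Ck_snd k (f : V -> R) : Ck setT k f -> Ck setT k (fun p : U * V => f p.2).
Proof.
by apply: (@Ck_affine _ _ _ k f snd snd) => // p; exact: cvg_snd.
Qed.

Lemma continuous_slice F x : continuous F -> continuous (fun y => F (x, y)).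
Proof.
by move=> cF y; apply: (@continuous_comp _ _ _ (pair x) F); [exact: continuous_pairr|exact: cF].
Qed.

(** Compactness of [C] turns continuity into an estimate uniform in [y], which is what passing a
    limit under the integral needs. *)
Lemma tube F (C : set V) x (e : R) : continuous F -> compact C -> 0 < e ->
  \forall x' \near x, forall y, C y -> `|F (x', y) - F (x, y)| <= e.
Proof.
move=> cF /compact_near_coveringP cC e0.
have := cC U (nbhs x) (fun x' y => `|F (x', y) - F (x, y)| <= e) _; apply.
move=> y Cy.
have e20 : 0 < e / 2 by rewrite divr_gt0.
have h1 : \forall p \near (x, y), `|F (x, y) - F p| <= e / 2.
  by have /cvgrPdist_le := cF (x, y); apply.
have h2 : \forall y' \near y, `|F (x, y) - F (x, y')| <= e / 2.
  have cs := continuous_slice (x:=x) cF.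
  by have /cvgrPdist_le := cs y; apply.
case: h1 => -[A B] /= [nA nB] AB.
exists (B `&` [set y' | `|F (x, y) - F (x, y')| <= e / 2], A) => /=.
  by split => //; exact: filterI.
move=> [y' x'] /= [[By' h] Ax'].
rewrite (_ : _ - _ = (F (x, y) - F (x, y')) - (F (x, y) - F (x', y'))); last first.
  by ring.
rewrite (le_trans (ler_normB _ _))// (splitr e) lerD//.
exact: (AB (x', y')).
Qed.

End pairing.

Section compact_boxes.
Context {R : realType} {n : nat}.
Local Notation H := (heisenberg R n).
Implicit Types (x y : H).

Definition cbox (M : R) : set H := [set x | forall i, `|coord i x| <= M].

Lemma compact_cbox (M : R) : compact (cbox M).
Proof.
pose A : set 'rV[R]_n := [set v | forall j, `[(- M), M]%classic (v 0 j)].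
have cA : compact A by apply: (@rV_compact R n (fun=> `[(- M), M]%classic)) => j; exact: segment_compact.
have -> : cbox M = (A `*` A) `*` `[(- M), M]%classic.
  apply/seteqP; split => x /= h.
    split; first split => j; rewrite /= in_itv/= -ler_norml.
    - exact: (h (Some (inl j))).
    - exact: (h (Some (inr j))).
    by have := h None; rewrite /= ler_norml.
  move: h => [[h1 h2] h3] [[j|j]|] /=.
  - by have := h1 j; rewrite /= in_itv/= ler_norml.
  - by have := h2 j; rewrite /= in_itv/= ler_norml.
  - by move: h3; rewrite ler_norml.
apply: compact_setX; last exact: segment_compact.
exact: compact_setX.
Qed.

Lemma norm_row (v : 'rV[R]_n) j : `|v 0 j| <= `|v|.
Proof.
rewrite [leRHS]/Num.norm/= mx_normrE.
exact: (le_bigmax _ (fun ij : 'I_1 * 'I_n => `|v ij.1 ij.2|) (0, j)).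
Qed.

Lemma norm_coord x i : `|coord i x| <= `|x|.
Proof.
rewrite !prod_normE /=.
case: i => [[j|j]|] /=; rewrite !le_max.
- by rewrite norm_row.
- by rewrite norm_row orbT.
- by rewrite lexx orbT.
Qed.

Lemma bounded_cbox (A : set H) : bounded_set A -> exists2 M : R, 0 < M & A `<=` cbox M.
Proof.
move=> [M [Mr hM]]; exists (`|M| + 1); first by rewrite ltr_wpDl.
move=> x Ax i; apply: (le_trans (norm_coord x i)); apply: hM => //.
by rewrite (le_lt_trans (ler_norm M))// ltrDl.
Qed.

Lemma closed_bounded_compact (A : set H) (M : R) : closed A -> A `<=` cbox M -> compact A.
Proof. by move=> cA AM; apply: subclosed_compact AM => //; exact: compact_cbox. Qed.

End compact_boxes.

(** * Differentiation under the integral sign *)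

Section parametrized_integral.
Context {R : realType} {n : nat}.
Local Notation H := (heisenberg R n).
Local Notation HM := ('rV[R]_n * 'rV[R]_n * measurableTypeR R)%type.
Implicit Types (x y v : H).
Variables (Omega : set H) (mOmega : measurable (Omega : set HM)).
Variables (C : set H) (cC : compact C) (OmegaC : Omega `<=` C).

Definition smoothing (g : H -> R) (F : H * H -> R) x : R :=
  (\int[vol]_(y in (Omega : set HM)) (g y * F (x, y)))%R.

Variables (g : H -> R) (ig : vol.-integrable (Omega : set HM) (EFin \o g)).

Lemma integrable_smoothing (f : H -> R) : continuous f ->
  vol.-integrable (Omega : set HM) (EFin \o (fun y => g y * f y)).
Proof.
move=> cf; have [M M0 hM] := compact_bound cC cf.
apply: (@intg_le _ _ _ _ _ mOmega _ (fun y => M * `|g y|)) => //.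
- apply: measurable_funM; first exact: intg_meas ig.
  apply: measurable_funTS; apply: (continuous_measurable_heisenberg openT) => x _; exact: cf.
- by move=> y Oy; rewrite normrM mulrC ler_wpM2r//; apply: hM; exact: OmegaC.
- by apply: intgZ => //; have := integrable_norm ig.
Qed.

Lemma smoothing_estimate (f h : H -> R) (e : R) : continuous f -> continuous h ->
  (forall y, C y -> `|f y - h y| <= e) ->
  `|(\int[vol]_(y in (Omega : set HM)) (g y * f y))%R -
    (\int[vol]_(y in (Omega : set HM)) (g y * h y))%R| <=
  e * (\int[vol]_(y in (Omega : set HM)) `|g y|)%R.
Proof.
move=> cf ch fh.
have If := integrable_smoothing cf; have Ih := integrable_smoothing ch.
rewrite -RintegralB//.
apply: (le_trans (le_normr_Rintegral _ _)) => //; first exact: (intgB mOmega If Ih).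
rewrite -RintegralZl//; last exact: integrable_norm ig.
apply: le_Rintegral => //.
- by have := integrable_norm (intgB mOmega If Ih).
- by apply: intgZ => //; have := integrable_norm ig.
- move=> y Oy; rewrite -mulrBr normrM mulrC ler_wpM2r//.
  by apply: fh; exact: OmegaC.
Qed.

Let I := (\int[vol]_(y in (Omega : set HM)) `|g y|)%R.

Let I0 : 0 <= I.
Proof. by apply: Rintegral_ge0 => y _. Qed.

Lemma continuous_smoothing (F : H * H -> R) : continuous F -> continuous (smoothing g F).
Proof.
move=> cF x; apply/cvgrPdist_le => e e0.
have e1 : 0 < e / (I + 1) by rewrite divr_gt0// ltr_wpDl.
have h := tube x cF cC e1.
have : nbhs (x : H) (fun x' => `|smoothing g F x - smoothing g F x'| <= e).
  apply: filterS h => x' hx'.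
  rewrite distrC; apply: (le_trans (smoothing_estimate _ _ hx')).
  - exact: continuous_slice.
  - exact: continuous_slice.
  rewrite mulrAC ler_pdivrMr ?ltr_wpDl// ler_wpM2l ?(ltW e0)//.
  by rewrite lerDl.
by [].
Qed.

(** By the mean value theorem the quotient is the derivative at a point [s *: v + x] with [s]
    depending on [y]; [tube] controls it uniformly in [y], so that integrability of [g] suffices. *)
Lemma is_derive_smoothing (F : H * H -> R) x v : Ck setT 1 F ->
  is_derive x v (smoothing g F) (smoothing g ('D_(v, 0) F) x).
Proof.
move=> hF.
have cF := Ck_cont hF.
have cD : continuous ('D_(v, 0) F) by exact: (Ck_cont (CkD1 _ hF)).
suff key : (fun h : R => h^-1 *: ((smoothing g F \o shift x) (h *: v) - smoothing g F x)) @ 0^'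
    --> smoothing g ('D_(v, 0) F) x.
  by split; [apply/cvg_ex; eexists; exact: key|exact: cvg_lim key].
apply/cvgrPdist_le => e e0.
have e1 : 0 < e / (I + 1) by rewrite divr_gt0// ltr_wpDl.
have := tube x cD cC e1 => /nbhs_ballP[d /= d0 hd].
near=> h.
have h0 : h != 0 by near: h; exact: nbhs_dnbhs_neq.
have hsmall : `|h| * `|v| < d.
  have : `|h| < d / (`|v| + 1).
    by near: h; apply: dnbhs0_lt; rewrite divr_gt0// ltr_wpDl.
  rewrite ltr_pdivlMr ?ltr_wpDl//; apply: le_lt_trans.
  by rewrite ler_wpM2l// lerDl.
have -> : h^-1 *: ((smoothing g F \o shift x) (h *: v) - smoothing g F x) =
   (\int[vol]_(y in (Omega : set HM)) (g y * (h^-1 * (F (h *: v + x, y) - F (x, y)))))%R.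
  rewrite /smoothing /= -RintegralB//; first last.
  - by apply: integrable_smoothing; exact: continuous_slice.
  - by apply: integrable_smoothing; exact: continuous_slice.
  rewrite /GRing.scale/= -RintegralZl//; last first.
    by apply: (intgB mOmega); apply: integrable_smoothing; exact: continuous_slice.
  by apply: eq_Rintegral => y _; rewrite -mulrBr mulrCA.
rewrite (le_trans (@smoothing_estimate _ _ (e / (I + 1)) _ _ _))//.
- exact: continuous_slice cD.
- move=> y; apply: cvgM; first exact: cvg_cst.
  apply: cvgB; [exact: (Ck_at (Ck_pairr (h *: v + x) hF))|exact: (Ck_at (Ck_pairr x hF))].
- move=> y Cy.
  have [s sh E] := mvt_line x v h (Ck_pairl y hF).
  rewrite E mulrA mulVf// mul1r.
  have [_ ->] := is_derive_pairl (s *: v + x) y v hF.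
  rewrite distrC; apply: hd => //.
  rewrite -ball_normE /= opprD addrCA subrr addr0 normrN normrZ.
  by rewrite (le_lt_trans _ hsmall)// ler_wpM2r.
- rewrite mulrAC ler_pdivrMr ?ltr_wpDl// ler_wpM2l ?(ltW e0)//.
  by rewrite lerDl.
Unshelve. all: by end_near. Qed.

Lemma Ck_smoothing k (F : H * H -> R) : Ck setT k F -> Ck setT k (smoothing g F).
Proof.
elim: k F => [|k IH] F hF.
  by split=> // x _; apply: continuous_smoothing; exact: Ck_cont hF.
apply: (@CkI _ _ _ _ (fun v => smoothing g ('D_(v, 0) F))).
- by apply: continuous_smoothing; exact: Ck_cont hF.
- by move=> v x; apply: is_derive_smoothing; exact: Ck_le hF.
- by move=> v; apply: IH; exact: CkD1.
Qed.

End parametrized_integral.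

(** * Kernels invariant under right translations *)

Section right_invariant_kernels.
Context {R : realType} {n : nat}.
Local Notation H := (heisenberg R n).
Implicit Types (x y z : H) (F : H * H -> R) (k : 'I_n + 'I_n).

(* [hfield k] generates right translations: a kernel invariant under them turns a
   derivative in [x] into minus the derivative in [y]. *)
Definition flow_invariant k F :=
  forall x y (h : R), F (h *: hfield k x + x, h *: hfield k y + y) = F (x, y).

Lemma hgrad_invariant k F x y : Ck setT 1 F -> flow_invariant k F ->
  hgrad k (fun x => F (x, y)) x = - hgrad k (fun y => F (x, y)) y.
Proof.
move=> hF iF.
have h1 : 'D_(hfield k x, hfield k y) F (x, y) = 0.
  have [_ <-] : is_derive (x, y) (hfield k x, hfield k y) F 0 => //.
  apply/is_deriveP; rewrite (_ : (fun _ => _) = cst (F (x, y))); last first.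
    by apply/funext => h; rewrite /cst -(iF x y h).
  exact: is_derive_cst.
have E : (hfield k x, hfield k y) = (hfield k x, 0) + (0, hfield k y).
  by apply: injective_projections => /=; rewrite ?addr0 ?add0r.
move: h1; rewrite E derive_add_dir//.
rewrite (hgradE _ _ (Ck_pairl y hF)) (hgradE _ _ (Ck_pairr x hF)).
have [_ ->] := is_derive_pairl x y (hfield k x) hF.
have [_ ->] := is_derive_pairr x y (hfield k y) hF.
by move/eqP; rewrite addr_eq0 => /eqP.
Qed.

(** The derivative in the first point is kept as a kernel of both points, so that regularity and
    invariance can be iterated. *)
Definition hgrad1 k F : H * H -> R := fun p => hgrad k (fun x => F (x, p.2)) p.1.

Lemma Ck_hgrad1 m k F : Ck setT m.+1 F -> Ck setT m (hgrad1 k F).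
Proof.
move=> hF.
have hF1 : Ck setT 1 F by exact: Ck_le hF.
have E v (p : H * H) : 'D_v (fun x => F (x, p.2)) p.1 = 'D_(v, 0) F p.
  by case: p => x y; have [_ ->] := is_derive_pairl x y v hF1.
rewrite /hgrad1; case: k => i /=.
- rewrite (_ : (fun _ => _) = fun p : H * H =>
    'D_(dir_x i, 0) F p + 2 * coord (Some (inr i)) p.1 * 'D_(dir_t, 0) F p).
    apply: CkD; first exact: CkD1.
    apply: CkM; last exact: CkD1.
    by apply: CkZ; apply: Ck_fst; exact: Ck_coord.
  by apply/funext => p; rewrite /fieldX !E.
- rewrite (_ : (fun _ => _) = fun p : H * H =>
    'D_(dir_y i, 0) F p - 2 * coord (Some (inl i)) p.1 * 'D_(dir_t, 0) F p).
    apply: CkB; first exact: CkD1.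
    apply: CkM; last exact: CkD1.
    by apply: CkZ; apply: Ck_fst; exact: Ck_coord.
  by apply/funext => p; rewrite /fieldY !E.
Qed.

Lemma hgrad1_invariant k F : Ck setT 1 F -> flow_invariant k F ->
  flow_invariant k (hgrad1 k F).
Proof.
move=> hF iF x y h; rewrite /hgrad1 /=.
rewrite (hgradE _ _ (Ck_pairl _ hF)) (hgradE _ _ (Ck_pairl _ hF)) hfield_flow.
suff : is_derive (h *: hfield k x + x) (hfield k x)
    (fun x0 => F (x0, h *: hfield k y + y)) ('D_(hfield k x) (fun x0 => F (x0, y)) x).
  by case.
apply/is_deriveP.
rewrite (_ : (fun _ => _) = (fun s : R => F (s *: hfield k x + x, y))); last first.
  apply/funext => s; rewrite -(iF (s *: hfield k x + x) y h) hfield_flow; congr (F (_, _)).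
  by rewrite addrCA.
exact: (is_deriveP _ _ _ _).1 (Ck_is_derive x (hfield k x) (Ck_pairl y hF)).
Qed.

(** Each of the two derivatives changes sign when moved from x to y, so the second-order operator
    moves without a sign. *)
Lemma sublap_invariant F x y : Ck setT 2 F -> (forall k, flow_invariant k F) ->
  sublap (fun x => F (x, y)) x = sublap (fun y => F (x, y)) y.
Proof.
move=> hF iF; rewrite !sublapE; apply: eq_bigr => k _.
have hF1 := CkS hF.
have := hgrad_invariant x y (Ck_hgrad1 k hF) (hgrad1_invariant hF1 (iF k)).
rewrite /hgrad1 /= => ->.
rewrite (_ : (fun y0 => hgrad k (fun x0 => F (x0, y0)) x) =
  fun y0 => (-1) * hgrad k (fun y => F (x, y)) y0); last first.
  by apply/funext => y0; rewrite hgrad_invariant// mulN1r.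
rewrite hgradZ; first by rewrite mulN1r opprK.
exact: (Ck_hgrad k (Ck_pairr x hF)).
Qed.

End right_invariant_kernels.

Section smoothing_sublap.
Context {R : realType} {n : nat}.
Local Notation H := (heisenberg R n).
Local Notation HM := ('rV[R]_n * 'rV[R]_n * measurableTypeR R)%type.
Variables (Omega : set H) (mOmega : measurable (Omega : set HM)).
Variables (C : set H) (cC : compact C) (OmegaC : Omega `<=` C).
Variables (g : H -> R) (ig : vol.-integrable (Omega : set HM) (EFin \o g)).
Implicit Types (x y : H) (F : H * H -> R).
Local Notation smoothing := (smoothing Omega).

Lemma is_derive_smoothing' F x v : Ck setT 1 F ->
  'D_v (smoothing g F) x = smoothing g ('D_(v, 0) F) x.
Proof. by move=> hF; have [] := is_derive_smoothing mOmega cC OmegaC ig x v hF. Qed.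

Lemma hgrad_smoothing k F : Ck setT 1 F ->
  hgrad k (smoothing g F) = smoothing g (hgrad1 k F).
Proof.
move=> hF; apply/funext => x.
have I f : Ck setT 0 f -> vol.-integrable (Omega : set HM) (EFin \o (fun y => g y * f y)).
  by move=> hf; apply: (integrable_smoothing mOmega cC OmegaC ig); exact: Ck_cont hf.
have E v y : 'D_v (fun x => F (x, y)) x = 'D_(v, 0) F (x, y).
  by have [_ ->] := is_derive_pairl x y v hF.
have I2 v : vol.-integrable (Omega : set HM) (EFin \o (fun y => g y * 'D_(v, 0) F (x, y))).
  by apply: (I (fun y => 'D_(v, 0) F (x, y))); exact: (Ck_pairr x (CkD1 (v, 0) hF)).
have D v w (c : R) : 'D_v (smoothing g F) x + c * 'D_w (smoothing g F) x =
    (\int[vol]_(y in (Omega : set HM)) (g y * ('D_v (fun x => F (x, y)) x +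
       c * 'D_w (fun x => F (x, y)) x)))%R.
  rewrite !is_derive_smoothing'// /smoothing.
  rewrite -(Rintg_DZ mOmega c (I2 v) (I2 w)).
  by apply: eq_Rintegral => y _; rewrite !E mulrDr mulrCA.
case: k => i; rewrite /hgrad1 /= /fieldX /fieldY; first exact: D.
have := D (dir_y i) dir_t (- (2 * x.1.1 0 i)); rewrite mulNr => ->.
by apply: eq_Rintegral => y _; rewrite mulNr.
Qed.

(** The sublaplacian ends up on [y], where it meets the weak equation with y -> F(x, y) as test
    function. *)
Lemma sublap_smoothing F x : Ck setT 2 F -> (forall k, flow_invariant k F) ->
  sublap (smoothing g F) x =
  (\int[vol]_(y in (Omega : set HM)) (g y * sublap (fun y => F (x, y)) y))%R.
Proof.
move=> hF iF.
have E k : hgrad k (hgrad k (smoothing g F)) x = smoothing g (hgrad1 k (hgrad1 k F)) x.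
  by rewrite hgrad_smoothing ?hgrad_smoothing//; [exact: Ck_hgrad1|exact: CkS].
rewrite sublapE; under eq_bigr do rewrite E.
have I k : vol.-integrable (Omega : set HM)
    (EFin \o (fun y => g y * hgrad1 k (hgrad1 k F) (x, y))).
  apply: (integrable_smoothing mOmega cC OmegaC ig (f := fun y => hgrad1 k (hgrad1 k F) (x, y))).
  by apply: (@Ck_cont _ _ 0); apply: Ck_pairr; do 2 apply: Ck_hgrad1.
rewrite -(@Rintg_sum _ _ _ _ _ mOmega _ _ (fun k y => g y * hgrad1 k (hgrad1 k F) (x, y)))//.
apply: eq_Rintegral => y _; rewrite -mulr_sumr -(sublap_invariant x y hF iF) sublapE.
by [].
Qed.

End smoothing_sublap.

(** * Group identities and the bump kernel *)

Section heisenberg_group_laws.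
Context {R : realType} {n : nat}.
Local Notation H := (heisenberg R n).
Implicit Types (x y z : H).

Lemma dotC (a b : 'rV[R]_n) : dot a b = dot b a.
Proof. by apply: eq_bigr => j _; rewrite mulrC. Qed.

Lemma dotDl (a b c : 'rV[R]_n) : dot (a + b) c = dot a c + dot b c.
Proof. by rewrite /dot -big_split; apply: eq_bigr => j _; rewrite mxE mulrDl. Qed.

Lemma dotNl (a c : 'rV[R]_n) : dot (- a) c = - dot a c.
Proof. by rewrite /dot -sumrN; apply: eq_bigr => j _; rewrite mxE mulNr. Qed.

Lemma dotDr (a b c : 'rV[R]_n) : dot c (a + b) = dot c a + dot c b.
Proof. by rewrite dotC dotDl !(dotC c). Qed.

Lemma dotNr (a c : 'rV[R]_n) : dot c (- a) = - dot c a.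
Proof. by rewrite dotC dotNl (dotC c). Qed.

Lemma hmul_cancelr x y z : hmul (hmul x z) (- hmul y z) = hmul x (- y).
Proof.
rewrite /hmul /=; congr (_, _, _); rewrite /= ?opprD.
- by rewrite addrACA addrN addr0.
- by rewrite addrACA addrN addr0.
- rewrite !(dotDl, dotDr, dotNl, dotNr) (dotC z.1.2 y.1.1) (dotC z.1.1 y.1.2).
  rewrite (dotC z.1.2 z.1.1); ring.
Qed.

Lemma hmulNN x y : hmul x (- y) = - hmul y (- x).
Proof.
apply: coord_eq; rewrite /hmul; case=> [[j|j]|] /=.
- by rewrite !mxE opprD opprK addrC.
- by rewrite !mxE opprD opprK addrC.
- rewrite !dotNr (dotC x.1.2) (dotC x.1.1); ring.
Qed.

Lemma hmul0x x : hmul 0 x = x.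
Proof.
by case: x => [[a b] t]; rewrite /hmul /= !(dotC 0) !dot0 subr0 mulr0 !(addr0, add0r).
Qed.

(** The Euclidean square, not a homogeneous gauge: the kernel requires a function that is smooth,
    even under group inversion, and small only near 0. *)
Definition gauge x : R := \sum_i coord i x ^+ 2.

Lemma gaugeN x : gauge (- x) = gauge x.
Proof.
apply: eq_bigr => i _; rewrite (_ : coord i (- x) = - coord i x) ?sqrrN//.
by case: i => [[j|j]|] //=; rewrite mxE.
Qed.

Lemma gauge_coord x i (e : R) : 0 < e -> gauge x < e ^+ 2 -> `|coord i x| < e.
Proof.
move=> e0 h; rewrite -(@ltr_pXn2r _ 2)// ?nnegrE ?(ltW e0)// real_normK ?num_real//.
apply: le_lt_trans h; rewrite /gauge (bigD1 i)//= lerDl.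
by apply: sumr_ge0 => j _; rewrite sqr_ge0.
Qed.

(* A function of [x y^-1], the group inverse being [- y]. *)
Definition bump (e : R) (p : H * H) : R :=
  smooth_step (e ^+ 2 - gauge (hmul p.1 (- p.2))).

Lemma Ck_bump k e : Ck setT k (bump e).
Proof.
apply: Ck_comp1; first exact: Cinf_smooth_step.
apply: CkB; first exact: Ck_cst.
have c1 i : Ck setT k (fun p : H * H => coord i p.1) by apply: Ck_fst; exact: Ck_coord.
have c2 i : Ck setT k (fun p : H * H => coord i p.2) by apply: Ck_snd; exact: Ck_coord.
apply: Ck_sum => i; apply: CkX; case: i => [[j|j]|].
- rewrite (_ : (fun _ => _) = fun p : H * H => coord (Some (inl j)) p.1 - coord (Some (inl j)) p.2).
    exact: CkB.
  by apply/funext => p; rewrite /= !mxE.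
- rewrite (_ : (fun _ => _) = fun p : H * H => coord (Some (inr j)) p.1 - coord (Some (inr j)) p.2).
    exact: CkB.
  by apply/funext => p; rewrite /= !mxE.
- rewrite (_ : (fun _ => _) = fun p : H * H => coord None p.1 - coord None p.2 +
      2 * (\sum_j coord (Some (inr j)) p.1 * - coord (Some (inl j)) p.2 -
           \sum_j coord (Some (inl j)) p.1 * - coord (Some (inr j)) p.2)).
    apply: CkD; first exact: CkB.
    apply: CkZ; apply: CkB; apply: Ck_sum => j; apply: CkM => //; exact: CkN.
  apply/funext => p /=; congr (_ + 2 * (_ - _)); apply: eq_bigr => j _; by rewrite mxE.
Qed.

Lemma bump_ge0 e p : 0 <= bump e p.
Proof. exact: smooth_step_ge0. Qed.

Lemma bump_sym e x y : bump e (x, y) = bump e (y, x).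
Proof. by rewrite /bump /= hmulNN gaugeN. Qed.

Lemma bump_hmulr e x y z : bump e (hmul x z, hmul y z) = bump e (x, y).
Proof. by rewrite /bump /= hmul_cancelr. Qed.

Lemma flow_invariant_bump k e : flow_invariant k (bump e).
Proof. by move=> x y h; rewrite -!hmul_hfield bump_hmulr. Qed.

(** [e] bounds the coordinates of x y^-1, and the last of them differs from [x.2 - y.2] by twice
    [dot x.1.2 (x.1.1 - y.1.1) - dot x.1.1 (x.1.2 - y.1.2)]. When the coordinates of [x] are at most
    M this costs at most 4 n M e, the origin of the factor. *)
Lemma bump_supp e x y (M : R) : 0 < e -> 0 < M -> (forall i, `|coord i x| <= M) ->
  bump e (x, y) != 0 -> forall i, `|coord i x - coord i y| < e * (1 + 4 * n%:R * M).
Proof.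
move=> e0 M0 hM hb.
have hg : gauge (hmul x (- y)) < e ^+ 2.
  rewrite -subr_gt0 ltNge; apply: contra hb => h.
  by rewrite /bump /= smooth_step0.
have hc i := gauge_coord i e0 hg.
have nM0 : 0 <= 4 * n%:R * M by rewrite !mulr_ge0// ltW.
have ee : e <= e * (1 + 4 * n%:R * M) by rewrite ler_pMr// lerDl.
have hx j : `|x.1.1 0 j - y.1.1 0 j| < e by have := hc (Some (inl j)); rewrite /= !mxE.
have hy j : `|x.1.2 0 j - y.1.2 0 j| < e by have := hc (Some (inr j)); rewrite /= !mxE.
case=> [[j|j]|]; [exact: lt_le_trans (hx j) ee|exact: lt_le_trans (hy j) ee|].
have ht := hc None; move: ht => /= ht.
have E : x.2 - y.2 = (x.2 - y.2 + 2 * (dot x.1.2 (- y.1.1) - dot x.1.1 (- y.1.2))) -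
   2 * (dot x.1.2 (x.1.1 - y.1.1) - dot x.1.1 (x.1.2 - y.1.2)).
  rewrite !dotDr (dotC x.1.2 x.1.1); ring.
have dle (a b : 'rV[R]_n) : (forall j, `|a 0 j| <= M) -> (forall j, `|b 0 j| < e) ->
    `|dot a b| <= n%:R * M * e.
  move=> ha hb'; apply: (le_trans (ler_norm_sum _ _ _)).
  rewrite -mulrA -[n in n%:R]card_ord mulr_natl -sumr_const.
  by apply: ler_sum => j _; rewrite normrM ler_pM// ltW.
rewrite /= E [ltRHS]mulrDr mulr1; apply: (le_lt_trans (ler_normB _ _)); rewrite ltr_leD//.
rewrite normrM ger0_norm//.
have -> : e * (4 * n%:R * M) = 2 * (n%:R * M * e + n%:R * M * e) by ring.
rewrite ler_wpM2l//; apply: (le_trans (ler_normB _ _)); rewrite lerD//; apply: dle.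
- by move=> j; exact: (hM (Some (inr j))).
- by move=> j; rewrite !mxE; exact: hx.
- by move=> j; exact: (hM (Some (inl j))).
- by move=> j; rewrite !mxE; exact: hy.
Qed.

Lemma bump_diag e x : 0 < e -> 0 < bump e (x, x).
Proof.
move=> e0; rewrite /bump /=; apply: smooth_step_gt0.
have -> : hmul x (- x) = 0.
  apply: coord_eq => -[[j|j]|]; rewrite /= ?mxE ?subrr//.
  by rewrite !dotNr (dotC x.1.2); ring.
rewrite /gauge big1 ?subr0 ?exprn_gt0// => i _.
by rewrite coord0 expr0n.
Qed.

End heisenberg_group_laws.

(** * The normalised smoothing kernel *)

Section mollifier.
Context {R : realType} {n : nat}.
Local Notation H := (heisenberg R n).
Local Notation HM := ('rV[R]_n * 'rV[R]_n * measurableTypeR R)%type.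
Implicit Types (x y z : H).

Lemma measurable_bump e : measurable_fun setT (bump e : HM * HM -> measurableTypeR R).
Proof.
have ms : measurable_fun setT (smooth_step : measurableTypeR R -> measurableTypeR R).
  by apply: continuous_measurable_fun; apply: (@Ck_cont _ _ 0); exact: Cinf_smooth_step.
apply: (measurableT_comp ms); apply: measurable_funB; first exact: measurable_cst.
have c1 i : measurable_fun setT (fun p : HM * HM => coord i p.1 : measurableTypeR R).
  by apply: (measurableT_comp (measurable_coord i)); exact: measurable_fst.
have c2 i : measurable_fun setT (fun p : HM * HM => coord i p.2 : measurableTypeR R).
  by apply: (measurableT_comp (measurable_coord i)); exact: measurable_snd.
apply: measurable_sum => i; apply: measurable_funX; case: i => [[j|j]|].
- rewrite (_ : (fun _ => _) = fun p : HM * HM => coord (Some (inl j)) p.1 - coord (Some (inl j)) p.2).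
    by apply: measurable_funB; [exact: c1|exact: c2].
  by apply/funext => p; rewrite /= !mxE.
- rewrite (_ : (fun _ => _) = fun p : HM * HM => coord (Some (inr j)) p.1 - coord (Some (inr j)) p.2).
    by apply: measurable_funB; [exact: c1|exact: c2].
  by apply/funext => p; rewrite /= !mxE.
- rewrite (_ : (fun _ => _) = fun p : HM * HM => coord None p.1 - coord None p.2 +
      2 * (\sum_j coord (Some (inr j)) p.1 * (-1 * coord (Some (inl j)) p.2) -
           \sum_j coord (Some (inl j)) p.1 * (-1 * coord (Some (inr j)) p.2))).
    apply: measurable_funD; first by apply: measurable_funB; [exact: c1|exact: c2].
    apply: measurable_funM; first exact: measurable_cst.
    by apply: measurable_funB; apply: measurable_sum => j; apply: measurable_funM;
      [exact: c1| |exact: c1|]; apply: measurable_funM; [|exact: c2| |exact: c2]; exact: measurable_cst.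
  by apply/funext => p /=; congr (_ + 2 * (_ - _)); apply: eq_bigr => j _; rewrite mxE mulN1r.
Qed.

Lemma off_bump e y : 0 < e -> exists M : R, off (cbox M) (fun x => bump e (x, y)).
Proof.
move=> e0; have [M M0 hM] := compact_cube (@compact_set1 _ y).
have hy i : `|coord i y| <= M by rewrite ltW//; apply: (cube0P M y).1; exact: hM.
exists (M + e * (1 + 4 * n%:R * M)) => x; apply: contra_notP => /eqP hx.
rewrite bump_sym in hx; have h := bump_supp e0 M0 hy hx.
move=> i; rewrite (_ : coord i x = coord i y - (coord i y - coord i x)); last by ring.
by apply: (le_trans (ler_normB _ _)); rewrite lerD// ltW.
Qed.

Lemma integrable_bump e y : 0 < e ->
  vol.-integrable [set: HM] (EFin \o (fun x => bump e (x, y))).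
Proof.
move=> e0; have [M hM] := off_bump y e0.
apply: (integrable_compact_support (@compact_cbox R n M)) => //.
exact: (Ck_cont (Ck_pairl y (Ck_bump 0 e))).
Qed.

Definition mass e : R := (\int[vol]_(x in [set: HM]) bump e (x, 0))%R.

(** Right translation by [y] carries the kernel centred at 0 to the one centred at [y], so one
    constant normalises all of them. *)
Lemma integral_bump e y : 0 < e -> (\int[vol]_x (bump e (x, y))%:E = (mass e)%:E)%E.
Proof.
move=> e0; rewrite /mass /Rintegral fineK; last exact: integrable_fin_num (integrable_bump 0 e0).
rewrite -(@integral_hmulr _ _ y (fun x : HM => (bump e (x, y))%:E)).
  by apply: eq_integral => x _; rewrite -(bump_hmulr e x 0 y) hmul0x.
by have /integrableP[] := integrable_bump y e0.
Qed.

Lemma mass_gt0 e : 0 < e -> 0 < mass e.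
Proof.
move=> e0; pose o : H := 0.
suff : (0 < \int[vol]_x (bump e (x, o))%:E)%E by rewrite integral_bump// lte_fin.
pose c := bump e (o, o) / 2.
have c0 : 0 < c by rewrite divr_gt0// bump_diag.
have cb : continuous (fun x => bump e (x, o)) := Ck_cont (Ck_pairl o (Ck_bump 0 e)).
have : nbhs o (fun x => c <= bump e (x, o)).
  have /cvgrPdist_le /(_ c c0) := cb o.
  apply: filterS => x; rewrite ler_distlC => /andP[h _]; apply: le_trans h.
  by rewrite /c; lra.
move=> /nbhs_ballP[d /= d0 hd].
have mcube := @measurable_cube R n o d.
have /andP[v0 voo] := @vol_cube R n o d d0.
apply: (@lt_le_trans _ _ (c%:E * vol (cube o d : set HM))%E).
  by apply: mule_gt0.
rewrite -integral_cst//.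
apply: (@le_trans _ _ (\int[vol]_(x in (cube o d : set HM)) (bump e (x, o))%:E)%E).
  apply: ge0_le_integral => //.
  - by move=> x _; rewrite lee_fin ltW.
  - apply: measurable_funTS; by have /integrableP[] := integrable_bump o e0.
  - by move=> x hx; rewrite lee_fin; apply: hd; apply/ball_coord.
apply: ge0_subset_integral => //.
- by have /integrableP[] := integrable_bump o e0.
- by move=> x _; rewrite lee_fin bump_ge0.
Qed.

Definition kern e (p : H * H) : R := (mass e)^-1 * bump e p.

Lemma Ck_kern k e : Ck setT k (kern e).
Proof. by apply: CkZ; exact: Ck_bump. Qed.

Lemma kern_ge0 e p : 0 < e -> 0 <= kern e p.
Proof. by move=> e0; rewrite mulr_ge0 ?bump_ge0// invr_ge0 ltW// mass_gt0. Qed.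

Lemma kern_sym e x y : kern e (x, y) = kern e (y, x).
Proof. by rewrite /kern bump_sym. Qed.

Lemma flow_invariant_kern k e : flow_invariant k (kern e).
Proof. by move=> x y h; rewrite /kern flow_invariant_bump. Qed.

Lemma measurable_kern e : measurable_fun setT (kern e : HM * HM -> measurableTypeR R).
Proof. by apply: measurable_funM; [exact: measurable_cst|exact: measurable_bump]. Qed.

Lemma integral_kernl e y : 0 < e -> (\int[vol]_x (kern e (x, y))%:E = 1)%E.
Proof.
move=> e0; under eq_integral do rewrite EFinM.
rewrite (integralZl measurableT (integrable_bump y e0)) integral_bump//.
by rewrite -EFinM mulVf// gt_eqF// mass_gt0.
Qed.

(** By symmetry both marginals are 1: the one in x makes smoothing an L^1 contraction, the one in y
    bounds smoothed indicators by 1. *)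
Lemma integral_kernr e x : 0 < e -> (\int[vol]_y (kern e (x, y))%:E = 1)%E.
Proof.
by move=> e0; under eq_integral do rewrite kern_sym; exact: integral_kernl.
Qed.

Lemma kern_supp e x y (M : R) : 0 < e -> 0 < M -> cbox M x ->
  ~ cube x (e * (1 + 4 * n%:R * M)) y -> kern e (x, y) = 0.
Proof.
move=> e0 M0 hM; apply: contra_notP => /eqP; rewrite /kern mulf_eq0 negb_or => /andP[_ hb].
exact: (bump_supp e0 M0 hM hb).
Qed.

End mollifier.

Lemma cvge0_leP {R : realType} (I : nat -> \bar R) : (forall m, (0 <= I m)%E) ->
  (I m @[m --> \oo] --> 0%E) <->
  (forall e : R, 0 < e -> \forall m \near \oo, (I m <= e%:E)%E).
Proof.
move=> I0; split=> [/fine_cvgP[If I00] e e0|h].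
  move/cvgrPdist_le : I00 => /(_ e e0) I00; near=> m.
  have fm : I m \is a fin_num by near: m.
  rewrite -(fineK fm) lee_fin (le_trans (ler_norm _))//.
  have : `|0 - fine (I m)| <= e by near: m.
  by rewrite sub0r normrN.
apply/fine_cvgP; split.
  have := h 1 ltr01; apply: filterS => m Im1.
  by rewrite ge0_fin_numE// (le_lt_trans Im1)// ltry.
apply/cvgrPdist_le => e e0; have := h e e0; apply: filterS => m Ime.
rewrite sub0r normrN ger0_norm; last exact: fine_ge0.
rewrite -lee_fin fineK// ge0_fin_numE// (le_lt_trans Ime)// ltry.
Unshelve. all: by end_near. Qed.

(** * Convergence of the smoothings in L^1 *)

Section mollifier_convergence.
Context {R : realType} {n : nat}.
Local Notation H := (heisenberg R n).
Local Notation HM := ('rV[R]_n * 'rV[R]_n * measurableTypeR R)%type.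
Implicit Types (x y z : H).
Variables (Omega : set H) (oOmega : open Omega) (M : R) (M0 : 0 < M).
Hypothesis OmegaM : Omega `<=` cbox M.
Implicit Types (f g : H -> R).

Let mOmega : measurable (Omega : set HM) := open_measurable_heisenberg oOmega.
Let cC : compact (cbox M : set H) := @compact_cbox R n M.

Lemma vol_bounded : (vol (Omega : set HM) < +oo)%E.
Proof.
apply: le_lt_trans (compact_vol cC); apply: le_measure => //; rewrite inE//.
exact: measurable_compact.
Qed.

Local Notation intO g := (vol.-integrable (Omega : set HM) (EFin \o g)).
Local Notation T e g := (smoothing Omega g (kern e)).

Lemma integrable_mul_kern e g x : intO g -> intO (fun y => g y * kern e (x, y)).
Proof.
move=> ig; apply: (integrable_smoothing mOmega cC OmegaM ig (f := fun y => kern e (x, y))).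
exact: (Ck_cont (Ck_pairr x (Ck_kern 0 e))).
Qed.

Lemma continuous_mollify e g : intO g -> continuous (T e g).
Proof.
by move=> ig; exact: (Ck_cont (Ck_smoothing mOmega cC OmegaM ig (Ck_kern 0 e))).
Qed.

Lemma mollify_lin e c f g x : intO f -> intO g ->
  T e (fun y => c * f y + g y) x = c * T e f x + T e g x.
Proof.
move=> hf hg; rewrite /smoothing addrC -(Rintg_DZ mOmega c (integrable_mul_kern e x hg) (integrable_mul_kern e x hf)).
by apply: eq_Rintegral => y _; rewrite mulrDl addrC mulrA.
Qed.

Lemma mollify_L1_le e g : 0 < e -> intO g ->
  (\int[vol]_(x in (Omega : set HM)) `|T e g x|%:E <=
   \int[vol]_(x in (Omega : set HM)) `|g x|%:E)%E.
Proof.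
move=> e0 ig.
pose F (p : HM * HM) : \bar R := (((fun y => `|g y|) \_ Omega) p.2 * kern e p)%:E.
have mg : measurable_fun setT ((fun y : HM => `|g y|) \_ Omega).
  apply/(measurable_restrictT _ mOmega).
  by apply: measurableT_comp => //; exact: intg_meas ig.
have mF : measurable_fun setT F.
  apply/measurable_EFinP; apply: measurable_funM; last exact: measurable_kern.
  by apply: (measurableT_comp mg); exact: measurable_snd.
have F0 p : (0 <= F p)%E.
  rewrite lee_fin mulr_ge0//; last exact: kern_ge0.
  by rewrite patchE; case: ifP.
apply: (@le_trans _ _ (\int[vol]_x \int[vol]_y F (x, y))%E).
  apply: (@le_trans _ _ (\int[vol]_(x in (Omega : set HM)) \int[vol]_y F (x, y))%E).
    apply: ge0_le_integral => //.
    - apply/measurable_EFinP; apply: measurableT_comp => //; apply: measurable_funTS.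
      by apply: (@continuous_measurable_heisenberg _ _ setT _ openT) => x _; exact: continuous_mollify.
    - by apply: measurable_funTS; exact: (@measurable_fun_fubini_tonelli_F _ _ _ _ _ svol F).
    - move=> x Ox.
      have := le_normr_Rintegral mOmega (integrable_mul_kern e x ig).
      rewrite -lee_fin => /le_trans; apply.
      rewrite /Rintegral fineK; last first.
        by have := integrable_fin_num mOmega (integrable_norm (integrable_mul_kern e x ig)).
      rewrite integral_mkcond le_eqVlt; apply/orP; left; apply/eqP.
      apply: eq_integral => y _; rewrite /F /= !patchE; case: ifPn => _; last by rewrite mul0r.
      by rewrite normrM (ger0_norm (kern_ge0 _ e0)).
  apply: ge0_subset_integral => //.
    exact: (@measurable_fun_fubini_tonelli_F _ _ _ _ _ svol F).
  by move=> x _; apply: integral_ge0.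
rewrite tonelli_vol// [leRHS]integral_mkcond.
rewrite le_eqVlt; apply/orP; left; apply/eqP; apply: eq_integral => y _.
rewrite /F /=.
under eq_integral do rewrite EFinM.
have ik : vol.-integrable [set: HM] (fun x => (kern e (x, y))%:E).
  exact: (intgZ measurableT (mass e)^-1 (integrable_bump y e0)).
rewrite (integralZl measurableT ik) integral_kernl// mule1.
by rewrite !patchE; case: ifP.
Qed.

Lemma mollify_ge0 e g x : 0 < e -> (forall y, Omega y -> 0 <= g y) -> 0 <= T e g x.
Proof.
by move=> e0 g0; apply: Rintegral_ge0 => y Oy; rewrite mulr_ge0 ?g0 ?kern_ge0.
Qed.

Lemma integrable_indic_bounded (A : set H) : measurable (A : set HM) -> intO (\1_A : H -> R).
Proof.
move=> mA; apply: measurable_bounded_integrable => //; first exact: vol_bounded.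
exists 1; split; first exact: num_real.
move=> N N1 x _ /=; rewrite (le_trans _ (ltW N1))// indicE.
by case: (x \in A); rewrite ?normr1 ?normr0.
Qed.

Lemma mollify_indic_le1 e (A : set H) x : 0 < e -> measurable (A : set HM) -> T e \1_A x <= 1.
Proof.
move=> e0 mA; rewrite -lee_fin /smoothing /Rintegral fineK; last first.
  exact: (integrable_fin_num mOmega (integrable_mul_kern e x (integrable_indic_bounded mA))).
rewrite -(integral_kernr x e0).
have mk : measurable_fun [set: HM] (fun y : HM => (kern e (x, y))%:E).
  apply/measurable_EFinP.
  by apply: (measurableT_comp (measurable_kern e)); exact: pair1_measurable.
apply: (@le_trans _ _ (\int[vol]_(y in (Omega : set HM)) (kern e (x, y))%:E)%E).
  apply: ge0_le_integral => //.
  - by move=> y _; rewrite lee_fin mulr_ge0 ?kern_ge0// indicE.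
  - by have /integrableP[] := integrable_mul_kern e x (integrable_indic_bounded mA).
  - by apply: measurable_funTS.
  - move=> y _; rewrite lee_fin ler_piMl ?kern_ge0// indicE.
by apply: ge0_subset_integral => // y _; rewrite lee_fin kern_ge0.
Qed.

(** For small [e] the kernel at [x] is supported in both [O] and [Omega], so none of its mass is cut
    off. *)
Lemma mollify_indic_eq1 (O : set H) x : open O -> O x -> Omega x ->
  exists2 d : R, 0 < d & forall e, 0 < e -> e < d -> T e \1_O x = 1.
Proof.
move=> oO Ox Omx.
have : nbhs (x : H) (O `&` Omega) by apply: open_nbhs_nbhs; split => //; exact: openI.
move=> /nbhs_ballP[r /= r0 hr].
have k0 : 0 < 1 + 4 * n%:R * M by rewrite ltr_pwDl// !mulr_ge0// ltW.
exists (r / (1 + 4 * n%:R * M)); first by rewrite divr_gt0.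
move=> e e0; rewrite ltr_pdivlMr// => er.
have mO : measurable (O : set HM) := open_measurable_heisenberg oO.
apply: EFin_inj; rewrite /smoothing /Rintegral fineK; last first.
  exact: (integrable_fin_num mOmega (integrable_mul_kern e x (integrable_indic_bounded mO))).
rewrite -(integral_kernr x e0) integral_mkcond; apply: eq_integral => y _.
rewrite patchE indicE.
have [yc|nyc] := pselect (cube x (e * (1 + 4 * n%:R * M)) y); last first.
  by rewrite (kern_supp e0 M0 (OmegaM Omx) nyc) mulr0; case: ifP.
have [Oy Omy] : (O `&` Omega) y.
  by apply: hr; apply/(ball_coord _ _ r0) => i; exact: lt_trans (yc i) er.
by rewrite !mem_set// mul1r.
Qed.

Definition eps_ (m : nat) : R := m.+1%:R^-1.

Lemma eps_gt0 m : 0 < eps_ m.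
Proof. by rewrite invr_gt0. Qed.

Lemma cvg_eps : eps_ @ \oo --> 0.
Proof. exact: cvg_harmonic. Qed.

Let P g := (\int[vol]_(x in (Omega : set HM)) `|T (eps_ m) g x - g x|%:E)%E @[m --> \oo] --> 0%E.

Lemma integrable_mollify e g : 0 < e -> intO g -> intO (T e g).
Proof.
move=> e0 ig; apply/integrableP; split.
  apply/measurable_EFinP; apply: measurable_funTS.
  by apply: (continuous_measurable_heisenberg openT) => x _; exact: continuous_mollify.
apply: (le_lt_trans (mollify_L1_le e0 ig)).
by have /integrableP[] := ig.
Qed.

Let P_open (O : set H) : open O -> P \1_O.
Proof.
move=> oO; have mO : measurable (O : set HM) := open_measurable_heisenberg oO.
(* [|T 1_O - 1_O| = T 1_O - 1_O + J], and [T] does not increase the L^1 norm. *)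
pose J m x : R := 2 * (\1_O x * (1 - T (eps_ m) \1_O x)).
have J0 m x : 0 <= J m x.
  rewrite !mulr_ge0// ?indicE// subr_ge0; exact: mollify_indic_le1 (eps_gt0 m) mO.
have iO := integrable_indic_bounded mO.
have iT m := integrable_mollify (eps_gt0 m) iO.
have T0 m x : 0 <= T (eps_ m) \1_O x.
  by apply: (mollify_ge0 x (eps_gt0 m)) => y _; rewrite indicE.
have T1 m x : T (eps_ m) \1_O x <= 1 by exact: mollify_indic_le1 (eps_gt0 m) mO.
have mJ m : measurable_fun (Omega : set HM) (J m).
  apply: measurable_funM => //; apply: measurable_funM; first exact: intg_meas iO.
  by apply: measurable_funB => //; exact: intg_meas (iT m).
have iJ m : intO (J m).
  apply: (@intg_le _ _ _ _ _ mOmega _ (fun x => 2 * \1_O x)) => //; last exact: intgZ.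
  move=> x _; rewrite ger0_norm// ler_wpM2l// ler_piMr ?indicE//.
  by rewrite lerBlDr lerDl.
have cJ : (\int[vol]_(x in (Omega : set HM)) (J m x)%:E)%E @[m --> \oo] --> 0%E.
  rewrite -[X in _ --> X](integral0 vol (Omega : set HM)).
  apply: (@dominated_cvg_real _ _ _ vol (Omega : set HM) mOmega J (cst 0) (fun x => 2 * \1_O x)) => //; last 2 first.
  - exact: intgZ.
  - move=> m x _; rewrite ger0_norm// ler_wpM2l// ler_piMr ?indicE//.
    by rewrite lerBlDr lerDl.
  move=> x Omx; have [Ox|nOx] := pselect (O x); last first.
    rewrite /J (_ : (fun m => _) = cst 0); first exact: cvg_cst.
    by apply/funext => m; rewrite indicE memNset// mul0r mulr0.
  have [d d0 hd] := mollify_indic_eq1 oO Ox Omx.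
  apply: cvg_near_cst.
  have /cvgrPdist_lt/(_ _ d0) := cvg_eps; apply: filterS => m.
  rewrite sub0r normrN gtr0_norm ?eps_gt0// => hm.
  by rewrite /J hd ?eps_gt0// subrr !mulr0.
apply/cvge0_leP; first by move=> m; apply: integral_ge0 => x _; rewrite lee_fin.
move=> e e0.
have J_ge m : (0 <= \int[vol]_(x in (Omega : set HM)) (J m x)%:E)%E.
  by apply: integral_ge0 => x _; rewrite lee_fin.
have h := (cvge0_leP J_ge).1 cJ _ e0.
apply: filterS h => m; apply: le_trans.
have iTO : intO (fun x => T (eps_ m) \1_O x - \1_O x) by exact: (intgB mOmega (iT m) iO).
have E : (\int[vol]_(x in (Omega : set HM)) `|T (eps_ m) \1_O x - \1_O x|%:E =
    \int[vol]_(x in (Omega : set HM)) (T (eps_ m) \1_O x)%:E -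
    \int[vol]_(x in (Omega : set HM)) (\1_O x)%:E +
    \int[vol]_(x in (Omega : set HM)) (J m x)%:E)%E.
  rewrite -(integralB mOmega (iT m) iO) -(integralD mOmega (integrableB mOmega (iT m) iO) (iJ m)).
  apply: eq_integral => x _; rewrite /= /J indicE -EFinB -EFinD; congr EFin.
  case: (x \in O) => /=.
    by rewrite ler0_norm ?subr_le0 ?T1//; ring.
  by rewrite subr0 ger0_norm//; ring.
rewrite E -[leRHS]add0e leeD2r// sube_le0.
have := mollify_L1_le (eps_gt0 m) iO.
by under eq_integral do rewrite ger0_norm//; under [X in (_ <= X)%E]eq_integral do rewrite ger0_norm ?indicE//.
Qed.

(** [L1_ind] reduces the claim to indicators of open sets. The boundary of an open set may have
    positive measure, so pointwise convergence is used only at points of the set; the L^1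
    contraction bounds what the smoothing puts outside. *)
Lemma mollifier_cvg g : intO g -> P g.
Proof.
move=> ig.
have H1 : forall e, 0 < e -> 0 < e / 3 :> R by move=> e e0; rewrite divr_gt0.
apply: (@L1_ind _ HM R vol (Omega : set HM) mOmega vol_bounded (@open H)
  measurable_heisenbergE _ P _ P_open _ _ g ig).
- exact: openI.
- by rewrite (_ : cst 1 = \1_[set: H]); [exact: P_open openT|rewrite indicT].
- move=> c f h hf hh Pf Ph.
  apply/cvge0_leP; first by move=> m; apply: integral_ge0 => x _; rewrite lee_fin.
  move=> e e0.
  have e1 : 0 < e / 2 / (`|c| + 1) by rewrite !divr_gt0// ltr_wpDl.
  have e2 : 0 < e / 2 by rewrite divr_gt0.
  have nP f' : intO f' -> P f' -> forall e, 0 < e -> \forall m \near \oo,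
      (\int[vol]_(x in (Omega : set HM)) `|T (eps_ m) f' x - f' x|%:E <= e%:E)%E.
    move=> if' Pf'; apply: (cvge0_leP _).1 Pf' => m.
    by apply: integral_ge0 => x _; rewrite lee_fin.
  have HF := filterI (nP f hf Pf _ e1) (nP h hh Ph _ e2); case: HF => N _ HN; exists N => // m /HN [h1 h2] {HN}.
  have := @le_int_lin _ _ _ vol _ mOmega (fun x => T (eps_ m) (fun y => c * f y + h y) x - (c * f x + h x))
     (fun x => T (eps_ m) f x - f x) (fun x => T (eps_ m) h x - h x) `|c| 1 _ _ (normr_ge0 c) ler01.
  move=> /(_ _ _ _ _ _ _ h1 h2) hl.
  apply: le_trans (hl _ _ _ _) _.
  - have ifh : intO (fun y => c * f y + h y) := intgD mOmega (intgZ mOmega c hf) hh.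
    exact: (intg_meas (intgB mOmega (integrable_mollify (eps_gt0 m) ifh) ifh)).
  - exact: (intg_meas (intgB mOmega (integrable_mollify (eps_gt0 m) hf) hf)).
  - exact: (intg_meas (intgB mOmega (integrable_mollify (eps_gt0 m) hh) hh)).
  - move=> x _; rewrite mollify_lin// mul1r -normrM.
    rewrite (_ : _ - _ = c * (T (eps_ m) f x - f x) + (T (eps_ m) h x - h x)); last by ring.
    exact: ler_normD.
  rewrite lee_fin mul1r [leRHS](splitr e) lerD2r mulrA ler_pdivrMr ?ltr_wpDl//.
  by rewrite mulrC ler_wpM2l ?(ltW e2)// lerDl.
- move=> f_ f hf_ hf cf Pf_.
  apply/cvge0_leP; first by move=> m; apply: integral_ge0 => x _; rewrite lee_fin.
  move=> e e0; have e3 : 0 < e / 3 by exact: H1.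
  have f_ge m : (0 <= \int[vol]_(x in (Omega : set HM)) `|f x - f_ m x|%:E)%E.
    by apply: integral_ge0 => x _; rewrite lee_fin.
  have [N _ /(_ N (leqnn N)) hN] := (cvge0_leP f_ge).1 cf _ e3.
  have nP f' : intO f' -> P f' -> forall e, 0 < e -> \forall m \near \oo,
      (\int[vol]_(x in (Omega : set HM)) `|T (eps_ m) f' x - f' x|%:E <= e%:E)%E.
    move=> if' Pf'; apply: (cvge0_leP _).1 Pf' => m.
    by apply: integral_ge0 => x _; rewrite lee_fin.
  have HF := nP _ (hf_ N) (Pf_ N) _ e3; case: HF => N' _ HN'; exists N' => // m /HN' hm {HN'}.
  have em := eps_gt0 m.
  have id : intO (fun x => f x - f_ N x) by exact: (intgB mOmega).
  have iTd := integrable_mollify em id.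
  have iTN : intO (fun x => T (eps_ m) (f_ N) x - f_ N x).
    by apply: (intgB mOmega) => //; exact: integrable_mollify.
  (* The three terms of T f - f = T (f - f_N) + (T f_N - f_N) - (f - f_N) are each at most e / 3 in
     L^1, the first by contraction. *)
  have hT := le_trans (mollify_L1_le em id) hN.
  have h2 := @le_int_lin _ _ _ vol _ mOmega
    (fun x => (T (eps_ m) (f_ N) x - f_ N x) - (f x - f_ N x)) _ _ 1 1 _ _ ler01 ler01
    (intg_meas (intgB mOmega iTN id)) (intg_meas iTN) (intg_meas id) _ hm hN.
  have h3 := @le_int_lin _ _ _ vol _ mOmega
    (fun x => T (eps_ m) f x - f x) _ _ 1 1 _ _ ler01 ler01
    (intg_meas (intgB mOmega (integrable_mollify em hf) hf)) (intg_meas iTd)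
    (intg_meas (intgB mOmega iTN id)) _ hT (h2 _).
  apply: le_trans (h3 _ _) _.
  - move=> x _; rewrite !mul1r.
    have -> : T (eps_ m) (fun x => f x - f_ N x) x = T (eps_ m) f x - T (eps_ m) (f_ N) x.
      rewrite (_ : (fun x => f x - f_ N x) = (fun x => (-1) * f_ N x + f x)).
        by rewrite mollify_lin// mulN1r addrC.
      by apply/funext => y; rewrite mulN1r addrC.
    rewrite (_ : T (eps_ m) f x - f x = (T (eps_ m) f x - T (eps_ m) (f_ N) x) +
      (T (eps_ m) (f_ N) x - f_ N x - (f x - f_ N x))); last by ring.
    exact: ler_normD.
  - by move=> x _; rewrite !mul1r ler_normB.
  by rewrite lee_fin !mul1r; lra.
Qed.

End mollifier_convergence.

(** * Subsequences and square integrable functions *)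

Section almost_everywhere_subsequence.
Context d {T : measurableType d} {R : realType} (mu : {measure set T -> \bar R}).
Variables (D : set T) (mD : measurable D).

(** [s] is not asked to increase: [k <= s k] is enough to inherit limits along it. *)
Lemma ae_subsequence (f : nat -> T -> R) : (forall m, measurable_fun D (f m)) ->
  (forall m x, D x -> 0 <= f m x) ->
  (\int[mu]_(x in D) (f m x)%:E)%E @[m --> \oo] --> 0%E ->
  exists s : nat -> nat, (forall k, (k <= s k)%N) /\
    {ae mu, forall x, D x -> f (s m) x @[m --> \oo] --> (0 : R)}.
Proof.
move=> mf f0 /cvge0_leP hf.
have I0 m : (0 <= \int[mu]_(x in D) (f m x)%:E)%E.
  by apply: integral_ge0 => x Dx; rewrite lee_fin f0.
have hN k : exists N, forall m, (N <= m)%N ->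
    (\int[mu]_(x in D) (f m x)%:E <= (1 / (2 ^ (k + 1))%:R)%:E)%E.
  have [|N _ HN] := hf I0 (1 / (2 ^ (k + 1))%:R).
    by rewrite divr_gt0// ltr0n expn_gt0.
  by exists N.
have [N HN] := choice hN.
exists (fun k => maxn k (N k)); split; first by move=> k; exact: leq_maxl.
by apply: (ae_cvg0 mD) => // [m x|m]; [exact: f0|exact: HN (leq_maxr _ _)].
Qed.

End almost_everywhere_subsequence.

Section square_integrable.
Context d {T : measurableType d} {R : realType} (mu : {measure set T -> \bar R}).
Variables (D : set T) (mD : measurable D).
Implicit Types (f g : T -> R).

(** Membership in L^2 stated for real integrands, so that products and combinations are handled by
    integrability alone; [space_L2P] links it to [space_L]. *)
Definition sq_int f := measurable_fun D f /\
  mu.-integrable D (EFin \o (fun x => f x ^+ 2)).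

Lemma sq_int_le f (a b : R) g h : measurable_fun D f -> 0 <= a -> 0 <= b ->
  (forall x, D x -> f x ^+ 2 <= a * g x ^+ 2 + b * h x ^+ 2) ->
  sq_int g -> sq_int h -> sq_int f.
Proof.
move=> mf a0 b0 fgh [mg ig] [mh ih]; split => //.
apply: (@intg_le _ _ _ _ _ mD _ (fun x => a * g x ^+ 2 + b * h x ^+ 2)).
- exact: measurable_funX.
- by move=> x Dx; rewrite ger0_norm ?sqr_ge0// fgh.
- by apply: (intgD mD); apply: (intgZ mD).
Qed.

Lemma sq_int_lin (c : R) f g : sq_int f -> sq_int g -> sq_int (fun x => c * f x + g x).
Proof.
move=> hf hg; have [mf _] := hf; have [mg _] := hg.
apply: (@sq_int_le _ (2 * c ^+ 2) 2 f g) => //.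
- by apply: measurable_funD => //; exact: measurable_funM.
- by rewrite mulr_ge0// sqr_ge0.
- by move=> x _; have := sqr_ge0 (c * f x - g x); nra.
Qed.

Lemma sq_intB f g : sq_int f -> sq_int g -> sq_int (fun x => f x - g x).
Proof.
move=> hf hg; have := sq_int_lin (-1) hg hf.
by congr sq_int; apply/funext => x; rewrite mulN1r addrC.
Qed.

Lemma sq_intM f g : sq_int f -> sq_int g ->
  mu.-integrable D (EFin \o (fun x => f x * g x)).
Proof.
move=> [mf hf] [mg hg].
apply: (@intg_le _ _ _ _ _ mD _ (fun x => f x ^+ 2 + g x ^+ 2)).
- exact: measurable_funM.
- move=> x _; have := sqr_ge0 (f x - g x); have := sqr_ge0 (f x + g x).
  by rewrite ler_norml; nra.
- exact: intgD.
Qed.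

Lemma intg_cst (c : R) : (mu D < +oo)%E -> mu.-integrable D (EFin \o (fun=> c)).
Proof.
move=> Dfin; apply: measurable_bounded_integrable => //.
exists `|c|; split; first exact: num_real.
by move=> N cN x _; exact: ltW.
Qed.

Lemma sq_int_bounded f (B : R) : (mu D < +oo)%E -> measurable_fun D f ->
  (forall x, D x -> `|f x| <= B) -> sq_int f.
Proof.
move=> Dfin mf fB; split => //.
apply: (@intg_le _ _ _ _ _ mD _ (fun=> B ^+ 2)).
- exact: measurable_funX.
- move=> x Dx; rewrite ger0_norm ?sqr_ge0// -[leLHS]real_normK ?num_real//.
  by rewrite ler_sqr ?nnegrE// ?fB// (le_trans _ (fB _ Dx)).
- exact: intg_cst.
Qed.

Lemma sq_int_intg f : (mu D < +oo)%E -> sq_int f -> mu.-integrable D (EFin \o f).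
Proof.
move=> Dfin hf.
have h1 : sq_int (fun=> 1) by apply: (sq_int_bounded (B := 1)) => // x _; rewrite normr1.
by have := sq_intM hf h1; congr integrable; apply/funext => x /=; rewrite mulr1.
Qed.

End square_integrable.

(** * Weak derivatives and membership in D *)

Section weak_derivatives.
Context {R : realType} {n : nat}.
Local Notation H := (heisenberg R n).
Local Notation HM := ('rV[R]_n * 'rV[R]_n * measurableTypeR R)%type.
Implicit Types (x y z : H) (u v w f g h phi psi : H -> R) (k : 'I_n + 'I_n).
Variables (Omega : set H) (oOmega : open Omega) (M : R) (M0 : 0 < M).
Hypothesis OmegaM : Omega `<=` cbox M.

Let mOmega : measurable (Omega : set HM) := open_measurable_heisenberg oOmega.
Let vOmega : (vol (Omega : set HM) < +oo)%E := vol_bounded oOmega OmegaM.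
Local Notation intO g := (vol.-integrable (Omega : set HM) (EFin \o g)).
Local Notation sqO g := (sq_int vol (Omega : set HM) g).

Lemma compact_subset_cube (C : set H) : compact C -> C `<=` Omega ->
  exists2 d : R, 0 < d & forall x, C x -> cube x d `<=` Omega.
Proof.
move=> /compact_near_coveringP cC CO.
have [x Cx|N _ HN] := cC nat \oo (fun m x => cube x (eps_ m) `<=` Omega) _; last first.
  exists (eps_ N); first exact: eps_gt0.
  by move=> x Cx; exact: (HN N (leqnn N)).
have /nbhs_ballP[r /= r0 hr] : nbhs (x : H) Omega.
  by apply: open_nbhs_nbhs; split => //; exact: CO.
have r2 : 0 < r / 2 by rewrite divr_gt0.
exists (ball x (r / 2), [set m | eps_ m < r / 2]).
  split; first exact: nbhsx_ballx.
  have /cvgrPdist_lt/(_ _ r2) := @cvg_eps R; apply: filterS => m.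
  by rewrite sub0r normrN gtr0_norm ?eps_gt0.
move=> [x' m] /= [/(ball_coord _ _ r2) xx' em] y yx'.
apply: hr; apply/(ball_coord _ _ r0) => i.
rewrite (_ : _ - _ = (coord i x - coord i x') + (coord i x' - coord i y)); last by ring.
rewrite (le_lt_trans (ler_normD _ _))// (splitr r) ltrD//.
exact: lt_trans (yx' i) em.
Qed.

Lemma kern_Cinfc (C : set H) : compact C -> C `<=` Omega ->
  exists2 d : R, 0 < d & forall e x, 0 < e -> e < d -> C x ->
    Cinfc Omega (fun y => kern e (x, y)).
Proof.
move=> cC CO; have [r r0 hr] := compact_subset_cube cC CO.
have k0 : 0 < 1 + 4 * n%:R * M by rewrite ltr_pwDl// !mulr_ge0// ltW.
exists (r / 2 / (1 + 4 * n%:R * M)); first by rewrite !divr_gt0.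
move=> e x e0; rewrite ltr_pdivlMr// => er Cx; split.
  by move=> k; exact: Ck_pairr (Ck_kern k e).
(* The kernel lives in the cube of radius [e * (1 + 4 * n%:R * M)], here below r / 2. The closed box
   [K] of radius r / 2 lies in the open cube of radius r, hence in [Omega], and is compact. *)
pose K : set H := (fun y => x - y) @^-1` cbox (r / 2).
have KP y : K y <-> forall i, `|coord i x - coord i y| <= r / 2.
  have cB i : coord i (x - y) = coord i x - coord i y.
    by rewrite addrC -scaleN1r coord_lin mulN1r addrC.
  by split=> Ky i; have := Ky i; rewrite cB.
have clK : closed K.
  apply: (@closed_comp _ _ (fun y : H => x - y) (cbox (r / 2))); last first.
    exact: compact_closed_heisenberg (@compact_cbox _ _ _).
  move=> y _; apply: (@continuousB _ _ _ (cst x) id); [exact: cst_continuous|exact: cvg_id].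
have KO : K `<=` Omega.
  move=> y /KP Ky; apply: (hr x Cx) => i; apply: le_lt_trans (Ky i) _.
  by rewrite ltr_pdivrMr// ltr_pMr// ltr1n.
exists K; split => //.
  by apply: (closed_bounded_compact clK (M := M)) => y /KO; exact: OmegaM.
move=> y nKy; apply: (kern_supp e0 M0 (OmegaM (CO _ Cx))) => yc; apply/nKy/KP => i.
exact/ltW/(lt_trans (yc i)).
Qed.

Lemma ae_mollifier g : intO g -> exists s : nat -> nat, (forall m, (m <= s m)%N) /\
  {ae vol, forall x : HM, Omega x -> smoothing Omega g (kern (eps_ (s m))) x @[m --> \oo] --> g x}.
Proof.
move=> ig.
have [m|m x _|s [ss hs]] := @ae_subsequence _ HM R vol (Omega : set HM) mOmega
    (fun m x => `|smoothing Omega g (kern (eps_ m)) x - g x|) _ _ (mollifier_cvg oOmega M0 OmegaM ig).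
- apply: measurableT_comp => //; apply: measurable_funB; last exact: intg_meas ig.
  exact: (intg_meas (integrable_mollify oOmega OmegaM (eps_gt0 m) ig)).
- exact: normr_ge0.
exists s; split => //; apply: filterS hs => x hx Ox.
by apply/subr_cvg0/norm_cvg0P; exact: hx.
Qed.

(** Testing with K(x, .) shows that the smoothings of [g] vanish at [x] for small scales, while
    along a subsequence they tend to [g] almost everywhere. *)
Lemma fundamental_lemma g : intO g ->
  (forall phi, Cinfc Omega phi -> (\int[vol]_(x in (Omega : set HM)) (g x * phi x)%:E = 0)%E) ->
  {ae vol, forall x : HM, Omega x -> g x = 0}.
Proof.
move=> ig g0; have [s [ss hs]] := ae_mollifier ig.
apply: filterS hs => x hx Ox; have {}hx := hx Ox.
have [|d d0 hd] := @kern_Cinfc [set (x : H)] (@compact_set1 _ _); first by move=> _ ->.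
apply: (cvg_unique _ hx) => //; apply: cvg_near_cst.
have /cvgrPdist_lt/(_ _ d0)[N _ HN] := @cvg_eps R; exists N => // m Nm.
rewrite /smoothing /Rintegral g0//; apply: hd => //; first exact: eps_gt0.
have := HN (s m) (leq_trans Nm (ss m)).
by rewrite sub0r normrN gtr0_norm ?eps_gt0.
Qed.

Lemma norm_L2E g : norm_L Omega 2%:E g =
  ((\int[vol]_(x in (Omega : set HM)) (g x ^+ 2)%:E) `^ 2^-1)%E.
Proof.
rewrite /norm_L Lnorm.unlock; congr (_ `^ _)%E.
rewrite [RHS]integral_mkcond; apply: eq_integral => x _.
rewrite !patchE; case: ifP => _; last by rewrite abse0 poweR0r.
by rewrite /= powR_mulrn// real_normK ?num_real.
Qed.

Lemma space_L2P g : space_L Omega 2%:E g <-> sqO g.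
Proof.
rewrite /space_L /= norm_L2E /sq_int; split=> -[mg h]; split => //.
  apply/integrableP; split; first by apply/measurable_EFinP; exact: measurable_funX.
  under eq_integral do rewrite /= ger0_norm ?sqr_ge0//.
  by rewrite ltey; apply/eqP => hy; move: h; rewrite hy poweRyr.
apply: poweR_lty; have /integrableP[_] := h.
by under eq_integral do rewrite /= ger0_norm ?sqr_ge0//.
Qed.

Lemma norm_L2_le g (e : R) : 0 <= e ->
  (\int[vol]_(x in (Omega : set HM)) (g x ^+ 2)%:E <= (e ^+ 2)%:E)%E ->
  (norm_L Omega 2%:E g <= e%:E)%E.
Proof.
move=> e0 he; rewrite norm_L2E.
have -> : e%:E = ((e ^+ 2)%:E `^ 2^-1)%E.
  by rewrite poweR_EFin -powR_mulrn// -powRrM mulfV// powRr1.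
apply: gt0_ler_poweR => //; rewrite ?in_itv/= ?leey ?andbT ?lee_fin ?sqr_ge0//.
by apply: integral_ge0 => x _; rewrite lee_fin sqr_ge0.
Qed.

Lemma Cinfc_sq phi : Cinfc Omega phi -> sqO phi.
Proof.
move=> [sphi [K [cK KO Kphi]]].
have [B B0 hB] := off_bound cK (Ck_cont (sphi 0)) Kphi.
apply: (sq_int_bounded mOmega (B := B)) => //.
by apply: measurable_funTS; exact: Ck_measurable (sphi 0).
Qed.

Lemma Cinfc_hgrad k phi : Cinfc Omega phi -> Cinfc Omega (hgrad k phi).
Proof.
move=> [sphi [K [cK KO Kphi]]]; split; first by move=> m; exact: Ck_hgrad.
by exists K; split => //; apply: off_hgrad => //; exact: compact_closed_heisenberg.
Qed.

Lemma Cinfc_sublap phi : Cinfc Omega phi -> Cinfc Omega (sublap phi).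
Proof.
move=> [sphi [K [cK KO Kphi]]]; split; first by move=> m; exact: Ck_sublap.
by exists K; split => //; apply: off_sublap => //; exact: compact_closed_heisenberg.
Qed.

Lemma ae_eq_weak g h : sqO g -> sqO h ->
  (forall phi, Cinfc Omega phi ->
    (\int[vol]_(x in (Omega : set HM)) (g x * phi x)%:E =
     \int[vol]_(x in (Omega : set HM)) (h x * phi x)%:E)%E) ->
  ae_in Omega (fun x => g x = h x).
Proof.
move=> sg sh gh.
suff h0 : {ae vol, forall x : HM, Omega x -> g x - h x = 0}.
  by apply: filterS h0 => x h0 Ox; apply/eqP; rewrite -subr_eq0 h0.
apply: fundamental_lemma; first exact: (sq_int_intg mOmega vOmega (sq_intB mOmega sg sh)).
move=> phi cphi; have sphi := Cinfc_sq cphi.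
have i1 := sq_intM mOmega sg sphi; have i2 := sq_intM mOmega sh sphi.
under eq_integral do rewrite mulrBl EFinB.
rewrite (integralB mOmega i1 i2) gh// subee//.
exact: (integrable_fin_num mOmega i2).
Qed.

(** [xget] returns some derivative without saying which; uniqueness up to null sets identifies it
    with any derivative known by other means. *)
Lemma weak_hgrad_ae k u g : sqO g -> is_weak_hgrad Omega k u g ->
  [/\ sqO (weak_hgrad Omega k u), is_weak_hgrad Omega k u (weak_hgrad Omega k u) &
    ae_in Omega (fun x => weak_hgrad Omega k u x = g x)].
Proof.
move=> sg wg.
have [] : [set g | space_L Omega 2%:E g /\ is_weak_hgrad Omega k u g] (weak_hgrad Omega k u).
  by apply: (@xgetPex _ (fun=> 0)); exists g; split => //; exact/space_L2P.
move=> /space_L2P s1 w1; split => //.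
apply: ae_eq_weak => // phi cphi; apply: oppe_inj.
by rewrite -(w1 _ cphi) (wg _ cphi).
Qed.

Lemma weak_sublap_ae u w : sqO w -> is_weak_sublap Omega u w ->
  [/\ sqO (weak_sublap Omega u), is_weak_sublap Omega u (weak_sublap Omega u) &
    ae_in Omega (fun x => weak_sublap Omega u x = w x)].
Proof.
move=> sg wg.
have [] : [set g | space_L Omega 2%:E g /\ is_weak_sublap Omega u g] (weak_sublap Omega u).
  by apply: (@xgetPex _ (fun=> 0)); exists w; split => //; exact/space_L2P.
move=> /space_L2P s1 w1; split => //.
by apply: ae_eq_weak => // phi cphi; rewrite -(w1 _ cphi) (wg _ cphi).
Qed.

Lemma ae_inS (P Q : H -> Prop) : (forall x, Omega x -> P x -> Q x) ->
  ae_in Omega P -> ae_in Omega Q.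
Proof.
move=> PQ hP; have hP' : {ae vol, forall x : HM, Omega x -> P x} := hP.
by apply: filterS hP' => x Px Ox; exact: PQ (Px Ox).
Qed.

Lemma ae_inI (P Q : H -> Prop) : ae_in Omega P -> ae_in Omega Q ->
  ae_in Omega (fun x => P x /\ Q x).
Proof.
move=> hP hQ; have hP' : {ae vol, forall x : HM, Omega x -> P x} := hP.
have hQ' : {ae vol, forall x : HM, Omega x -> Q x} := hQ.
by apply: filterS2 hP' hQ' => x Px Qx Ox; split; [exact: Px|exact: Qx].
Qed.

Lemma integral_Omega (F : H -> R) (K : set H) : K `<=` Omega -> off K F ->
  (\int[vol]_(x in (Omega : set HM)) (F x)%:E = \int[vol]_(x in [set: HM]) (F x)%:E)%E.
Proof.
move=> KO oF; rewrite integral_mkcond; apply: eq_integral => x _.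
rewrite patchE; case: ifPn => // nO; rewrite oF// => /KO Ox.
by rewrite mem_set in nO.
Qed.

Lemma Cinfc_weak_hgrad k phi : Cinfc Omega phi -> is_weak_hgrad Omega k phi (hgrad k phi).
Proof.
move=> [sphi [K [cK KO Kphi]]] psi [spsi _].
have clK := compact_closed_heisenberg cK.
rewrite !(integral_Omega KO); first exact: (integral_by_parts k cK (or_introl Kphi)).
- by move=> x Kx; rewrite (off_hgrad k clK Kphi)// mul0r.
- by move=> x Kx; rewrite Kphi// mul0r.
Qed.

Lemma Cinfc_weak_sublap phi : Cinfc Omega phi -> is_weak_sublap Omega phi (sublap phi).
Proof.
move=> [sphi [K [cK KO Kphi]]] psi [spsi _].
have clK := compact_closed_heisenberg cK.
rewrite !(integral_Omega KO); first exact: (integral_sublap_sym cK (or_introl Kphi)).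
- by move=> x Kx; rewrite (off_sublap clK Kphi)// mul0r.
- by move=> x Kx; rewrite Kphi// mul0r.
Qed.

(** Entry into D for functions built as limits: [G] is a gradient known explicitly, in place of the
    chosen [weak_hgrad], and one rate [delta] serves [u] and every component. *)
Lemma space_D_intro u w (G : 'I_n + 'I_n -> H -> R) (phi : nat -> H -> R) (delta : nat -> R) :
  sqO u -> sqO w -> is_weak_sublap Omega u w ->
  (forall k, sqO (G k)) -> (forall k, is_weak_hgrad Omega k u (G k)) ->
  (forall m, Cinfc Omega (phi m)) -> delta @ \oo --> 0 ->
  (forall m, (\int[vol]_(x in (Omega : set HM)) ((phi m x - u x) ^+ 2)%:E <= (delta m)%:E)%E) ->
  (forall m k, (\int[vol]_(x in (Omega : set HM)) ((hgrad k (phi m) x - G k x) ^+ 2)%:E <= (delta m)%:E)%E) ->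
  space_D Omega u.
Proof.
move=> su sw wu sG wG cphi d0 phiu phiG.
have hwu : has_weak_hgrad Omega u.
  by move=> k; exists (G k); split => //; exact/space_L2P.
have lu : space_L Omega 2%:E u by exact/space_L2P.
split; first by split => //; exists w; split => //; exact/space_L2P.
split => //; exists phi; split => //.
  apply/cvge0_leP => [m|e e0]; first exact: Lnorm_ge0.
  have /cvgrPdist_le/(_ (e ^+ 2)) := d0; rewrite exprn_gt0// => /(_ isT).
  apply: filterS => m hm; apply: norm_L2_le; first exact: ltW.
  apply: (le_trans (phiu m)); rewrite lee_fin (le_trans _ hm)//.
  by rewrite sub0r normrN ler_norm.
have E m k : (\int[vol]_(x in (Omega : set HM)) ((hgrad k (phi m) x - weak_hgrad Omega k u x) ^+ 2)%:E =
    \int[vol]_(x in (Omega : set HM)) ((hgrad k (phi m) x - G k x) ^+ 2)%:E)%E.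
  have [s1 _ ae1] := weak_hgrad_ae (sG k) (wG k).
  have [s2 _] := Cinfc_sq (Cinfc_hgrad k (cphi m)).
  apply: ae_eq_integral => //.
  - by apply/measurable_EFinP; apply: measurable_funX; apply: measurable_funB => //; exact: s1.1.
  - by apply/measurable_EFinP; apply: measurable_funX; apply: measurable_funB => //; exact: (sG k).1.
  - by apply: ae_inS ae1 => x Ox hx; rewrite hx.
apply/cvge0_leP => [m|e e0].
  by apply: integral_ge0 => x _; rewrite lee_fin sumr_ge0// => k _; rewrite sqr_ge0.
have e1 : 0 < e / (#|{: 'I_n + 'I_n}|%:R + 1) by rewrite divr_gt0// ltr_wpDl.
have /cvgrPdist_le/(_ _ e1) := d0; apply: filterS => m hm.
under eq_integral do rewrite -sumEFin.
rewrite ge0_integral_sum//; last 2 first.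
- move=> k; apply/measurable_EFinP; apply: measurable_funX; apply: measurable_funB.
    exact: (Cinfc_sq (Cinfc_hgrad k (cphi m))).1.
  by have [[]] := weak_hgrad_ae (sG k) (wG k).
- by move=> k x _; rewrite lee_fin sqr_ge0.
apply: (@le_trans _ _ (\sum_(k : 'I_n + 'I_n) (e / (#|{: 'I_n + 'I_n}|%:R + 1))%:E)%E).
  apply: lee_sum => k _; rewrite E; apply: (le_trans (phiG m k)).
  by rewrite lee_fin (le_trans _ hm)// sub0r normrN ler_norm.
rewrite sumEFin lee_fin sumr_const -(mulr_natr (e / _)) mulrAC ler_pdivrMr ?ltr_wpDl//.
by rewrite ler_pM2l// lerDl.
Qed.

Lemma Cinfc_space_D phi : Cinfc Omega phi -> space_D Omega phi.
Proof.
move=> cphi.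
have z (f : H -> R) : (\int[vol]_(x in (Omega : set HM)) ((f x - f x) ^+ 2)%:E <= 0%:E)%E.
  by rewrite integral0_eq// => x _; rewrite subrr expr0n.
apply: (@space_D_intro phi (sublap phi) (fun k => hgrad k phi) (fun=> phi) (fun=> 0)) => //.
- exact: Cinfc_sq.
- exact/Cinfc_sq/Cinfc_sublap.
- exact: Cinfc_weak_sublap.
- by move=> k; exact/Cinfc_sq/Cinfc_hgrad.
- by move=> k; exact: Cinfc_weak_hgrad.
- exact: cvg_cst.
Qed.

End weak_derivatives.

(** * The L^2 inner product *)

Section inner_product.
Context d {T : measurableType d} {R : realType} (mu : {measure set T -> \bar R}).
Variables (D : set T) (mD : measurable D).
Implicit Types (f g h : T -> R).

Definition ip f g : R := (\int[mu]_(x in D) (f x * g x))%R.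
Local Notation sq := (sq_int mu D).

Lemma ipC f g : ip f g = ip g f.
Proof. by apply: eq_Rintegral => x _; rewrite mulrC. Qed.

Lemma ip_lin (c : R) f g h : sq f -> sq g -> sq h ->
  ip (fun x => c * f x + g x) h = c * ip f h + ip g h.
Proof.
move=> sf sg sh; rewrite addrC -(Rintg_DZ mD c (sq_intM mD sg sh) (sq_intM mD sf sh)).
by apply: eq_Rintegral => x _; rewrite mulrDl addrC mulrA.
Qed.

Lemma ipZ (c : R) f g : sq f -> sq g -> ip (fun x => c * f x) g = c * ip f g.
Proof.
move=> sf sg; rewrite /ip -(RintegralZl _ mD (sq_intM mD sf sg)).
by apply: eq_Rintegral => x _; rewrite mulrA.
Qed.

Lemma ip_linr (c : R) f g h : sq f -> sq g -> sq h ->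
  ip h (fun x => c * f x + g x) = c * ip h f + ip h g.
Proof. by move=> sf sg sh; rewrite ipC ip_lin// !(ipC h). Qed.

Lemma ip_ge0 f : 0 <= ip f f.
Proof. by apply: Rintegral_ge0 => x _; rewrite -expr2 sqr_ge0. Qed.

Lemma ipE f g : sq f -> sq g -> (\int[mu]_(x in D) (f x * g x)%:E = (ip f g)%:E)%E.
Proof.
move=> sf sg; rewrite /ip /Rintegral fineK//.
exact: (integrable_fin_num mD (sq_intM mD sf sg)).
Qed.

Lemma ip_sq f : sq f -> (\int[mu]_(x in D) (f x ^+ 2)%:E = (ip f f)%:E)%E.
Proof. by move=> sf; rewrite -ipE//; apply: eq_integral => x _; rewrite expr2. Qed.

Lemma le_ip f g f' g' : sq f -> sq g -> sq f' -> sq g' ->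
  (forall x, D x -> f x * g x <= f' x * g' x) -> ip f g <= ip f' g'.
Proof.
move=> sf sg sf' sg' h; apply: le_Rintegral => //; exact: sq_intM.
Qed.

Lemma ip_quadratic (t : R) f g : sq f -> sq g ->
  ip (fun x => t * f x + g x) (fun x => t * f x + g x) =
  ip g g + 2 * t * ip g f + t ^+ 2 * ip f f.
Proof.
move=> sf sg; rewrite ip_lin//; last exact: sq_int_lin.
by rewrite !ip_linr// (ipC f g); ring.
Qed.

(** Integrate (f - e g)^2 >= 0 and divide by [e]. It serves in place of the Cauchy-Schwarz
    inequality. *)
Lemma ip_young (e : R) f g : 0 < e -> sq f -> sq g ->
  2 * ip f g <= e^-1 * ip f f + e * ip g g.
Proof.
move=> e0 sf sg; have := ip_ge0 (fun x => (- e) * g x + f x).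
rewrite ip_quadratic// => h.
have ie0 : 0 <= e^-1 by rewrite invr_ge0 ltW.
have := mulr_ge0 ie0 h.
have -> : e^-1 * (ip f f + 2 * - e * ip f g + (- e) ^+ 2 * ip g g) =
    e^-1 * ip f f - 2 * ip f g + e * ip g g by field; rewrite gt_eqF.
by lra.
Qed.

Lemma ip_cvg (F : nat -> T -> R) f g (delta : nat -> R) : (forall m, sq (F m)) ->
  sq f -> sq g ->
  (forall m, (\int[mu]_(x in D) ((F m x - f x) ^+ 2)%:E <= (delta m)%:E)%E) ->
  delta @ \oo --> 0 -> ip (F m) g @[m --> \oo] --> ip f g.
Proof.
move=> sF sf sg hF d0; apply/cvgrPdist_le => e e0.
(* Young's inequality with this parameter bounds twice the error by [e + e]: once the squared norm
   of [F m - f] is below [e] times the parameter, each of the two terms is at most [e]. The added 1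
   covers the case [ip g g = 0]. *)
have a0 : 0 < e / (ip g g + 1) by rewrite divr_gt0// ltr_wpDl// ip_ge0.
have b0 : 0 < e * (e / (ip g g + 1)) by exact: mulr_gt0.
have /cvgrPdist_le/(_ _ b0) := d0; apply: filterS => m hm.
have sd := sq_intB mD (sF m) sf.
have hd : ip (fun x => F m x - f x) (fun x => F m x - f x) <= e * (e / (ip g g + 1)).
  rewrite -lee_fin -ip_sq//; apply: (le_trans (hF m)); rewrite lee_fin (le_trans _ hm)//.
  by rewrite sub0r normrN ler_norm.
have E : ip (F m) g - ip f g = ip (fun x => F m x - f x) g.
  rewrite (_ : (fun x => F m x - f x) = (fun x => (-1) * f x + F m x)).
    by rewrite ip_lin// mulN1r addrC.
  by apply/funext => x; rewrite mulN1r addrC.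
have y1 := ip_young a0 sd sg.
have sdN : sq (fun x => f x - F m x) by exact: sq_intB.
have y2 := ip_young a0 sdN sg.
have E' : ip f g - ip (F m) g = ip (fun x => f x - F m x) g.
  rewrite (_ : (fun x => f x - F m x) = (fun x => (-1) * F m x + f x)).
    by rewrite ip_lin// mulN1r addrC.
  by apply/funext => x; rewrite mulN1r addrC.
have dd : ip (fun x => f x - F m x) (fun x => f x - F m x) =
          ip (fun x => F m x - f x) (fun x => F m x - f x).
  by apply: eq_Rintegral => x _; ring.
have c1 : (e / (ip g g + 1))^-1 * ip (fun x => F m x - f x) (fun x => F m x - f x) <= e.
  by rewrite mulrC ler_pdivrMr.
have c2 : e / (ip g g + 1) * ip g g <= e.
  rewrite mulrAC ler_pdivrMr ?ltr_wpDl ?ip_ge0//.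
  by rewrite ler_pM2l// lerDl.
rewrite ler_norml lerNl opprB; apply/andP; split; first by rewrite E; lra.
by rewrite E'; rewrite dd in y2; lra.
Qed.

End inner_product.

(** * The Dirichlet problem by minimisation over test functions *)

Section dirichlet_problem.
Context {R : realType} {n : nat}.
Local Notation H := (heisenberg R n).
Local Notation HM := ('rV[R]_n * 'rV[R]_n * measurableTypeR R)%type.
Implicit Types (x y z : H) (u v w f g phi psi : H -> R) (k : 'I_n + 'I_n).
Variables (Omega : set H) (oOmega : open Omega) (M : R) (M0 : 0 < M).
Hypothesis OmegaM : Omega `<=` cbox M.
Variable i0 : 'I_n.

Let mOmega : measurable (Omega : set HM) := open_measurable_heisenberg oOmega.
Let vOmega : (vol (Omega : set HM) < +oo)%E := vol_bounded oOmega OmegaM.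
Local Notation sqO g := (sq_int vol (Omega : set HM) g).
Local Notation ipO := (ip vol (Omega : set HM)).
Local Notation test := (Cinfc Omega).

Let sqt phi : test phi -> sqO phi := Cinfc_sq oOmega OmegaM (phi := phi).
Let sqh k phi (c : test phi) : sqO (hgrad k phi) := sqt (Cinfc_hgrad k c).

Lemma Cinfc_lin (c : R) phi psi : test phi -> test psi -> test (fun x => c * phi x + psi x).
Proof.
move=> [s1 [K1 [cK1 KO1 h1]]] [s2 [K2 [cK2 KO2 h2]]]; split.
  by move=> k; apply: CkD => //; exact: CkZ.
exists (K1 `|` K2); split; first exact: compactU.
  by move=> x [/KO1|/KO2].
by move=> x /not_orP[n1 n2]; rewrite h1// h2// mulr0 addr0.
Qed.

Lemma hgrad_lin k (c : R) phi psi : test phi -> test psi ->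
  hgrad k (fun x => c * phi x + psi x) = (fun x => c * hgrad k phi x + hgrad k psi x).
Proof.
move=> [s1 _] [s2 _]; apply/funext => x; rewrite hgradD//; last exact: CkZ.
by rewrite hgradZ.
Qed.

Lemma ip_hgrad k phi psi : test phi -> test psi ->
  ipO phi (hgrad k psi) = - ipO (hgrad k phi) psi.
Proof.
move=> tphi tpsi; apply: EFin_inj; rewrite EFinN -!ipE//; last 4 first.
- exact: sqh.
- exact: sqt.
- exact: sqt.
- exact: sqh.
exact: (Cinfc_weak_hgrad k tphi tpsi).
Qed.

Lemma Cinfc_coordM phi : test phi -> test (fun x => coord (Some (inl i0)) x * phi x).
Proof.
move=> [s1 [K1 [cK1 KO1 h1]]]; split; first by move=> k; apply: CkM => //; exact: Ck_coord.
by exists K1; split => // x nK; rewrite h1// mulr0.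
Qed.

(* Integrate [phi^2 = phi^2 X_1(x_1)] by parts. *)
Lemma poincare phi : test phi ->
  ipO phi phi <= 4 * M ^+ 2 * ipO (hgrad (inl i0) phi) (hgrad (inl i0) phi).
Proof.
move=> tphi; have tx := Cinfc_coordM tphi; have [s1 _] := tphi.
pose c := coord (Some (inl i0)) : H -> R.
have hc x : hgrad (inl i0) c x = 1.
  rewrite (hgrad_val (Ck_coord _ _) (is_derive_coord (Some (inl i0)) x _)).
  by rewrite /coord /= mxE !eqxx.
have hx x : hgrad (inl i0) (fun x => c x * phi x) x = phi x + c x * hgrad (inl i0) phi x.
  by rewrite hgradM ?hc ?mul1r//; exact: Ck_coord.
have e1 := ip_hgrad (inl i0) tx tphi.
have e2 : ipO (hgrad (inl i0) (fun x => c x * phi x)) phi =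
    ipO phi phi + ipO (fun x => c x * hgrad (inl i0) phi x) phi.
  rewrite (_ : hgrad _ _ = (fun x => 1 * phi x + c x * hgrad (inl i0) phi x)); last first.
    by apply/funext => x; rewrite hx mul1r.
  rewrite ip_lin ?mul1r//; try exact: sqt.
  exact: (sqt (Cinfc_coordM (Cinfc_hgrad _ tphi))).
have e3 : ipO (fun x => c x * phi x) (hgrad (inl i0) phi) =
    ipO (fun x => c x * hgrad (inl i0) phi x) phi.
  by apply: eq_Rintegral => x _; ring.
have sx := sqt (Cinfc_coordM (Cinfc_hgrad (inl i0) tphi)).
(* By [e1], [e2] and [e3] the product of x_1 X_1(phi) with phi integrates to minus half the integral
   of phi^2. The weight 1/2 is then the best choice in this square, and it produces the constant
   4. *)
have := ip_ge0 vol (Omega : set HM) (fun x => 2^-1 * phi x + c x * hgrad (inl i0) phi x).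
rewrite ip_quadratic//; last exact: sqt.
have le : ipO (fun x => c x * hgrad (inl i0) phi x) (fun x => c x * hgrad (inl i0) phi x) <=
    M ^+ 2 * ipO (hgrad (inl i0) phi) (hgrad (inl i0) phi).
  have s2 := sqh (inl i0) tphi.
  rewrite -ipZ//; apply: (le_ip mOmega) => //.
    by have := sq_int_lin mOmega (M ^+ 2 - 1) s2 s2; congr sq_int; apply/funext => x; ring.
  move=> x Ox; rewrite mulrACA -[leRHS]mulrA -!expr2; apply: ler_wpM2r; rewrite ?sqr_ge0//.
  rewrite -[leLHS]real_normK ?num_real// ler_sqr ?nnegrE ?(ltW M0)//.
  exact: OmegaM.
by rewrite -mulrA; lra.
Qed.

Definition energy phi : R := \sum_(k : 'I_n + 'I_n) ipO (hgrad k phi) (hgrad k phi).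

Lemma hgrad_le_energy k phi : ipO (hgrad k phi) (hgrad k phi) <= energy phi.
Proof. by rewrite /energy (bigD1 k)//= lerDl sumr_ge0// => i _; exact: ip_ge0. Qed.

Lemma ip_le_energy phi : test phi -> ipO phi phi <= 4 * M ^+ 2 * energy phi.
Proof.
move=> tphi; apply: (le_trans (poincare tphi)); rewrite ler_wpM2l ?hgrad_le_energy//.
by rewrite mulr_ge0// sqr_ge0.
Qed.

Section dirichlet_functional.
Variables (h : H -> R) (sh : sqO h) (h0 : forall x, Omega x -> 0 <= h x).

Definition dirichlet phi : R := energy phi - 2 * ipO h phi.

(** The coefficient of t is, up to the factor -2, the weak residual of - Delta phi = h tested with
    [psi]. Both derivatives sit on [psi] so that the residual passes to L^2 limits in [phi]. *)
Lemma dirichlet_quadratic (t : R) phi psi : test phi -> test psi ->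
  dirichlet (fun x => t * psi x + phi x) = dirichlet phi -
    2 * t * (ipO phi (sublap psi) + ipO h psi) + t ^+ 2 * energy psi.
Proof.
move=> tphi tpsi; have sphi := sqt tphi; have spsi := sqt tpsi.
have -> : ipO phi (sublap psi) = - \sum_(k : 'I_n + 'I_n) ipO (hgrad k phi) (hgrad k psi).
  have -> : ipO phi (sublap psi) =
      \sum_(k : 'I_n + 'I_n) ipO phi (hgrad k (hgrad k psi)).
    rewrite /ip -(Rintg_sum mOmega); last first.
      by move=> k; apply: (sq_intM mOmega sphi); exact/sqh/Cinfc_hgrad.
    by apply: eq_Rintegral => x _; rewrite sublapE mulr_sumr.
  rewrite -sumrN; apply: eq_bigr => k _; rewrite ip_hgrad//; exact: Cinfc_hgrad.
rewrite /dirichlet ip_linr//.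
have -> : energy (fun x => t * psi x + phi x) = energy phi +
   2 * t * \sum_(k : 'I_n + 'I_n) ipO (hgrad k phi) (hgrad k psi) + t ^+ 2 * energy psi.
  rewrite /energy !mulr_sumr -!big_split /=; apply: eq_bigr => k _.
  by rewrite hgrad_lin// ip_quadratic//; exact: sqh.
move: (energy _) (energy _) (ipO h phi) (ipO h psi) (\sum_k _) => a b c d e.
by ring.
Qed.

(** The Young parameter is the inverse of the constant in [ip_le_energy], so that the energy absorbs
    the term in phi^2 exactly. *)
Lemma dirichlet_ge phi : test phi -> - (4 * M ^+ 2 * ipO h h) <= dirichlet phi.
Proof.
move=> tphi; have M2 : 0 < 4 * M ^+ 2 by rewrite mulr_gt0// exprn_gt0.
have M2' : 0 < (4 * M ^+ 2)^-1 by rewrite invr_gt0.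
have := ip_young mOmega M2' sh (sqt tphi); rewrite invrK => y.
have := ip_le_energy tphi; rewrite -ler_pdivrMl// => e.
by rewrite /dirichlet; lra.
Qed.

Let J : set R := [set dirichlet phi | phi in test].

Lemma has_inf_dirichlet : has_inf J.
Proof.
split; last by exists (- (4 * M ^+ 2 * ipO h h)) => _ [phi tphi <-]; exact: dirichlet_ge.
exists (dirichlet (fun=> 0)), (fun=> 0) => //; split; first by move=> k; exact: Ck_cst.
by exists set0; split => //; exact: compact0.
Qed.

Lemma inf_dirichlet_le phi : test phi -> inf J <= dirichlet phi.
Proof. by move=> tphi; apply: (ge_inf has_inf_dirichlet.2); exists phi. Qed.

(* Parallelogram identity, the midpoint being a competitor. *)
Lemma energyB_le phi psi : test phi -> test psi ->
  energy (fun x => phi x - psi x) <=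
  2 * (dirichlet phi - inf J) + 2 * (dirichlet psi - inf J).
Proof.
move=> tphi tpsi.
have E : (fun x => phi x - psi x) = (fun x => (-1) * psi x + phi x).
  by apply/funext => x; ring.
have td : test (fun x => phi x - psi x) by rewrite E; exact: Cinfc_lin.
have h1 := dirichlet_quadratic 1 tpsi td.
have h2 := dirichlet_quadratic 2^-1 tpsi td.
have := inf_dirichlet_le (Cinfc_lin 2^-1 td tpsi).
rewrite h2; move: h1.
rewrite (_ : (fun x => 1 * (phi x - psi x) + psi x) = phi); last by apply/funext => x; ring.
by move=> ->; lra.
Qed.

(* [sqrt (phi^2 + d^2) - d] is nonnegative, has at most the energy of [phi], and
   exceeds [phi - d]. *)
Lemma dirichlet_ge0_competitor phi (e : R) : test phi -> 0 < e ->
  exists psi, [/\ test psi, forall x, 0 <= psi x & dirichlet psi <= dirichlet phi + e].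
Proof.
move=> tphi e0; have [s1 [K [cK KO hK]]] := tphi.
have s11 : sqO (fun=> 1).
  by apply: (sq_int_bounded mOmega (B := 1)) => // x _; rewrite normr1.
pose A := ipO h (fun=> 1).
have A0 : 0 <= A by apply: Rintegral_ge0 => x Ox; rewrite mulr1 h0.
(* Passing from [phi] to [psi] lowers the integral against [h] by at most d A, so the functional
   grows by at most 2 d A <= e. *)
pose d := e / (2 * A + 1).
have d0 : 0 < d by rewrite divr_gt0// ltr_wpDl// mulr_ge0.
pose q x := phi x ^+ 2 + d ^+ 2.
have q0 x : 0 < q x by rewrite ltr_wpDl ?sqr_ge0// exprn_gt0.
have Cq (m : nat) : Ck setT m q by apply: CkD; [exact: CkX|exact: Ck_cst].
have Csq (m : nat) : Ck setT m (fun x => Num.sqrt (q x)) by exact: Ck_sqrt.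
pose psi x := Num.sqrt (q x) - d.
have tpsi : test psi.
  split; first by move=> k; apply: CkB; [exact: Csq|exact: Ck_cst].
  exists K; split => // x nK; rewrite /psi /q hK// expr0n add0r sqrtr_sqr.
  by rewrite gtr0_norm// subrr.
have psi_ge x : phi x - d <= psi x.
  rewrite lerD2r (le_trans (ler_norm _))// -sqrtr_sqr ler_wsqrtr// lerDl sqr_ge0 //.
have psi_ge0 x : 0 <= psi x.
  rewrite subr_ge0 -[leLHS]gtr0_norm// -sqrtr_sqr ler_wsqrtr// lerDr sqr_ge0 //.
exists psi; split => //.
have grad k x : hgrad k psi x = phi x / Num.sqrt (q x) * hgrad k phi x.
  have s0 : 0 < Num.sqrt (q x) by rewrite sqrtr_gt0.
  (* The gradient of the root is read off from the product rule for its square. *)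
  have : hgrad k (fun y => Num.sqrt (q y) * Num.sqrt (q y)) x =
         hgrad k (fun y => phi y * phi y + d ^+ 2) x.
    by congr hgrad; apply/funext => y; rewrite -expr2 sqr_sqrtr ?(ltW (q0 y))// expr2.
  have C1 := Ck_cst 1 d; have C2 := Ck_cst 1 (d ^+ 2).
  rewrite hgradM// hgradD//; last exact: CkM.
  rewrite hgradM// !hgrad_cst hgradB// hgrad_cst subr0 => eq2.
  rewrite mulrAC; apply: (canRL (mulfK (lt0r_neq0 s0))).
  by lra.
have e_le : energy psi <= energy phi.
  apply: ler_sum => k _; apply: (le_ip mOmega); try exact: sqh.
  move=> x Ox; rewrite !grad -expr2 exprMn -[leRHS]expr2 ler_piMl ?sqr_ge0//.
  rewrite expr_div_n sqr_sqrtr ?(ltW (q0 x))// ler_pdivrMr// mul1r.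
  by rewrite /q lerDl sqr_ge0.
have ip_ge : ipO h phi - d * A <= ipO h psi.
  rewrite -[X in X - _]mul1r (_ : _ - _ = (- d) * A + ipO h phi); last by ring.
  rewrite -ip_linr//; last exact: sqt.
  apply: (le_ip mOmega); [exact: sh| | exact: sh|exact: sqt|].
    by apply: sq_int_lin => //; exact: sqt.
  move=> x Ox; rewrite ler_wpM2l ?h0// mulr1 addrC; exact: psi_ge.
have dA : 2 * (d * A) <= e.
  have A1 : 0 < 2 * A + 1 by rewrite ltr_wpDl// mulr_ge0.
  rewrite /d (_ : 2 * _ = e * (2 * A / (2 * A + 1))); last by ring.
  by rewrite ler_piMr ?(ltW e0)// ler_pdivrMr// mul1r lerDl.
rewrite -/A in ip_ge; rewrite /dirichlet.
move: e_le ip_ge dA; move: (energy _) (energy _) (ipO h phi) (ipO h psi) (d * A) => *; lra.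
Qed.

(** A minimising sequence of nonnegative test functions is Cauchy in L^2 together with all its
    horizontal derivatives, so the limit is strong and no weak compactness enters. *)
Lemma dirichlet_solution : exists phi, [/\ sqO phi, space_D Omega phi,
  forall x, Omega x -> 0 <= phi x & is_weak_sublap Omega phi (fun x => - h x)].
Proof.
(* One [eps_ m] for approaching the infimum, one for making the function nonnegative. *)
pose eta_ m : R := 2 * eps_ m.
have hphi m : exists phi, [/\ test phi, forall x, 0 <= phi x &
    dirichlet phi - inf J <= eta_ m].
  have [_ [phi1 t1 <-] h1] := inf_adherent (eps_gt0 m) has_inf_dirichlet.
  have [phi [t2 p2 h2]] := dirichlet_ge0_competitor t1 (eps_gt0 m).
  by exists phi; split => //; rewrite /eta_; lra.
have [phi {}hphi] := choice hphi.
have tphi m : test (phi m) by have [] := hphi m.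
(* Energies of differences are at most [2 * eta_ i + 2 * eta_ j], and squared L^2 norms 4 M^2 times
   that; one rate covers both. *)
pose delta m : R := 2 * (1 + 4 * M ^+ 2) * eta_ m.
have M2 : 0 <= 4 * M ^+ 2 by rewrite mulr_ge0// sqr_ge0.
have eta0 m : 0 <= eta_ m by rewrite mulr_ge0// ltW// eps_gt0.
have delta0 : delta @ \oo --> 0.
  rewrite [X in _ --> X](_ : 0 = 2 * (1 + 4 * M ^+ 2) * (2 * 0)); last by rewrite !mulr0.
  by apply: cvgMr; apply: cvgMr; exact: cvg_eps.
have E i j : energy (fun x => phi i x - phi j x) <= 2 * eta_ i + 2 * eta_ j.
  have [_ _ hi] := hphi i; have [_ _ hj] := hphi j.
  by have := energyB_le (tphi i) (tphi j); lra.
have tB i j : test (fun x => phi i x - phi j x).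
  rewrite (_ : (fun x => _) = (fun x => (-1) * phi j x + phi i x)); first exact: Cinfc_lin.
  by apply/funext => x; ring.
have B0 i j : (\int[vol]_(x in (Omega : set HM)) ((phi i x - phi j x) ^+ 2)%:E <=
    (delta i + delta j)%:E)%E.
  rewrite (ip_sq mOmega (f := fun x => phi i x - phi j x)); last exact: sqt.
  rewrite lee_fin (le_trans (ip_le_energy (tB i j)))//.
  have := ler_wpM2l M2 (E i j); have := eta0 i; have := eta0 j; rewrite /delta.
  by move: (energy _) (eta_ i) (eta_ j) (4 * M ^+ 2) => *; lra.
have B1 k i j : (\int[vol]_(x in (Omega : set HM)) ((hgrad k (phi i) x - hgrad k (phi j) x) ^+ 2)%:E <=
    (delta i + delta j)%:E)%E.
  have -> : (fun x : HM => ((hgrad k (phi i) x - hgrad k (phi j) x) ^+ 2)%:E) =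
            (fun x => (hgrad k (fun y => phi i y - phi j y) x ^+ 2)%:E).
    by apply/funext => x; rewrite hgradB//; [exact: (tphi i).1|exact: (tphi j).1].
  rewrite (ip_sq mOmega (sqh k (tB i j))) lee_fin (le_trans (hgrad_le_energy k _))//.
  have := mulr_ge0 M2 (eta0 i); have := mulr_ge0 M2 (eta0 j).
  have := E i j; have := eta0 i; have := eta0 j; rewrite /delta.
  by move: (energy _) (eta_ i) (eta_ j) (4 * M ^+ 2) => *; lra.
have [U [mU Ud U0]] := L2_complete mOmega (fun m => (sqt (tphi m)).1) B0 delta0.
have hG k := L2_complete mOmega (fun m => (sqh k (tphi m)).1) (B1 k) delta0.
have [G {}hG] := choice hG.
have sqlim f g' (c : R) : sqO g' -> measurable_fun (Omega : set HM) (f : HM -> R) ->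
    (\int[vol]_(x in (Omega : set HM)) ((g' x - f x) ^+ 2)%:E <= c%:E)%E -> sqO f.
  move=> sg mf hf.
  have sd : sqO (fun x => g' x - f x).
    split; first by apply: measurable_funB => //; exact: sg.1.
    apply/integrableP; split.
      apply/measurable_EFinP; apply: measurable_funX; apply: measurable_funB => //; exact: sg.1.
    under eq_integral do rewrite /= ger0_norm ?sqr_ge0//.
    exact: le_lt_trans hf (ltry _).
  have := sq_intB mOmega sg sd; congr sq_int; apply/funext => x; ring.
have sU : sqO U := sqlim _ _ _ (sqt (tphi 0%N)) mU (Ud 0%N).
have sG k : sqO (G k).
  by have [mG Gd _] := hG k; exact: sqlim (sqh k (tphi 0%N)) mG (Gd 0%N).
have EN : (fun x => - h x) = (fun x => (-1) * h x) by apply/funext => x; rewrite mulN1r.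
have sNh : sqO (fun x => - h x).
  have := sq_int_lin mOmega (-2) sh sh; congr sq_int; apply/funext => x; ring.
have wU : is_weak_sublap Omega U (fun x => - h x).
  move=> psi tpsi; have sD := sqt (Cinfc_sublap tpsi); have sp := sqt tpsi.
  rewrite (ipE mOmega sU sD) (ipE mOmega sNh sp) EN ipZ// mulN1r; congr EFin.
  apply/eqP; rewrite -addr_eq0; apply/eqP.
  (* [b] is the weak residual. Near-minimality gives [2 * t * b <= t ^+ 2 * e] for every t in the
     limit, and t = b / (e + 1) forces b = 0. *)
  set b := _ + _; set e := energy psi.
  have e0 : 0 <= e by apply: sumr_ge0 => k _; exact: ip_ge0.
  have hb t : 2 * t * b <= t ^+ 2 * e.
    have c1 : (2 * t * ipO (phi m) (sublap psi)) @[m --> \oo] --> 2 * t * ipO U (sublap psi).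
      by apply: cvgMr; exact: (ip_cvg mOmega (fun m => sqt (tphi m)) sU sD Ud delta0).
    have c2 : (2 * eps_ m + (t ^+ 2 * e - 2 * t * ipO h psi)) @[m --> \oo] -->
        2 * 0 + (t ^+ 2 * e - 2 * t * ipO h psi).
      by apply: cvgD; [apply: cvgMr; exact: cvg_eps|exact: cvg_cst].
    have : 2 * t * ipO U (sublap psi) <= 2 * 0 + (t ^+ 2 * e - 2 * t * ipO h psi).
      apply: (ler_cvg_to c1 c2); apply: nearW => m.
      have [_ _] := hphi m; have := inf_dirichlet_le (Cinfc_lin t tpsi (tphi m)).
      rewrite dirichlet_quadratic// /eta_ -/e.
      move: (dirichlet _) (inf J) (ipO (phi m) _) (ipO h psi) (eps_ m) => *; lra.
    by rewrite /b; move: (ipO U _) (ipO h psi) => *; lra.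
  have e1 : 0 < e + 1 by rewrite ltr_wpDl.
  have := hb (b / (e + 1)).
  have -> : 2 * (b / (e + 1)) * b = 2 * b ^+ 2 * (e + 1) / (e + 1) ^+ 2 by field; rewrite gt_eqF.
  have -> : (b / (e + 1)) ^+ 2 * e = b ^+ 2 * e / (e + 1) ^+ 2 by field; rewrite gt_eqF.
  rewrite ler_pM2r ?invr_gt0 ?exprn_gt0// => hh.
  have b2 := sqr_ge0 b; have be := mulr_ge0 b2 e0.
  by apply/eqP; rewrite -sqrf_eq0 eq_le b2 andbT; move: hh be; lra.
exists U; split => //; last by apply: U0 => m x _; have [] := hphi m.
apply: (@space_D_intro _ _ _ oOmega _ M0 OmegaM U (fun x => - h x) G phi delta) => //.
- move=> k psi tpsi; have sX := sqh k tpsi; have sp := sqt tpsi; have [_ Gd _] := hG k.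
  rewrite (ipE mOmega sU sX) (ipE mOmega (sG k) sp) -EFinN; congr EFin.
  have c1 := ip_cvg mOmega (fun m => sqt (tphi m)) sU sX Ud delta0.
  have c2 : - ipO (hgrad k (phi m)) psi @[m --> \oo] --> - ipO (G k) psi.
    by apply: cvgN; exact: (ip_cvg mOmega (fun m => sqh k (tphi m)) (sG k) sp Gd delta0).
  have EE : (fun m => ipO (phi m) (hgrad k psi)) = (fun m => - ipO (hgrad k (phi m)) psi).
    by apply/funext => m; rewrite ip_hgrad.
  by rewrite EE in c1; exact: (cvg_unique _ c1 c2).
- by move=> m k; have [_ + _] := hG k; exact.
Qed.

End dirichlet_functional.

End dirichlet_problem.

(** * Measurability of nonlinear superpositions *)

Section substitution.
Context d {T : measurableType d} {R : realType}.
Variables (D : set T) (mD : measurable D).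

(** The values of [w_ m] are multiples of [(N m)^-1], countably many, so [f x (w_ m x)] is
    measurable piece by piece; continuity in the second variable gives the limit. *)
Lemma measurable_substitution (f : T -> R -> R) (w : T -> R) :
  measurable_fun D w -> (forall s, measurable_fun D (fun x => f x s)) ->
  (forall x, D x -> continuous (f x)) -> measurable_fun D (fun x => f x (w x)).
Proof.
move=> mw mf cf.
pose N (m : nat) : R := m.+1%:R; have N0 m : 0 < N m by rewrite ltr0n.
pose w_ m x : R := (Num.floor (N m * w x))%:~R / N m.
apply: (@measurable_fun_cvg _ _ _ _ (fun m x => f x (w_ m x))) => [m|x Dx].
  move=> _ B mB.
  pose E (z : int) : set T := (D `&` w @^-1` `[z%:~R / N m, (z + 1)%:~R / N m[) `&`
    (D `&` (fun x => f x (z%:~R / N m)) @^-1` B).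
  have -> : D `&` (fun x => f x (w_ m x)) @^-1` B = \bigcup_z E z.
    apply/seteqP; split=> [x [Dx Bx]|x [z _ [[Dx] /=]]].
      exists (Num.floor (N m * w x)) => //; split; split => //=.
      have /andP[h1 h2] := floor_itv (N m * w x).
      by rewrite in_itv/= ler_pdivrMr// ltr_pdivlMr// (mulrC (w x)) h1 h2.
    rewrite in_itv/= ler_pdivrMr// ltr_pdivlMr// (mulrC (w x)) => /floor_def zE [_ Bx].
    by split => //=; rewrite /w_ zE.
  apply: countable_bigcupT_measurable; first exact: countableP.
  move=> z.
  by apply: measurableI; [exact: mw|exact: mf].
suff hw : w_ m x @[m --> \oo] --> w x.
  exact: (cvg_comp (fun m => w_ m x) (f x) hw (cf x Dx (w x))).
apply/cvgrPdist_le => e e0.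
have /cvgrPdist_le/(_ _ e0) := @cvg_harmonic R; apply: filterS => m.
rewrite sub0r normrN ger0_norm ?harmonic_ge0// => he; apply: (le_trans _ he); change (harmonic m) with (N m)^-1.
have /andP[h1 h2] := floor_itv (N m * w x).
rewrite ger0_norm; last by rewrite subr_ge0 ler_pdivrMr// (mulrC (w x)).
rewrite /w_ -(ler_pM2l (N0 m)) mulfV ?lt0r_neq0//.
rewrite mulrBr (mulrCA (N m)) mulfV ?lt0r_neq0// mulr1.
by rewrite lerBlDl -[X in _ + X]/(1%:~R) -intrD ltW.
Qed.

End substitution.

(** * Essential bounds and almost everywhere signs *)

Section almost_everywhere_bounds.
Context {R : realType} {n : nat}.
Local Notation H := (heisenberg R n).
Local Notation HM := ('rV[R]_n * 'rV[R]_n * measurableTypeR R)%type.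
Implicit Types (x y z : H) (u v w f g phi psi : H -> R) (k : 'I_n + 'I_n).
Variables (Omega : set H) (oOmega : open Omega) (M : R) (M0 : 0 < M).
Hypothesis OmegaM : Omega `<=` cbox M.

Let mOmega : measurable (Omega : set HM) := open_measurable_heisenberg oOmega.
Let vOmega : (vol (Omega : set HM) < +oo)%E := vol_bounded oOmega OmegaM.
Local Notation sqO g := (sq_int vol (Omega : set HM) g).
Local Notation ipO := (ip vol (Omega : set HM)).

Lemma space_Loo_bounded g : space_L Omega +oo g -> exists2 B : R, 0 <= B &
  ae_in Omega (fun x => `|g x| <= B).
Proof.
move=> [mg]; rewrite /norm_L Lnorm.unlock.
(* The norm at infinity is by definition the essential supremum only when the whole space has
   positive measure. *)
have v0 : (0 < vol [set: HM])%E.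
  have /andP[c0 _] := @vol_cube R n 0 1 ltr01.
  apply: (lt_le_trans c0); apply: le_measure => //; rewrite inE//.
  exact: measurable_cube.
rewrite v0; set S := ess_sup_inf.ess_sup _ _ => Soo.
have [B B0 SB] : exists2 B : R, 0 <= B & (S <= B%:E)%E.
  case: S Soo => [r _| |_] //; first by exists `|r| => //; rewrite lee_fin ler_norm.
  by exists 0; rewrite ?leNye.
exists B => //; have := ess_sup_inf.ess_sup_ge vol (abse \o (EFin \o g) \_ (Omega : set HM)).
move=> h; suff h' : {ae vol, forall x : HM, Omega x -> `|g x| <= B} by [].
apply: filterS h => x gx Ox; rewrite -lee_fin; apply: le_trans SB.
by apply: le_trans gx; rewrite /= patchE mem_set.
Qed.

Lemma sq_int_ae_bounded g (B : R) : measurable_fun (Omega : set HM) (g : HM -> R) ->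
  ae_in Omega (fun x => `|g x| <= B) -> sqO g.
Proof.
move=> mg gB; split => //; apply/integrableP.
have mg2 : measurable_fun (Omega : set HM) (EFin \o (fun x : HM => g x ^+ 2)).
  by apply/measurable_EFinP; exact: measurable_funX.
split => //; under eq_integral do rewrite /= ger0_norm ?sqr_ge0//.
have B2 : (\int[vol]_(x in (Omega : set HM)) (B ^+ 2)%:E < +oo)%E.
  by rewrite integral_cst// lte_mul_pinfty// lee_fin sqr_ge0.
apply: le_lt_trans B2; apply: ae_ge0_le_integral => //.
- by move=> x _; rewrite lee_fin sqr_ge0.
- by move=> x _; rewrite lee_fin sqr_ge0.
- apply: ae_inS gB => x Ox gB; rewrite lee_fin -[leLHS]real_normK ?num_real//.
  by rewrite ler_sqr ?nnegrE// (le_trans _ gB).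
Qed.

Lemma sq_int_norm g : sqO g -> sqO (fun x => `|g x|).
Proof.
move=> [mg ig]; split; first exact: measurableT_comp.
by have -> : (fun x => `|g x| ^+ 2) = (fun x => g x ^+ 2);
  first by apply/funext => x; rewrite real_normK ?num_real.
Qed.

Lemma ip_ae g f phi : sqO g -> sqO f -> sqO phi -> ae_in Omega (fun x => g x = f x) ->
  ipO g phi = ipO f phi.
Proof.
move=> sg sf sp gf; rewrite /ip /Rintegral; congr fine; apply: ae_eq_integral => //.
- by have /integrableP[] := sq_intM mOmega sg sp.
- by have /integrableP[] := sq_intM mOmega sf sp.
- by apply: ae_inS gf => x Ox ->.
Qed.

Lemma ip_ae_norm g phi : sqO g -> sqO phi -> ae_in Omega (fun x => 0 <= g x) ->
  ipO g phi = ipO (fun x => `|g x|) phi.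
Proof.
move=> sg sp g0; apply: ip_ae => //; first exact: sq_int_norm.
by apply: ae_inS g0 => x _ ?; rewrite ger0_norm.
Qed.

Lemma ip_ae_ge0 g phi : sqO g -> sqO phi -> ae_in Omega (fun x => 0 <= g x) ->
  (forall x, Omega x -> 0 <= phi x) -> 0 <= ipO g phi.
Proof.
move=> sg sp g0 p0; rewrite ip_ae_norm//; apply: Rintegral_ge0 => x Ox.
by rewrite mulr_ge0// p0.
Qed.

(** With an essentially bounded [u] this bounds f(., u), and so puts a u - f(., u) in L^2. *)
Lemma continuous_nonlinearity_bounded (f : H -> R -> R) (B : R) :
  {within closure Omega `*` [set: R], continuous (fun p : H * R => f p.1 p.2)} ->
  exists C : R, forall x s, Omega x -> `|s| <= B -> `|f x s| <= C.
Proof.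
move=> fC.
have cO : compact (closure Omega).
  apply: (closed_bounded_compact (M := M)); first exact: closed_closure.
  rewrite [X in _ `<=` X](closure_id _).1; first exact: closureS.
  exact: compact_closed_heisenberg (@compact_cbox _ _ _).
have cA : compact (closure Omega `*` `[- B, B]%classic).
  by apply: compact_setX => //; exact: segment_compact.
have fA : {within closure Omega `*` `[- B, B]%classic,
    continuous (fun p : H * R => f p.1 p.2)}.
  by apply: continuous_subspaceW fC => p [].
have [C [_ hC]] := compact_bounded (continuous_compact fA cA).
exists (`|C| + 1) => x s Ox sB; apply: (hC (`|C| + 1)).
  by rewrite (le_lt_trans (ler_norm C))// ltrDl.
exists (x, s) => //; split => /=; first exact: subset_closure.
by rewrite in_itv/= -ler_norml.
Qed.

Lemma continuous_nonlinearity_measurable (f : H -> R -> R) s :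
  {within closure Omega `*` [set: R], continuous (fun p : H * R => f p.1 p.2)} ->
  measurable_fun (Omega : set HM) (fun x : HM => f x s).
Proof.
move=> fC; apply: (continuous_measurable_heisenberg oOmega) => x Ox.
pose A : set (H * R) := fst @^-1` Omega.
have oA : open A.
  by apply: open_comp oOmega => p _; exact: cvg_fst.
have : {within A, continuous (fun p : H * R => f p.1 p.2)}.
  by apply: continuous_subspaceW fC => p Op; split => //; exact: subset_closure.
rewrite continuous_open_subspace// => /(_ (x, s)).
rewrite inE => /(_ Ox) cf.
exact: (cvg_comp (fun y : H => (y, s)) (fun p : H * R => f p.1 p.2)
  (@continuous_pairl _ _ _ s x) cf).
Qed.

End almost_everywhere_bounds.

(** * Picone's inequality for the sublaplacian *)

Section picone.
Context {R : realType} {n : nat}.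
Local Notation H := (heisenberg R n).
Implicit Types (x : H) (v D : H -> R).

(** Differentiating p D = v^2, with p = v^2 / D, twice along a field X avoids the quotient rule.
    Multiplied by [D], the difference of the two sides is the sum over the fields of 2 (D X v - v X
    D)^2. *)
Lemma sublap_picone v D x : Ck setT 2 v -> Ck setT 2 D -> (forall y, 0 < D y) ->
  2 * v x * sublap v x * D x - v x ^+ 2 * sublap D x <=
  sublap (fun y => v y ^+ 2 / D y) x * D x ^+ 2.
Proof.
move=> Cv CD D0; pose p y := v y ^+ 2 / D y.
have Cp : Ck setT 2 p.
  apply: CkM; [exact: CkX|apply: CkV => //].
  by move=> y; rewrite gt_eqF.
have pD : (fun y => p y * D y) = (fun y => v y * v y).
  by apply/funext => y; rewrite /p mulfVK ?gt_eqF// expr2.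
have Cp1 := CkS Cp; have CD1 := CkS CD; have Cv1 := CkS Cv.
have C1 k := Ck_hgrad k Cp; have C2 k := Ck_hgrad k CD; have C3 k := Ck_hgrad k Cv.
have e1 k y : hgrad k p y * D y + p y * hgrad k D y = hgrad k v y * v y + v y * hgrad k v y.
  by rewrite -!hgradM// pD.
have e2 k : hgrad k (hgrad k p) x * D x + hgrad k p x * hgrad k D x +
    (hgrad k p x * hgrad k D x + p x * hgrad k (hgrad k D) x) =
    hgrad k (hgrad k v) x * v x + hgrad k v x * hgrad k v x +
    (hgrad k v x * hgrad k v x + v x * hgrad k (hgrad k v) x).
  have := congr1 (fun g => hgrad k g x) (funext (e1 k)).
  rewrite (hgradD _ _ (CkM (C1 k) CD1) (CkM Cp1 (C2 k))).
  rewrite (hgradD _ _ (CkM (C3 k) Cv1) (CkM Cv1 (C3 k))).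
  by rewrite (hgradM _ _ (C1 k) CD1) (hgradM _ _ Cp1 (C2 k)) (hgradM _ _ (C3 k) Cv1)
    (hgradM _ _ Cv1 (C3 k)).
have E0 : p x * D x = v x ^+ 2 by rewrite /p mulfVK ?gt_eqF.
have key k : 2 * v x * hgrad k (hgrad k v) x * D x - v x ^+ 2 * hgrad k (hgrad k D) x <=
    hgrad k (hgrad k p) x * D x ^+ 2.
  have := e1 k x; have := e2 k; move: E0 (D0 x).
  move: (hgrad k (hgrad k p) x) (hgrad k (hgrad k D) x) (hgrad k (hgrad k v) x)
    (hgrad k p x) (hgrad k D x) (hgrad k v x) (p x) (D x) (v x) =>
    p2 D2 v2 p1 D1 v1 p0 d w pd d0 h2 h1.
  rewrite -subr_ge0 -(pmulr_rge0 _ d0).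
  have -> : d * (p2 * d ^+ 2 - (2 * w * v2 * d - w ^+ 2 * D2)) = 2 * (d * v1 - w * D1) ^+ 2.
    have q2 : p2 * d = 2 * v1 ^+ 2 + 2 * w * v2 - 2 * (p1 * D1) - p0 * D2 by lra.
    have q1 : p1 * d = 2 * w * v1 - p0 * D1 by lra.
    rewrite -pd.
    have -> : d * (p2 * d ^+ 2 - (2 * w * v2 * d - p0 * d * D2)) =
      d ^+ 2 * (p2 * d - 2 * w * v2 + p0 * D2) by ring.
    rewrite q2 (_ : d ^+ 2 * _ = 2 * (d * v1) ^+ 2 - 2 * d * D1 * (p1 * d)); last by ring.
    rewrite q1 (_ : 2 * (d * v1 - w * D1) ^+ 2 = 2 * (d * v1) ^+ 2 - 4 * d * v1 * w * D1 +
      2 * w ^+ 2 * D1 ^+ 2); last by ring.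
    by rewrite -pd; ring.
  by rewrite mulr_ge0// sqr_ge0.
rewrite !sublapE mulr_suml !mulr_sumr mulr_suml -sumrB; apply: ler_sum => k _.
exact: key.
Qed.

(** Multiply [sublap_picone] by w >= 0 and use the square (D Delta v + v w)^2 >= 0. *)
Lemma picone_inequality v D x (w : R) : Ck setT 2 v -> Ck setT 2 D ->
  (forall y, 0 < D y) -> sublap D x = - w -> 0 <= w ->
  - (w * sublap (fun y => v y ^+ 2 / D y) x) <= sublap v x ^+ 2.
Proof.
move=> Cv CD D0 Dw w0; have := sublap_picone x Cv CD D0; rewrite Dw.
move: (sublap _ x) (sublap v x) (D0 x) => p s; move: (D x) (v x) => d t d0 h.
have d2 : 0 < d ^+ 2 by rewrite exprn_gt0.
rewrite -(ler_pM2r d2).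
have := ler_wpM2l w0 h; have := sqr_ge0 (d * s + t * w).
nra.
Qed.

End picone.

(** * The smoothed system and its limit *)

Section smoothed_system.
Context {R : realType} {n : nat}.
Local Notation H := (heisenberg R n).
Local Notation HM := ('rV[R]_n * 'rV[R]_n * measurableTypeR R)%type.
Implicit Types (x y z : H) (v w f h phi psi : H -> R) (k : 'I_n + 'I_n).
Variables (Omega : set H) (oOmega : open Omega) (M : R) (M0 : 0 < M).
Hypothesis OmegaM : Omega `<=` cbox M.
Variable i0 : 'I_n.

Let mOmega : measurable (Omega : set HM) := open_measurable_heisenberg oOmega.
Let vOmega : (vol (Omega : set HM) < +oo)%E := vol_bounded oOmega OmegaM.
Local Notation sqO g := (sq_int vol (Omega : set HM) g).
Local Notation ipO := (ip vol (Omega : set HM)).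
Local Notation test := (Cinfc Omega).
Local Notation T e g := (smoothing Omega g (kern e)).

Variables (u w g : H -> R) (su : sqO u) (sw : sqO w) (sg : sqO g).
Hypothesis uw : is_weak_sublap Omega u w.
Hypothesis wg : forall phi, sqO phi -> space_D Omega phi ->
  ipO w (weak_sublap Omega phi) = ipO g phi.
Hypothesis u_gt0 : ae_in Omega (fun x => 0 < u x).
Hypothesis g_ge0 : ae_in Omega (fun x => 0 <= g x).

Let Ck_mollify (m : nat) e f : sqO f -> Ck setT m (T e f).
Proof.
move=> sf; apply: (Ck_smoothing mOmega (@compact_cbox _ _ M) OmegaM); last exact: Ck_kern.
exact: (sq_int_intg mOmega vOmega sf).
Qed.

Let sublap_mollify e f x : sqO f -> sublap (T e f) x = ipO f (sublap (fun y => kern e (x, y))).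
Proof.
move=> sf; apply: (sublap_smoothing mOmega (@compact_cbox _ _ M) OmegaM).
- exact: (sq_int_intg mOmega vOmega sf).
- exact: Ck_kern.
- by move=> k; exact: flow_invariant_kern.
Qed.

Let u_ge0 : ae_in Omega (fun x => 0 <= u x).
Proof. by apply: ae_inS u_gt0 => x _ /ltW. Qed.

Let sqk e x : sqO (fun y => kern e (x, y)).
Proof.
have [B B0 hB] := compact_bound (@compact_cbox R n M) (Ck_cont (Ck_pairr x (Ck_kern 0 e))).
apply: (sq_int_bounded mOmega (B := B)) => //; last by move=> y /OmegaM; exact: hB.
by apply: measurable_funTS; exact: Ck_measurable (Ck_pairr x (Ck_kern 0 e)).
Qed.

Let mollify_ge0 e f x : 0 < e -> sqO f -> ae_in Omega (fun x => 0 <= f x) -> 0 <= T e f x.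
Proof.
move=> e0 sf f0; apply: (ip_ae_ge0 oOmega sf (sqk e x) f0) => y _; exact: kern_ge0.
Qed.

Section at_a_point.
Variables (e : R) (e0 : 0 < e) (x : H) (tk : test (fun y => kern e (x, y))).

(** Here [w] is Delta u, the negative of the function so named in the overview; this accounts for
    the signs below. *)
Lemma sublap_smoothed_u : sublap (T e u) x = T e w x.
Proof.
rewrite sublap_mollify//; apply: EFin_inj.
rewrite -(ipE mOmega su (Cinfc_sq oOmega OmegaM (Cinfc_sublap tk))) (uw tk).
exact: (ipE mOmega sw (sqk e x)).
Qed.

(** [wg] speaks of the chosen [weak_sublap] of a function of D; for the test function K(x, .) it
    agrees almost everywhere with the classical sublaplacian, which is what the smoothing
    produces. *)
Lemma sublap_smoothed_w : sublap (T e w) x = T e g x.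
Proof.
have sK := Cinfc_sq oOmega OmegaM (Cinfc_sublap tk).
have [sk _ aek] := weak_sublap_ae oOmega M0 OmegaM sK (Cinfc_weak_sublap tk).
rewrite sublap_mollify//; transitivity (ipO w (weak_sublap Omega (fun y => kern e (x, y)))).
  by rewrite ipC [RHS]ipC; apply/esym/ip_ae.
by rewrite wg//; exact: (Cinfc_space_D oOmega M0 OmegaM tk).
Qed.

Lemma smoothed_w_le0 : T e w x <= 0.
Proof.
have k0 y : Omega y -> 0 <= kern e (x, y) by move=> _; exact: kern_ge0.
have [phi [sp Dp p0 wp]] := dirichlet_solution oOmega M0 OmegaM i0 (sqk e x) k0.
have sN : sqO (fun y => - kern e (x, y)).
  have := sq_int_lin mOmega (-2) (sqk e x) (sqk e x); congr sq_int.
  by apply/funext => y; ring.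
have [sk _ aek] := weak_sublap_ae oOmega M0 OmegaM sN wp.
have : 0 <= ipO w (weak_sublap Omega phi) by rewrite wg//; exact: ip_ae_ge0.
have -> : ipO w (weak_sublap Omega phi) = ipO w (fun y => - kern e (x, y)).
  by rewrite ipC [RHS]ipC; exact: ip_ae.
rewrite (_ : (fun y => - kern e (x, y)) = (fun y => (-1) * kern e (x, y))); last first.
  by apply/funext => y; rewrite mulN1r.
by rewrite ipC ipZ// mulN1r oppr_ge0 ipC.
Qed.

End at_a_point.

Variables (v : H -> R) (Cv : Ckc Omega 2 v).

Lemma smoothed_stability : exists2 d : R, 0 < d & forall e, 0 < e -> e < d ->
  (\int[vol]_(x in (Omega : set HM)) (T e g x * (v x ^+ 2 / (T e u x + e)))%:E <=
   \int[vol]_(x in (Omega : set HM)) (sublap v x ^+ 2)%:E)%E.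
Proof.
have [C2v [K [cK KO Kv]]] := Cv; have [d d0 hd] := kern_Cinfc oOmega M0 OmegaM cK KO.
exists d => // e e0 ed.
have clK := compact_closed_heisenberg cK.
(* The smoothing scale doubles as the regularisation: [T e u] is nonnegative everywhere but may
   vanish, whereas the global C^2 regularity of [phi] demands a denominator positive on the whole
   space. *)
pose D y := T e u y + e.
have D0 y : 0 < D y by rewrite ltr_wpDl// mollify_ge0.
have C2D : Ck setT 2 D by apply: CkD; [exact: Ck_mollify|exact: Ck_cst].
pose phi y := v y ^+ 2 / D y.
have C2p : Ck setT 2 phi.
  by apply: CkM; [exact: CkX|apply: CkV => // y; rewrite gt_eqF].
have Kp : off K phi by move=> y nK; rewrite /phi Kv// expr0n mul0r.
have C2w : Ck setT 2 (T e w) by exact: Ck_mollify.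
have Kv2 : off K (fun x => sublap v x ^+ 2).
  by move=> y nK; rewrite (off_sublap clK Kv)// expr0n.
have KTp : off K (fun x => T e g x * phi x) by move=> y nK; rewrite Kp// mulr0.
rewrite (integral_Omega KO KTp) (integral_Omega KO Kv2).
have -> : (fun x : HM => (T e g x * phi x)%:E) = (fun x => (sublap (T e w) x * phi x)%:E).
  (* The smoothed equations are known on [K], where the kernel is a test function; off [K] the
     factor [phi] vanishes. *)
  apply/funext => x; have [Kx|nK] := pselect (K x); last by rewrite Kp// !mulr0.
  by rewrite sublap_smoothed_w//; exact: hd.
rewrite -(integral_sublap_sym cK (or_intror Kp) C2w C2p).
have i1 : vol.-integrable [set: HM] (fun x => (T e w x * sublap phi x)%:E).
  apply: (integrable_compact_support cK).
    exact: (Ck_cont (CkM (Ck_le (isT : (0 <= 2)%N) C2w) (Ck_sublap (m := 0) C2p))).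
  by move=> y nK; rewrite (off_sublap clK Kp)// mulr0.
have i2 : vol.-integrable [set: HM] (fun x => (sublap v x ^+ 2)%:E).
  apply: (integrable_compact_support cK) => //.
  exact: (Ck_cont (CkX 2 (Ck_sublap (m := 0) C2v))).
apply: (le_integral measurableT i1 i2) => x _; rewrite lee_fin.
have [Kx|nK] := pselect (K x); last first.
  by rewrite (off_sublap clK Kp)// (off_sublap clK Kv)// mulr0 expr0n.
have tk := hd e x e0 ed Kx.
have hD k : hgrad k D = hgrad k (T e u).
  by apply/funext => y; rewrite (hgradD k y (Ck_mollify 1 e su) (Ck_cst 1 e)) hgrad_cst addr0.
have DD : sublap D x = - - T e w x.
  rewrite opprK -(sublap_smoothed_u tk) !sublapE.
  by apply: eq_bigr => k _; rewrite hD.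
have := picone_inequality C2v C2D D0 DD; rewrite oppr_ge0 => /(_ (smoothed_w_le0 e0 x)).
by rewrite mulNr opprK.
Qed.

(** [G] is g v^2 / u made nonnegative and measurable everywhere, since u > 0 and g >= 0 are known
    only almost everywhere. *)
Lemma limit_stability : exists G : H -> R,
  [/\ measurable_fun (Omega : set HM) (G : HM -> R), forall x, 0 <= G x,
    ae_in Omega (fun x => G x = g x * (v x ^+ 2 / u x)) &
    (\int[vol]_(x in (Omega : set HM)) (G x)%:E <=
     \int[vol]_(x in (Omega : set HM)) (sublap v x ^+ 2)%:E)%E].
Proof.
have [C2v [K [cK KO Kv]]] := Cv.
have iu : vol.-integrable (Omega : set HM) (EFin \o u) := sq_int_intg mOmega vOmega su.
have ig : vol.-integrable (Omega : set HM) (EFin \o g) := sq_int_intg mOmega vOmega sg.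
have mv : measurable_fun (Omega : set HM) (v : HM -> R).
  by apply: measurable_funTS; exact: Ck_measurable C2v.
exists (fun x => `|g x| * (v x ^+ 2 * (`|u x| `^ (-1)))).
have [d d0 hd] := smoothed_stability.
have /cvgrPdist_lt/(_ _ d0)[N _ HN] := @cvg_eps R.
(* Both L^1 errors go into one sequence, so that a single subsequence gives convergence for [u] and
   [g]; the shift by [N] keeps every scale below [d]. *)
pose F m x : R := `|T (eps_ (m + N)) u x - u x| + `|T (eps_ (m + N)) g x - g x|.
have mT f m : vol.-integrable (Omega : set HM) (EFin \o f) ->
    measurable_fun (Omega : set HM) (fun x : HM => T (eps_ m) f x - f x).
  move=> if'; apply: measurable_funB; last exact: intg_meas if'.
  exact: (intg_meas (integrable_mollify oOmega OmegaM (eps_gt0 m) if')).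
have mF m : measurable_fun (Omega : set HM) (F m).
  by apply: measurable_funD; apply: measurableT_comp => //; exact: mT.
have F0 m x : Omega x -> 0 <= F m x by move=> _; rewrite addr_ge0.
have I0 f m : (0 <= \int[vol]_(x in (Omega : set HM)) `|T (eps_ m) f x - f x|%:E)%E.
  by apply: integral_ge0 => x _; rewrite lee_fin.
have cF : (\int[vol]_(x in (Omega : set HM)) (F m x)%:E)%E @[m --> \oo] --> 0%E.
  apply/cvge0_leP => [m|e e0].
    by apply: integral_ge0 => x Ox; rewrite lee_fin F0.
  have e2 : 0 < e / 2 by rewrite divr_gt0.
  have [N1 _ h1] := (cvge0_leP (I0 u)).1 (mollifier_cvg oOmega M0 OmegaM iu) _ e2.
  have [N2 _ h2] := (cvge0_leP (I0 g)).1 (mollifier_cvg oOmega M0 OmegaM ig) _ e2.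
  exists (maxn N1 N2) => // m /= Nm.
  have := h1 (m + N)%N; rewrite /= => /(_ (leq_trans (leq_trans (leq_maxl _ _) Nm) (leq_addr _ _))) k1.
  have := h2 (m + N)%N; rewrite /= => /(_ (leq_trans (leq_trans (leq_maxr _ _) Nm) (leq_addr _ _))) k2.
  under eq_integral do rewrite EFinD.
  rewrite ge0_integralD//; first by rewrite (splitr e) EFinD leeD.
  - by apply/measurable_EFinP; apply: measurableT_comp => //; exact: mT.
  - by apply/measurable_EFinP; apply: measurableT_comp => //; exact: mT.
have [s [ss hs]] := ae_subsequence mOmega mF F0 cF.
pose e_ m : R := eps_ (s m + N).
have e_0 m : 0 < e_ m by exact: eps_gt0.
have e_d m : e_ m < d.
  have := HN (s m + N)%N (leq_addl _ _).
  by rewrite sub0r normrN gtr0_norm ?eps_gt0.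
have e_cvg : e_ @ \oo --> 0.
  apply/cvgrPdist_lt => e e0; have /cvgrPdist_lt/(_ _ e0)[N1 _ h1] := @cvg_eps R.
  exists N1 => // m Nm; apply: h1; apply: (leq_trans Nm); apply: (leq_trans (ss m)).
  exact: leq_addr.
have mG : measurable_fun (Omega : set HM) (fun x : HM => `|g x| * (v x ^+ 2 * (`|u x| `^ (-1)))).
  apply: measurable_funM; first by apply: measurableT_comp => //; exact: sg.1.
  apply: measurable_funM; first exact: measurable_funX.
  apply: (measurableT_comp (measurable_powR _)).
  by apply: measurableT_comp => //; exact: su.1.
have GE x : 0 < u x -> 0 <= g x ->
    `|g x| * (v x ^+ 2 * (`|u x| `^ (-1))) = g x * (v x ^+ 2 / u x).
  by move=> u0 g0; rewrite ger0_norm// gtr0_norm// powR_inv1// ltW.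
have aeug := ae_inI u_gt0 g_ge0.
split => //.
- by move=> x; rewrite mulr_ge0// mulr_ge0 ?sqr_ge0 ?powR_ge0.
- by apply: ae_inS aeug => x _ [u0 g0]; exact: GE.
pose L := (\int[vol]_(x in (Omega : set HM)) (sublap v x ^+ 2)%R)%R.
have clK := compact_closed_heisenberg cK.
have iL : vol.-integrable (Omega : set HM) (fun x => (sublap v x ^+ 2)%:E).
  apply: (integrableS measurableT mOmega) => //; apply: (integrable_compact_support cK).
    exact: (Ck_cont (CkX 2 (Ck_sublap (m := 0) C2v))).
  by move=> y nK; rewrite (off_sublap clK Kv)// expr0n.
have LE : (\int[vol]_(x in (Omega : set HM)) (sublap v x ^+ 2)%:E = L%:E)%E.
  by rewrite /L /Rintegral fineK//; exact: (integrable_fin_num mOmega iL).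
rewrite LE.
apply: (@fatou_ae _ _ _ vol _ mOmega
    (fun m x => T (e_ m) g x * (v x ^+ 2 / (T (e_ m) u x + e_ m))) _ (fun=> L)) => //.
- move=> m; apply: (continuous_measurable_heisenberg oOmega) => x _.
  apply: (Ck_at (k := 0)); apply: CkM; first exact: Ck_mollify.
  apply: CkM; first exact: CkX (Ck_le _ C2v).
  apply: CkV; last by apply: CkD; [exact: Ck_mollify|exact: Ck_cst].
  by move=> y; rewrite gt_eqF// ltr_wpDl// mollify_ge0.
- move=> m x _; rewrite mulr_ge0 ?mollify_ge0// divr_ge0 ?sqr_ge0//.
  by rewrite addr_ge0 ?mollify_ge0// ltW.
- have hs' : ae_in Omega (fun x => F (s m) x @[m --> \oo] --> 0) := hs.
  suff : ae_in Omega (fun x =>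
      (T (e_ m) g x * (v x ^+ 2 / (T (e_ m) u x + e_ m))) @[m --> \oo] -->
      `|g x| * (v x ^+ 2 * (`|u x| `^ (-1)))) by [].
  apply: ae_inS (ae_inI aeug hs') => x Ox [[ux0 gx0] Fx].
  rewrite GE//.
  have cT f : (forall m, `|T (e_ m) f x - f x| <= F (s m) x) ->
      T (e_ m) f x @[m --> \oo] --> f x.
    move=> fF; apply/subr_cvg0/norm_cvg0P.
    apply: (squeeze_cvgr _ (cvg_cst 0) Fx); apply: nearW => m.
    by rewrite fF andbT.
  have cu : T (e_ m) u x @[m --> \oo] --> u x by apply: cT => m; rewrite lerDl.
  have cg : T (e_ m) g x @[m --> \oo] --> g x by apply: cT => m; rewrite lerDr.
  apply: cvgM => //; apply: cvgM; first exact: cvg_cst.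
  apply: cvgV; first by rewrite gt_eqF.
  by rewrite -[X in _ --> X]addr0; exact: cvgD.
- by move=> m; rewrite -LE; exact: hd.
- exact: cvg_cst.
Qed.

End smoothed_system.

(** * Comparison with the integral of the derivative of f, and conclusion *)

Lemma ae_le_integral {R : realType} d (T : measurableType d)
    (mu : {measure set T -> \bar R}) (D : set T) (f1 f2 : T -> R) :
  measurable D -> mu.-integrable D (EFin \o f1) -> measurable_fun D f2 ->
  {ae mu, forall x, D x -> f1 x <= f2 x} ->
  (\int[mu]_(x in D) (f1 x)%:E <= \int[mu]_(x in D) (f2 x)%:E)%E.
Proof.
move=> mD i1 m2 f12.
have m1 : measurable_fun D (EFin \o f1) by have /integrableP[] := i1.
have m2' : measurable_fun D (EFin \o f2) by exact/measurable_EFinP.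
rewrite integralE [leRHS]integralE leeB//.
- apply: ae_ge0_le_integral => //.
  + exact: measurable_funepos.
  + exact: measurable_funepos.
  + apply: filterS f12 => x h Dx; rewrite !funeposE -!EFin_max lee_fin.
    by rewrite ge_max !le_max lexx orbT h.
- apply: ae_ge0_le_integral => //.
  + exact: measurable_funeneg.
  + exact: measurable_funeneg.
  + apply: filterS f12 => x h Dx; rewrite !funenegE -!EFinN -!EFin_max lee_fin.
    by rewrite ge_max !le_max lexx orbT lerN2 h.
Qed.

(** Presents the partial derivative of f at [u] as a limit of a sequence of measurable quotients,
    whence its measurability. *)
Lemma derivative_cvg_eps {R : realType} (f : R -> R) (y : R) : derivable f y 1 ->
  (eps_ m)^-1 * (f (eps_ m + y) - f y) @[m --> \oo] --> f^`()%classic y.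
Proof.
move=> df; rewrite derive1E.
have h : h^-1 *: (f (h *: 1 + y) - f y) @[h --> 0^'] --> 'D_1 f y := df.
have e0 : @eps_ R @ \oo --> 0^'.
  move=> P hP; have hm : \forall m \near \oo, eps_ m != 0 -> P (eps_ m) := @cvg_eps R _ hP.
  by apply: filterS hm => m; apply; rewrite gt_eqF// eps_gt0.
have := cvg_comp _ _ e0 h; apply: cvg_trans; apply: near_eq_cvg.
by apply: nearW => m; rewrite /= /GRing.scale /= mulr1.
Qed.

Theorem theorem1p3 (R : realType) (n : nat) (n_ge1 : (1 <= n)%N)
  (Omega : set (heisenberg R n)) (oOmega : open Omega)
  (sOmega : smooth_boundary Omega) (bOmega : bounded_set Omega)
  (a : heisenberg R n -> R) (aLoo : space_L Omega +oo%E a)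
  (f : heisenberg R n -> R -> R)
  (fC : {within closure Omega `*` [set: R],
           continuous (fun p : heisenberg R n * R => f p.1 p.2)})
  (fC1 : forall xi, Omega xi ->
     (forall y : R, derivable (f xi) y 1) /\ continuous (f xi)^`()%classic)
  (fA : forall xi, Omega xi -> forall y : R, 0 < y ->
     f xi y / y <= (f xi)^`()%classic y)
  (q : R) (q_ge1 : 1 <= q)
  (r : heisenberg R n -> R)
  (rq : space_L Omega q%:E r) (rq' : space_L Omega (hoelder_conjugate q%:E) r)
  (c : R) (c_gt0 : 0 < c)
  (c_emb : R) (c_embP : embedding_constant Omega q c_emb)
  (c_small : ((c%:E + norm_L Omega +oo a) * (c_emb ^+ 2)%:E < 1)%E)
  (fB1 : n = 1%N ->
     ae_in Omega (fun xi => forall s : R,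
       `|f xi s| <= r xi + c * `|s| `^ (q - 1)))
  (fB2 : (1 < n)%N ->
     let Q := (homogeneous_dim n)%:R : R in
     q < (Q + 4) / (Q - 4) /\
     ae_in Omega (fun xi => forall s : R, `|f xi s| <= r xi + c * `|s| `^ q))
  (fCond : ae_in Omega (fun xi => forall s : R, 0 <= a xi * s - f xi s))
  (u : heisenberg R n -> R) (uLoo : space_L Omega +oo%E u)
  (u_sol : weak_solution Omega a f u)
  (u_gt0 : ae_in Omega (fun xi => 0 < u xi)) :
  semi_stable Omega a f u.
Proof.
move=> v Cv; have [M M0 OmegaM] := bounded_cbox bOmega.
set HM := ('rV[R]_n * 'rV[R]_n * measurableTypeR R)%type.
have mO : measurable (Omega : set HM) := open_measurable_heisenberg oOmega.
have vO : (vol (Omega : set HM) < +oo)%E := vol_bounded oOmega OmegaM.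
pose i0 : 'I_n := Ordinal n_ge1.
have [Ba Ba0 aB] := space_Loo_bounded aLoo; have [ma _] := aLoo.
have [Bu Bu0 uB] := space_Loo_bounded uLoo; have [mu _] := uLoo.
have [C fB] := continuous_nonlinearity_bounded OmegaM Bu fC.
have cf x : Omega x -> continuous (f x).
  move=> Ox y; have [df _] := fC1 x Ox.
  by apply: differentiable_continuous; apply/derivable1_diffP; exact: df.
have mf (w : heisenberg R n -> R) : measurable_fun (Omega : set HM) w ->
    measurable_fun (Omega : set HM) (fun x : HM => f x (w x)).
  move=> mw; apply: measurable_substitution => //.
  by move=> s; exact: (continuous_nonlinearity_measurable oOmega s fC).
have mfu := mf _ mu.
have su : sq_int vol (Omega : set HM) u := sq_int_ae_bounded oOmega OmegaM mu uB.
have sa : sq_int vol (Omega : set HM) a := sq_int_ae_bounded oOmega OmegaM ma aB.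
have sau : sq_int vol (Omega : set HM) (fun x => a x * u x).
  apply: (sq_int_ae_bounded (B := Ba * Bu) oOmega OmegaM); first exact: measurable_funM.
  by apply: ae_inS (ae_inI aB uB) => x _ [? ?]; rewrite normrM ler_pM.
have sfu : sq_int vol (Omega : set HM) (fun x => f x (u x)).
  apply: (sq_int_ae_bounded (B := C) oOmega OmegaM) => //.
  by apply: ae_inS uB => x Ox ux; exact: fB.
pose g x := a x * u x - f x (u x).
have sg : sq_int vol (Omega : set HM) g by exact: sq_intB.
have g0 : ae_in Omega (fun x => 0 <= g x) by apply: ae_inS fCond => x _; exact.
have [[[_ _ [w0 [/space_L2P sw0 uw0]]] _] eqn] := u_sol.
have [sw uw _] := weak_sublap_ae oOmega M0 OmegaM sw0 uw0.
(* Testing with all of D, and not only with compactly supported functions, is what encodes Delta u =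
   0 on the boundary. *)
have wg phi : sq_int vol (Omega : set HM) phi -> space_D Omega phi ->
    ip vol (Omega : set HM) (weak_sublap Omega u) (weak_sublap Omega phi) =
    ip vol (Omega : set HM) g phi.
  move=> sp Dp; have [[_ _ [w1 [/space_L2P sw1 pw1]]] _] := Dp.
  have [swp _ _] := weak_sublap_ae oOmega M0 OmegaM sw1 pw1.
  apply: EFin_inj; rewrite -(ipE mO sw swp).
  have := eqn _ Dp; rewrite /inner_D => ->.
  rewrite (ipE mO sau sp) (ipE mO sfu sp) -EFinB; congr EFin.
  rewrite (_ : g = (fun x => (-1) * f x (u x) + a x * u x)); last first.
    by apply/funext => x; rewrite mulN1r addrC.
  by rewrite ip_lin// mulN1r addrC.
have [G [mG G0 GE GL]] := limit_stability oOmega M0 OmegaM i0 su sw sg uw wg u_gt0 g0 Cv.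
have [C2v [K [cK KO Kv]]] := Cv.
have clK := compact_closed_heisenberg cK.
have iL : vol.-integrable (Omega : set HM) (fun x => (sublap v x ^+ 2)%:E).
  apply: (integrableS measurableT mO) => //; apply: (integrable_compact_support cK).
    exact: (Ck_cont (CkX 2 (Ck_sublap (m := 0) C2v))).
  by move=> y nK; rewrite (off_sublap clK Kv)// expr0n.
have sv2 : sq_int vol (Omega : set HM) (fun x => v x ^+ 2).
  have Cv2 := CkX 2 C2v.
  have [|B B0 hB] := off_bound cK (Ck_cont Cv2).
    by move=> y nK; rewrite Kv// expr0n.
  apply: (sq_int_bounded mO (B := B)) => //.
  by apply: measurable_funTS; exact: Ck_measurable Cv2.
have iA := sq_intM mO sa sv2.
have iG : vol.-integrable (Omega : set HM) (EFin \o G).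
  apply/integrableP; split; first exact/measurable_EFinP.
  under eq_integral do rewrite /= ger0_norm//.
  by apply: (le_lt_trans GL); rewrite -ge0_fin_numE ?(integrable_fin_num mO iL)//;
    apply: integral_ge0 => x _; rewrite lee_fin sqr_ge0.
have mfd : measurable_fun (Omega : set HM) (fun x : HM => (f x)^`()%classic (u x)).
  apply: (@measurable_fun_cvg _ _ _ _
    (fun m x => (eps_ m)^-1 * (f x (eps_ m + u x) - f x (u x)))) => [m|x Ox].
    apply: measurable_funM => //; apply: measurable_funB => //.
    by apply: mf; exact: measurable_funD.
  by apply: derivative_cvg_eps; have [+ _] := fC1 x Ox; exact.
(* The left-hand side is f(., u) v^2 / u, written as a difference of integrable functions. The
   right-hand side need not be integrable, and [ae_le_integral] asks only for its measurability. *)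
have fd_ge : ae_in Omega (fun x => a x * v x ^+ 2 - G x <= (f x)^`()%classic (u x) * v x ^+ 2).
  apply: ae_inS (ae_inI GE u_gt0) => x Ox [-> ux].
  apply: le_trans (ler_wpM2r (sqr_ge0 (v x)) (fA x Ox _ ux)).
  rewrite /g le_eqVlt; apply/orP; left; apply/eqP; field; exact: lt0r_neq0.
have mfdv : measurable_fun (Omega : set HM) (fun x : HM => (f x)^`()%classic (u x) * v x ^+ 2).
  by apply: measurable_funM => //; exact: sv2.1.
have := ae_le_integral mO (intgB mO iA iG) mfdv fd_ge.
under eq_integral do rewrite EFinB.
rewrite (integralB mO iA iG).
have -> : (fun x : HM => (`|sublap v x| ^+ 2)%:E) = (fun x => (sublap v x ^+ 2)%:E).
  by apply/funext => x; rewrite real_normK ?num_real.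
move: GL.
rewrite -(fineK (integrable_fin_num mO iL)) -(fineK (integrable_fin_num mO iA))
  -(fineK (integrable_fin_num mO iG)) -EFinB -EFinN -EFinD.
move: (fine _) (fine _) (fine _) => l b c0.
(* The lower bound excludes the value -oo, and +oo makes the claim trivial because the other two
   integrals are finite. *)
case: (\int[vol]_(x in Omega) ((f x)^`()%classic (u x) * v x ^+ 2)%:E)%E => [r0| |] //=.
  rewrite -EFinD !lee_fin => h1 h2; have := lerD h1 h2.
  by rewrite addrC subrK => h3; rewrite addrAC subr_ge0.
by rewrite addey.
Qed.
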